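(* Let $K/F$ be a Galois extension with $\mathrm{Gal}(K/F)=\langle\sigma\rangle\simeq G=\mathbb{Z}/p^n\mathbb{Z}$. Let $A\subseteq J(K)$ be a finite $\mathbb{F}_p[G]$-submodule and $L$ the corresponding extension. Let $M$ be a finite $\mathbb{F}_p[G]$-module and $\mu\in\{1,\dots,p^n\}$ such that $\mu=p^n$ or $M$ has a cyclic direct summand of $\mathbb{F}_p$-dimension $\mu$. Then $L$ solves the embedding problem $M\bullet_\mu G\to G\to1$ over $K/F$ if and only if $A\simeq M$ as $\mathbb{F}_p[G]$-modules and $\mu=\lambda(A)$.
   Context: $J(K)$: if $\mathrm{char}K\ne p$, let $\hat K=K(\xi_p)$, $\hat F=F(\xi_p)$ ($\xi_p$ a primitive $p$-th root of unity); restriction identifies $\mathrm{Gal}(\hat K/\hat F)$ with $G$ (we write $\sigma$ for the generator restricting to $\sigma$); let $\epsilon$ generate $\mathrm{Gal}(\hat K/K)$ with $\epsilon(\xi_p)=\xi_p^t$; $J(K)$ is the $t$-eigenspace of $\epsilon$ on $\hat K^\times/\hat K^{\times p}$. If $\mathrm{char}K=p$, $J(K)=K/\wp(K)$ with $\wp(K)=\{k^p-k:k\in K\}$, and $\rho(k)$ denotes a root of $x^p-x-k$. $J(K)$ is an $\mathbb{F}_p[G]$-module. A finite submodule $A$ corresponds to the extension $L$ = the maximal $p$-extension of $K$ inside $\hat K(\sqrt[p]{a}:a\in A)$ (char $\ne p$), resp. $L=K(\rho(a):a\in A)$ (char $p$); $L/F$ is Galois. The length $\ell(\alpha)=\dim_{\mathbb{F}_p}\mathbb{F}_p[G]\alpha$.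 For $\alpha\in J(K)$ with $\ell(\alpha)<p^n$ the index $e(\alpha)\in\mathbb{F}_p$ is: if $\mathrm{char}K\ne p$, with $a\in\hat K^\times$ representing $\alpha$ and $\gamma$ a $p$-th root of $N_{\hat K/\hat F}(a)$ (which lies in $\hat K$), $\xi_p^{e(\alpha)}=\sigma(\gamma)/\gamma$; if $\mathrm{char}K=p$, $e(\alpha)=\sigma(\rho(\mathrm{Tr}_{K/F}a))-\rho(\mathrm{Tr}_{K/F}a)$ (here $\rho(\mathrm{Tr}_{K/F}a)\in K$). $\lambda(A)=\min\{\ell(\alpha):\alpha\in A,\ \ell(\alpha)<p^n,\ e(\alpha)\ne0\}$ if this set is nonempty, else $\lambda(A)=p^n$. Group $M\bullet_\mu G$: fix a decomposition $M=\bigoplus\mathbb{F}_p[G]\alpha_i$ into cyclic modules; for $\mu<p^n$ choose $\alpha_{i_0}$ of dimension $\mu$; $M\bullet_\mu G$ is generated by $M$ and $\hat\sigma$ with the relations of $M$, $\hat\sigma m\hat\sigma^{-1}=\sigma m$, $\hat\sigma^{p^n}=(\sigma-1)^{\mu-1}\alpha_{i_0}$; $M\bullet_{p^n}G=M\rtimes G$ ($\hat\sigma^{p^n}=1$); the map to $G$ kills $M$ and sends $\hat\sigma\mapsto\sigma$. $L$ solves the embedding problem $\varphi:\hat G\to G$ over $K/F$ if there is an isomorphism $\psi:\mathrm{Gal}(L/F)\to\hat G$ with $\varphi\circ\psi$ equal to restriction to $\mathrm{Gal}(K/F)=G$. *)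

(* Defs.v *)
From HB Require Import structures.
From mathcomp Require Import all_boot all_order all_algebra all_fingroup.
From mathcomp Require Import all_solvable all_field generic_quotient ring_quotient.
From mathcomp Require Import boolp classical_sets cardinality.

Set Implicit Arguments.
Unset Strict Implicit.
Unset Printing Implicit Defensive.

Import GRing.Theory.
Local Open Scope ring_scope.
Local Open Scope quotient_scope.
Local Open Scope classical_set_scope.

(* The multiplicative group of a field, written additively: 0 is the unit 1,
   x + y is the product, x *+ n is the n-th power. *)
Section Units.
Variable E : fieldType.

Record units := Units { uval : E; uvalP : uval != 0 }.
HB.instance Definition _ := [isSub for uval].
HB.instance Definition _ := [Choice of units by <:].

Definition units_one := Units (oner_neq0 E).
Fact units_mul_subproof (x y : units) : uval x * uval y != 0.
Proof. by rewrite mulf_neq0 ?uvalP. Qed.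
Definition units_mul x y := Units (units_mul_subproof x y).
Fact units_inv_subproof (x : units) : (uval x)^-1 != 0.
Proof. by rewrite invr_eq0 uvalP. Qed.
Definition units_inv x := Units (units_inv_subproof x).

Fact units_mulA : associative units_mul.
Proof. by move=> x y z; apply: val_inj; rewrite /= mulrA. Qed.
Fact units_mulC : commutative units_mul.
Proof. by move=> x y; apply: val_inj; rewrite /= mulrC. Qed.
Fact units_mul1 : left_id units_one units_mul.
Proof. by move=> x; apply: val_inj; rewrite /= mul1r. Qed.
Fact units_mulV : left_inverse units_one units_inv units_mul.
Proof. by move=> x; apply: val_inj; rewrite /= mulVf ?uvalP. Qed.
HB.instance Definition _ :=
  GRing.isZmodule.Build units units_mulA units_mulC units_mul1 units_mulV.

Lemma uvalD (x y : units) : uval (x + y) = uval x * uval y. Proof. by []. Qed.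
Lemma uvalMn (x : units) n : uval (x *+ n) = uval x ^+ n.
Proof. by elim: n => [|n IHn]; rewrite ?mulr0n // mulrS uvalD IHn exprS. Qed.

Definition ppowers (p : nat) : {pred units} :=
  fun x => `[< exists y : units, x = y *+ p >].
Variable p : nat.
Fact ppowers_closed : zmod_closed (ppowers p).
Proof.
split=> [|x y /asboolP[u ->] /asboolP[v ->]]; apply/asboolP.
  by exists 0; rewrite mul0rn.
by exists (u - v); rewrite mulrnBl.
Qed.
HB.instance Definition _ :=
  GRing.isZmodClosed.Build units (ppowers p) ppowers_closed.
Fact ppowers_mulrn (x : units) : x *+ p \in (ppowers p : {pred units}).
Proof. by apply/asboolP; exists x. Qed.
End Units.

Section ArtinSchreier.
Variables (E : fieldType) (p : nat) (chE : p \in [pchar E]).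

(* The proof of char E = p is carried so that the image of k |-> k ^ p - k has
   its subgroup structure attached. *)
Definition wp_image of p \in [pchar E] : {pred E} :=
  fun x => `[< exists k : E, x = k ^+ p - k >].
Fact wp_closed : zmod_closed (wp_image chE).
Proof.
split=> [|x y /asboolP[u ->] /asboolP[v ->]]; apply/asboolP.
  by exists 0; rewrite expr0n subr0 gtn_eqF ?(prime_gt0 (pcharf_prime chE)).
exists (u - v); have := pFrobenius_autB_comm chE (mulrC u v).
by rewrite !pFrobenius_autE => ->; rewrite !opprD !opprK addrACA.
Qed.
HB.instance Definition _ :=
  GRing.isZmodClosed.Build E (wp_image chE) wp_closed.
Fact wp_mulrn (x : E) : x *+ p \in (wp_image chE : {pred E}).
Proof. by rewrite mulrn_pchar //; have [] := wp_closed. Qed.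
End ArtinSchreier.

(* The quotient V / S, which is an F_p-vector space since p V is inside S. *)
Section FpQuotient.
Variables (p : nat) (V : zmodType).

Definition fpquot of prime p := fun (S : zmodClosed V)
  of (forall x : V, x *+ p \in (S : {pred V})) => Quotient.quot S.

Variables (p_pr : prime p) (S : zmodClosed V).
Variable pS : forall x : V, x *+ p \in (S : {pred V}).
Local Notation Q := (fpquot p_pr pS).

HB.instance Definition _ := GRing.Zmodule.on Q.

Definition fpclass (x : V) : Q := \pi_(Quotient.quot S) x.
Definition fprepr (x : Q) : V := repr (x : Quotient.quot S).

Lemma fpreprK : cancel fprepr fpclass.
Proof. by move=> x; rewrite /fpclass reprK. Qed.
Lemma fpclassE x y : (fpclass x == fpclass y) = (x - y \in S).
Proof. by rewrite Quotient.idealrBE. Qed.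
Lemma fpclassD x y : fpclass (x + y) = fpclass x + fpclass y.
Proof. exact: (raddfD (\pi_(Quotient.quot S))). Qed.
Lemma fpclass0 : fpclass 0 = 0.
Proof. exact: (raddf0 (\pi_(Quotient.quot S))). Qed.
Lemma fpclassMn x m : fpclass (x *+ m) = fpclass x *+ m.
Proof.
by elim: m => [|m IHm]; rewrite ?mulr0n ?fpclass0 // !mulrS fpclassD IHm.
Qed.

Fact fpquot_mulrn (x : Q) : x *+ p = 0.
Proof.
by rewrite -[x]fpreprK -fpclassMn -fpclass0; apply/eqP; rewrite fpclassE subr0.
Qed.
Fact fpquot_modn (x : Q) m : x *+ (m %% p)%N = x *+ m.
Proof.
by rewrite [in RHS](divn_eq m p) mulrnDr mulnC mulrnA fpquot_mulrn mul0rn add0r.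
Qed.

Definition fpscale (a : 'F_p) (x : Q) : Q := x *+ a.
Fact fpscaleA a b x : fpscale a (fpscale b x) = fpscale (a * b) x.
Proof.
rewrite /fpscale -mulrnA mulnC -[LHS]fpquot_modn.
by congr (_ *+ _); congr (_ %% _)%N; rewrite Fp_cast.
Qed.
Fact fpscale1 : left_id 1 fpscale.
Proof.
move=> x; rewrite /fpscale -[RHS]mulr1n -[RHS]fpquot_modn.
by congr (_ *+ _); congr (_ %% _)%N; rewrite Fp_cast.
Qed.
Fact fpscaleDr : right_distributive fpscale +%R.
Proof. by move=> a x y; rewrite /fpscale mulrnDl. Qed.
Fact fpscaleDl x : {morph fpscale^~ x : a b / a + b}.
Proof.
move=> a b; rewrite /fpscale -mulrnDr -[RHS]fpquot_modn.
by congr (_ *+ _); congr (_ %% _)%N; rewrite Fp_cast.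
Qed.
HB.instance Definition _ := GRing.Zmodule_isLmodule.Build 'F_p Q
  fpscaleA fpscale1 fpscaleDr fpscaleDl.
End FpQuotient.

Section FiniteModule.
Variables (p : nat) (p_pr : prime p) (M : vectType 'F_p) (s : 'End(M)).

(* An F_p[G]-module, for G cyclic of order N with generator sigma, is a vector
   space with an endomorphism s (the action of sigma) such that s ^ N = 1; the
   submodule generated by a is spanned by the s ^ i a, i < N. *)
Definition cyclicv (N : nat) (a : M) : {vspace M} :=
  <<[seq iter i s a | i <- iota 0 N]>>%VS.

Definition cyclic_decomposition (N r : nat) (alpha : 'I_r -> M) : Prop :=
  directv (\sum_(i < r) cyclicv N (alpha i))%VS
  /\ (\sum_(i < r) cyclicv N (alpha i))%VS = fullv.

Definition has_cyclic_summand (N mu : nat) : Prop :=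
  exists b : M, exists W : {vspace M},
    [/\ (s @: W <= W)%VS, directv (cyclicv N b + W)%VS,
        (cyclicv N b + W)%VS = fullv & \dim (cyclicv N b) = mu].

Definition sub1 (x : M) : M := s x - x.

(* The value of sigma^ ^ (p ^ n) in M *_mu G, a being the chosen generator
   alpha_{i_0}; a plays no role when mu = p ^ n. *)
Definition bullet_pow (n mu : nat) (a : M) : M :=
  if (mu < p ^ n)%N then iter mu.-1 sub1 a else 0.

Let sub1D x y : sub1 (x + y) = sub1 x + sub1 y.
Proof. by rewrite /sub1 linearD opprD addrACA. Qed.

Let Mp (x : M) : x *+ p = 0.
Proof. by rewrite -scaler_nat (pcharf0 (pchar_Fp p_pr)) scale0r. Qed.

Lemma iter_frobenius (f g : M -> M) :
    (forall x y, g (x + y) = g x + g y) -> (forall x, f x = x + g x) ->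
  forall x, iter p f x = x + iter p g x.
Proof.
move=> gD fE x.
have g0 : g 0 = 0 by apply: (addrI (g 0)); rewrite -gD !addr0.
have gMn k y : g (y *+ k) = g y *+ k.
  by elim: k => [|k IHk]; rewrite ?mulr0n // !mulrS gD IHk.
have bin k : iter k f x = \sum_(i < k.+1) iter i g x *+ 'C(k, i).
  elim: k => [|k IHk]; first by rewrite big_ord1 mulr1n.
  rewrite iterS fE IHk (big_morph g gD g0) big_ord_recl [in RHS]big_ord_recl.
  rewrite !bin0 -addrA.
  congr (_ + _).
  rewrite [in RHS](eq_bigr (fun i : 'I_k.+1 =>
    iter i.+1 g x *+ 'C(k, i.+1) + iter i.+1 g x *+ 'C(k, i))); last first.
    by move=> i _; rewrite lift0 binS mulrnDr.
  rewrite big_split /=; congr (_ + _).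
    rewrite [RHS]big_ord_recr /= bin_small // mulr0n addr0.
    by apply: eq_bigr => i _.
  by apply: eq_bigr => i _; rewrite gMn.
have p_gt0 := prime_gt0 p_pr.
rewrite bin (bigD1 ord0) //= (bigD1 ord_max) /= ?bin0 ?binn ?mulr1n; last first.
  by rewrite -val_eqE /= -lt0n.
rewrite big1 ?addr0 // => i; rewrite -!val_eqE /= => /andP[i0 ip].
have : (p %| 'C(p, i))%N.
  by rewrite prime_dvd_bin // lt0n i0 ltn_neqAle ip -ltnS ltn_ord.
by case/dvdnP=> c ->; rewrite mulnC mulrnA Mp mul0rn.
Qed.

Lemma iter_pfrobenius n x : iter (p ^ n) s x = x + iter (p ^ n) sub1 x.
Proof.
elim: n x => [|n IHn] x; first by rewrite expn0 /= /sub1 addrC subrK.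
rewrite expnS mulnC.
have iterM k q (f : M -> M) y : iter (k * q) f y = iter q (iter k f) y.
  by elim: q y => [|q IHq] y; rewrite ?muln0 // mulnS iterD IHq.
rewrite !iterM; apply: iter_frobenius => // y z.
by elim: (p ^ n)%N => //= k ->; rewrite sub1D.
Qed.

Lemma cyclicv_stable N a : (0 < N)%N -> (forall x, iter N s x = x) ->
  (s @: cyclicv N a <= cyclicv N a)%VS.
Proof.
move=> N_gt0 sN; rewrite limg_span; apply/span_subvP => y /mapP[z].
case/mapP=> i; rewrite mem_iota /= add0n => lt_iN -> ->.
apply: memv_span; have [lt|ge] := ltnP i.+1 N.
  by apply/mapP; exists i.+1; rewrite ?mem_iota.
have <- : i.+1 = N by apply/eqP; rewrite eqn_leq lt_iN.
apply/mapP; exists 0; rewrite ?mem_iota //=.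
by rewrite -[RHS]sN; have -> : N = i.+1 by apply/eqP; rewrite eqn_leq ge.
Qed.

Lemma mem_cyclicv N a : (0 < N)%N -> a \in cyclicv N a.
Proof.
by move=> N_gt0; apply: memv_span; apply/mapP; exists 0; rewrite ?mem_iota.
Qed.

Lemma iter_sub1_dim n (W : {vspace M}) m : (forall x, iter (p ^ n) s x = x) ->
  (s @: W <= W)%VS -> (\dim W <= m)%N -> {in W, forall x, iter m sub1 x = 0}.
Proof.
move=> sN; elim: m W => [|m IHm] W sW dW x Wx.
  move: dW; rewrite leqn0 dimv_eq0 => /eqP W0; move: Wx.
  by rewrite W0 memv0 => /eqP.
pose N := (s - \1)%VF; have NE y : N y = sub1 y by rewrite add_lfunE opp_lfunE id_lfunE.
have NW : (N @: W <= W)%VS.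
  apply/subvP=> _ /memv_imgP[y Wy ->]; rewrite NE rpredB //.
  by apply: (subvP sW); apply: memv_img.
rewrite iterSr -NE; apply: (IHm (N @: W)%VS); last exact: memv_img.
  apply/subvP=> _ /memv_imgP[_ /memv_imgP[y Wy ->] ->].
  have -> : s (N y) = N (s y) by rewrite !NE /sub1 linearB.
  by apply/memv_img/(subvP sW)/memv_img.
have [eqNW|neqNW] := eqVneq (N @: W)%VS W; last first.
  rewrite -ltnS; apply: leq_trans dW; rewrite ltn_neqAle dimvS // andbT.
  by apply: contra neqNW => eqd; rewrite eqEdim NW (eqP eqd) leqnn.
suff -> : (N @: W)%VS = 0%VS by rewrite dimv0.
apply/eqP; rewrite eqNW -subv0; apply/subvP=> y Wy; rewrite memv0.
have surj k z : z \in W -> exists2 w, w \in W & iter k sub1 w = z.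
  elim: k z => [|k IHk] z Wz; first by exists z.
  move: (Wz); rewrite -{1}eqNW => /memv_imgP[w Ww ->].
  by have [v Wv <-] := IHk w Ww; exists v; rewrite // NE.
have [w _ <-] := surj (p ^ n)%N y Wy; apply/eqP/(addrI w).
by rewrite -iter_pfrobenius sN addr0.
Qed.

Lemma bullet_pow_fixed n mu a : (forall x, iter (p ^ n) s x = x) ->
    (0 < mu)%N -> ((mu < p ^ n)%N -> \dim (cyclicv (p ^ n) a) = mu) ->
  s (bullet_pow n mu a) = bullet_pow n mu a.
Proof.
move=> sN mu_gt0 dima; rewrite /bullet_pow; case: ifP => [lt_mu|_]; last first.
  exact: linear0.
have pn_gt0 : (0 < p ^ n)%N by rewrite expn_gt0 prime_gt0.
apply/eqP; rewrite -subr_eq0; apply/eqP.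
have -> : forall y, s y - y = sub1 y by [].
rewrite -iterS prednK //.
apply: (@iter_sub1_dim n (cyclicv (p ^ n) a)) => //; last exact: mem_cyclicv.
  exact: cyclicv_stable.
by rewrite dima.
Qed.
End FiniteModule.

(* The group generated by M and an element g subject to the relations of M,
   g m g^-1 = s m and g ^ N = c.  The pair (m, i) stands for m g ^ i, so that
   m g ^ i m' g ^ j = (m + s ^ i m') g ^ (i + j), with a factor c for each
   extraction of g ^ N.  See cext_relations and cext_universal. *)
Section CyclicExtension.
Variables (k : fieldType) (M : vectType k) (s : 'End(M)) (N : nat) (c : M).

Definition cext of (0 < N)%N & (forall x, iter N s x = x) & s c = c : Type :=
  (M * 'I_N)%type.

Variables (N_gt0 : (0 < N)%N) (sN : forall x, iter N s x = x) (sc : s c = c).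
Local Notation H := (cext N_gt0 sN sc).

HB.instance Definition _ := Choice.on H.

Definition cext_ord (i : nat) : 'I_N := Ordinal (ltn_pmod i N_gt0).
Definition cext_one : H := (0, cext_ord 0).
Definition cext_mul (x y : H) : H :=
  (x.1 + iter x.2 s y.1 + c *+ ((x.2 + y.2) %/ N), cext_ord (x.2 + y.2)).
Definition cext_inv (x : H) : H :=
  (- (iter (N - x.2) s x.1) - c *+ (((N - x.2) %% N + x.2) %/ N),
   cext_ord (N - x.2)).

Let iterD' i x y : iter i s (x + y) = iter i s x + iter i s y.
Proof. by elim: i => //= i ->; rewrite linearD. Qed.
Let iter0 i : iter i s (0 : M) = 0.
Proof. by elim: i => //= i ->; rewrite linear0. Qed.
Let iterc i m : iter i s (c *+ m) = c *+ m.
Proof. by elim: i => //= i ->; rewrite linearMn /= sc. Qed.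
Let iter_mod i x : iter (i %% N) s x = iter i s x.
Proof.
rewrite [in RHS](divn_eq i N) addnC iterD; congr (iter _ _ _).
by elim: (i %/ N)%N => // q {1}->; rewrite mulSn iterD sN.
Qed.

Let ordE (i : 'I_N) : cext_ord i = i.
Proof. by apply: val_inj; rewrite /= modn_small. Qed.
Let divD i j : (i %/ N + (i %% N + j) %/ N = (i + j) %/ N)%N.
Proof. by rewrite {3}(divn_eq i N) -addnA divnMDl. Qed.

Fact cext_mulA : associative cext_mul.
Proof.
case=> [a i] [b j] [d l]; congr (_, _) => /=; last first.
  by apply: val_inj; rewrite /= modnDml modnDmr addnA.
rewrite !iterD' iterc iter_mod iterD -!addrA; congr (_ + (_ + _)).
rewrite [in RHS]addrCA; congr (_ + _); rewrite -!mulrnDr; congr (_ *+ _).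
by rewrite divD [(i + _)%N]addnC divD addnC addnA.
Qed.
Fact cext_mul1 : left_id cext_one cext_mul.
Proof.
case=> a i; congr (_, _); rewrite /= mod0n add0n ?ordE //=.
by rewrite add0r divn_small ?addr0.
Qed.
Fact cext_mulr1 : right_id cext_one cext_mul.
Proof.
case=> a i; congr (_, _); rewrite /= mod0n addn0 ?ordE //=.
by rewrite iter0 divn_small ?addr0.
Qed.
Fact cext_mulV : left_inverse cext_one cext_inv cext_mul.
Proof.
case=> a i; congr (_, _) => /=; last first.
  by apply: val_inj; rewrite /= modnDml subnK ?modnn ?mod0n // ltnW.
by rewrite iter_mod addrAC subrK addNr.
Qed.
Fact cext_mulrV : right_inverse cext_one cext_inv cext_mul.
Proof.
case=> a i; congr (_, _) => /=; last first.
  by apply: val_inj; rewrite /= modnDmr subnKC ?modnn ?mod0n // ltnW.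
have iterN j x : iter j s (- x) = - iter j s x.
  by elim: j => //= j ->; rewrite linearN.
rewrite iterD' !iterN iterc -iterD subnKC ?sN; last exact: ltnW.
by rewrite addrA subrr sub0r [(i + _)%N]addnC addNr.
Qed.
HB.instance Definition _ := isGroup.Build H
  cext_mulA cext_mul1 cext_mulr1 cext_mulV cext_mulrV.

Definition cext_inj (m : M) : H := (m, cext_ord 0).
Definition cext_gen : H := if (1 < N)%N then (0, cext_ord 1) else (c, cext_ord 0).

Lemma cext_genX i : (i < N)%N -> (cext_gen ^+ i)%g = (0, cext_ord i).
Proof.
elim: i => [|i IHi] lt_iN //; have N_gt1 : (1 < N)%N by apply: leq_trans lt_iN.
have lt_iN' := ltnW lt_iN.
rewrite expgS IHi // /cext_gen N_gt1; congr (_, _).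
  by rewrite /= iter0 !modn_small // add1n divn_small // !addr0.
by apply: val_inj; rewrite /= modnDm add1n.
Qed.

Lemma cextE (x : H) : x = (cext_inj x.1 * cext_gen ^+ x.2)%g.
Proof.
case: x => m i; rewrite /= cext_genX //; congr (_, _) => /=; last first.
  by apply: val_inj; rewrite /= modnDm add0n modn_small.
by rewrite mod0n /= add0n modn_small // divn_small // !addr0.
Qed.

Lemma cext_relations :
  [/\ {morph cext_inj : x y / x + y >-> (x * y)%g},
      forall m, (cext_gen * cext_inj m * cext_gen^-1)%g = cext_inj (s m)
    & (cext_gen ^+ N)%g = cext_inj c].
Proof.
split=> [x y | m |].
- by congr (_, _); rewrite /= ?mod0n ?addn0 ?div0n ?addr0 //; apply: val_inj.
- apply: (mulIg cext_gen); rewrite mulgVK.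
  rewrite /cext_gen; case: ifPn => [N_gt1|].
    congr (_, _).
      by rewrite /= !modn_small //= addn0 add0n divn_small // add0r !addr0.
    by apply: val_inj; rewrite /= addnC.
  rewrite -leqNgt => N_le1; have N1 : N = 1%N by apply/eqP; rewrite eqn_leq N_le1.
  have s1 x : s x = x by have := sN x; rewrite N1.
  by congr (_, _); rewrite /= ?mod0n ?div0n ?addr0 //= s1 addrC.
case: (ltngtP N 1) => [|N_gt1|N1].
- by rewrite ltnS leqNgt N_gt0.
- rewrite -(prednK N_gt0) expgS cext_genX ?prednK // /cext_gen N_gt1.
  congr (_, _); last by apply: val_inj; rewrite /= modnDm add1n prednK ?modnn ?mod0n.
  rewrite /= iter0 !modn_small ?prednK // add1n prednK // divnn N_gt0.
  by rewrite !add0r.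
- by rewrite {1}N1 expg1 /cext_gen; case: ifP; rewrite // {1}N1 ltnn.
Qed.

Lemma cext_universal (T : groupType) (f : M -> T) (t : T) :
    {morph f : x y / x + y >-> (x * y)%g} ->
    (forall m, (t * f m * t^-1)%g = f (s m)) -> (t ^+ N)%g = f c ->
  exists! h : H -> T, [/\ {morph h : x y / (x * y)%g >-> (x * y)%g},
    forall m, h (cext_inj m) = f m & h cext_gen = t].
Proof.
move=> fD tf tN; have f0 : f 0 = 1%g.
  by apply: (mulgI (f 0)); rewrite -fD addr0 mulg1.
have fMn x i : f (x *+ i) = (f x ^+ i)%g.
  by elim: i => [|i IHi]; rewrite ?mulr0n // mulrS fD IHi expgS.
have tf' i m : (t ^+ i * f m)%g = (f (iter i s m) * t ^+ i)%g.
  elim: i m => [|i IHi] m; first by rewrite mul1g mulg1.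
  by rewrite expgS -mulgA IHi /= -tf !mulgA mulgVK.
have hX (h : H -> T) : {morph h : x y / (x * y)%g >-> (x * y)%g} ->
    forall x i, h (x ^+ i)%g = (h x ^+ i)%g.
  move=> hM x; elim=> [|i IHi]; last by rewrite !expgS hM IHi.
  by apply: (mulgI (h 1%g)); rewrite -hM !mulg1.
exists (fun x : H => f x.1 * t ^+ x.2)%g; split; last first.
  move=> h [hM hf ht]; apply/funext => x.
  by rewrite [in RHS](cextE x) hM hX // hf ht.
have tmod i : (t ^+ i = f (c *+ (i %/ N)) * t ^+ (i %% N))%g.
  by rewrite {1}(divn_eq i N) expgnDr mulnC expgM tN fMn.
split=> [[a i] [b j] | m |] /=.
- rewrite !fD -!mulgA; congr (_ * _)%g; rewrite [RHS]mulgA tf' -mulgA.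
  by rewrite -expgnDr [in RHS]tmod.
- by rewrite mod0n mulg1.
- rewrite /cext_gen; case: ifPn => [N_gt1|].
    by rewrite /= modn_small // f0 mul1g.
  rewrite -leqNgt => N_le1; have N1 : N = 1%N by apply/eqP; rewrite eqn_leq N_le1.
  by rewrite /= mod0n mulg1 -tN N1.
Qed.
End CyclicExtension.

(* Linear algebra in a possibly infinite-dimensional F_p[G]-module V, with
   sQ the action of the generator of the cyclic group G of order N. *)
Section Modules.
Variables (p : nat) (V : lmodType 'F_p) (sQ : V -> V) (N : nat).

Definition fdim (S : set V) : nat :=
  xget 0%N [set d | exists b : 'I_d -> V,
    (forall c : 'I_d -> 'F_p, \sum_i c i *: b i = 0 -> forall i, c i = 0)
    /\ S = [set v | exists c : 'I_d -> 'F_p, v = \sum_i c i *: b i]].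

Definition cyclic_set (x : V) : set V :=
  [set v | exists c : 'I_N -> 'F_p, v = \sum_(i < N) c i *: iter i sQ x].

(* dim_{F_p} F_p[G]x *)
Definition mod_length (x : V) : nat := fdim (cyclic_set x).

Definition finite_submodule (A : set V) : Prop :=
  [/\ finite_set A, A 0, forall a x y, A x -> A y -> A (a *: x + y)
    & forall x, A x -> A (sQ x)].

Definition module_iso (M : vectType 'F_p) (s : 'End(M)) (A : set V) : Prop :=
  exists f : {linear M -> V},
    [/\ injective f, range f = A & forall m, f (s m) = sQ (f m)].

Definition lambda (e : V -> 'F_p) (A : set V) : nat :=
  let lengths := [set l | exists x,
    [/\ A x, (mod_length x < N)%N, e x != 0 & l = mod_length x]] in
  xget N [set l | lengths l /\ forall l', lengths l' -> (l <= l')%N].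
End Modules.

Section Galois.
Variables (F : fieldType) (Om : splittingFieldType F).
Implicit Types K L E B : {subfield Om}.

Definition gal_sub E (g : gal_of E) (x : subvs_of E) : subvs_of E :=
  vsproj E (g (vsval x)).
Lemma gal_subE E (g : gal_of E) x : vsval (gal_sub g x) = g (vsval x).
Proof. by rewrite vsprojK // memv_gal // subvsP. Qed.

Fact gal_units_subproof E (g : gal_of E) (x : units (subvs_of E)) :
  gal_sub g (uval x) != 0.
Proof.
apply: contra (uvalP x) => /eqP/(congr1 vsval); rewrite gal_subE linear0.
move/eqP; rewrite fmorph_eq0 => /eqP x0.
by apply/eqP/subvs_inj; rewrite linear0.
Qed.
Definition gal_units E (g : gal_of E) (x : units (subvs_of E)) :=
  Units (gal_units_subproof g x).

(* B = E(S) *)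
Definition adjoined E (S : set Om) B : Prop :=
  [/\ (E <= B)%VS, forall y, S y -> y \in B
    & forall B', (E <= B')%VS -> (forall y, S y -> y \in B') -> (B <= B')%VS].

Definition p_extension (p : nat) K E : bool :=
  galois K E && (p.-group 'Gal(E / K))%g.

Definition maximal_p_extension (p : nat) K B L : Prop :=
  [/\ p_extension p K L, (L <= B)%VS
    & forall E, p_extension p K E -> (E <= B)%VS -> (E <= L)%VS].

(* The product x * y of gal_of L is the composite y \o x (galM). *)
Definition solves_embedding K L (H : groupType) (phi : H -> gal_of K) : Prop :=
  exists psi : gal_of L -> H,
    [/\ bijective psi, forall x y, psi (y * x)%g = (psi x * psi y)%g
      & forall x, {in K, phi (psi x) =1 x}].

Section Bullet.
Variables (p n : nat) (p_pr : prime p) (M : vectType 'F_p) (s : 'End(M)).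
Variables (s_pn : forall m, iter (p ^ n) s m = m) (mu : nat) (a : M).
Variables (mu_gt0 : (0 < mu)%N).
Variable dim_a : (mu < p ^ n)%N -> \dim (cyclicv s (p ^ n) a) = mu.

Fact pn_gt0 : (0 < p ^ n)%N. Proof. by rewrite expn_gt0 prime_gt0. Qed.

(* M *_mu G, with a the generator alpha_{i_0} *)
Definition bullet : groupType :=
  cext pn_gt0 s_pn (bullet_pow_fixed p_pr s_pn mu_gt0 dim_a).

(* m g ^ i |-> sigma ^ i *)
Definition bullet_proj K (sigma : gal_of K) (x : bullet) : gal_of K :=
  (sigma ^+ (x : M * 'I_(p ^ n)).2)%g.
End Bullet.

Section Kummer.
Variables (p : nat) (p_pr : prime p) (E : {subfield Om}).
Local Notation U := (units (subvs_of E)).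

(* E^x / E^(x p), written additively *)
Definition kummer_quot :=
  @fpquot p U p_pr (ppowers (E := subvs_of E) p) (@ppowers_mulrn (subvs_of E) p).
HB.instance Definition _ := GRing.Lmodule.on kummer_quot.
Definition kummer_class (a : U) : kummer_quot :=
  fpclass p_pr (@ppowers_mulrn (subvs_of E) p) a.
Definition kummer_repr (x : kummer_quot) : U :=
  @fprepr p U p_pr (ppowers (E := subvs_of E) p) (@ppowers_mulrn (subvs_of E) p) x.
Lemma kummer_reprK : cancel kummer_repr kummer_class.
Proof. exact: fpreprK. Qed.
Definition kummer_act (g : gal_of E) (x : kummer_quot) : kummer_quot :=
  kummer_class (gal_units g (kummer_repr x)).

Lemma kummer_actE g a :
  kummer_act g (kummer_class a) = kummer_class (gal_units g a).
Proof.
apply/eqP; rewrite fpclassE.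
have /eqP := kummer_reprK (kummer_class a); rewrite fpclassE => /asboolP[u e]; apply/asboolP; exists (gal_units g u).
apply: val_inj; rewrite /= uvalMn /=; apply: subvs_inj.
move/(congr1 (fun z : U => vsval (uval z))): e; rewrite uvalMn /= => e.
rewrite fmorphV rmorphXn /= !gal_subE -rmorphXn -fmorphV -rmorphM /=.
by congr (g _); move: e; rewrite rmorphXn fmorphV.
Qed.

Definition kummer_eigenspace (eps : gal_of E) (t : nat) : set kummer_quot :=
  [set x | kummer_act eps x = t%:R *: x].

Definition kummer_roots (A : set kummer_quot) : set Om :=
  [set y | exists2 a : U, A (kummer_class a) & y ^+ p = vsval (uval a)].

(* xi ^ e = sh gam / gam with gam ^ p = N_{E/B}(a), a representing x; this
   determines e when x has length less than #|Gal(E / B)|.  In the use intended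
   here E = K(xi) and B = F(xi). *)
Definition kummer_index (B : {subfield Om}) (xi : Om) (sh : gal_of E)
    (x : kummer_quot) : 'F_p :=
  xget 0 [set e : 'F_p | exists (a : U) (gam : Om),
    [/\ kummer_class a = x, gam \in E,
        gam ^+ p = galNorm B E (vsval (uval a)) & xi ^+ e = sh gam / gam]].
End Kummer.

Section AS.
Variables (p : nat) (p_pr : prime p) (K : {subfield Om}).
Variable chK : p \in [pchar subvs_of K].

Definition as_quot := fpquot p_pr (wp_mulrn chK).
HB.instance Definition _ := GRing.Lmodule.on as_quot.
Definition as_class (a : subvs_of K) : as_quot :=
  fpclass p_pr (wp_mulrn chK) a.
Definition as_repr (x : as_quot) : subvs_of K :=
  @fprepr p (subvs_of K) p_pr (wp_image chK) (wp_mulrn chK) x.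
Lemma as_reprK : cancel as_repr as_class.
Proof. exact: fpreprK. Qed.
Definition as_act (g : gal_of K) (x : as_quot) : as_quot :=
  as_class (gal_sub g (as_repr x)).

Lemma as_actE g a : as_act g (as_class a) = as_class (gal_sub g a).
Proof.
apply/eqP; rewrite fpclassE.
have /eqP := as_reprK (as_class a); rewrite fpclassE => /asboolP[u e]; apply/asboolP; exists (gal_sub g u).
apply: subvs_inj; move/(congr1 vsval): e.
rewrite !linearB /= !rmorphXn /= !gal_subE => e.
by rewrite -rmorphB e rmorphB rmorphXn.
Qed.

Definition as_roots (A : set as_quot) : set Om :=
  [set y | exists2 a, A (as_class a) & y ^+ p - y = vsval a].

Definition as_index (sigma : gal_of K) (x : as_quot) : 'F_p :=
  xget 0 [set e : 'F_p | exists (a : subvs_of K) (rho : Om),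
    [/\ as_class a = x, rho \in K,
        rho ^+ p - rho = galTrace 1 K (vsval a)
      & e%:R = sigma rho - rho]].
End AS.
End Galois.

(* Main.v *)
Require Import Defs.
From HB Require Import structures.
From mathcomp Require Import all_boot all_order all_algebra all_fingroup.
From mathcomp Require Import all_solvable all_field generic_quotient ring_quotient.
From mathcomp Require Import boolp classical_sets cardinality.

Set Implicit Arguments.
Unset Strict Implicit.
Unset Printing Implicit Defensive.

Import GRing.Theory.
Local Open Scope ring_scope.
Local Open Scope classical_set_scope.

(** Kummer, resp. Artin-Schreier, theory gives a perfect pairing between Gal(L/K)
and A, under which conjugation by a lift g of sigma is adjoint to sigma^-1
and, on elements of length < p^n, the form chi := <g^(p^n), -> is the index e.
Hence L solves the embedding problem iff some isomorphism from M onto the dual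
of A maps the p^n-th power c of the generator of M *_mu G over sigma to chi
modulo norms, where the norm is (sigma - 1)^(p^n - 1). By duality chi is
divisible by (sigma - 1)^h iff it kills the elements of length <= h, so for h
< p^n this means h < lambda(A); likewise c is divisible by (sigma - 1)^h iff h
< mu. Since A and its dual have the same ranks of powers of sigma - 1, the
theorem follows from the fact that a nilpotent endomorphism together with a
vector of its kernel is classified by the ranks of its powers and the height
of the vector.

In characteristic <> p, Gal(B/K) is abelian by the eigenspace condition, and L
is the fixed field of its p'-part; so Gal(L/F) is identified by restriction
with Gal(B/F(xi)), on which the Kummer pairing is computed. *)

(** * Nilpotent endomorphisms *)

(** Norms enter because a lift of sigma is not canonical: replacing g by g x, with x in Gal(L/K),
    changes g^(p^n) by the norm of x. Over F_p one has (X^N - 1)/(X - 1) = (X - 1)^(N - 1) with N =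
    p^n, so a norm lies in the image of every (sigma - 1)^h with h < N and cannot disturb a height
    below N. The value mu = N is the case where chi is itself a norm, so that some lift has trivial
    N-th power.

    The index e makes sense only on elements of length < N, whereas chi is a functional on all of A;
    the two agree where (sigma - 1)^(N - 1), that is the norm, vanishes.

    If the characteristic is not p, L need not contain xi, so the pairing cannot be computed inside
    L. Since Gal(K(xi)/K) has exponent dividing p - 1, every p-element of Gal(B/K) already fixes
    K(xi); hence each automorphism of L has exactly one extension to B fixing xi. *)

Section NilpotentEndomorphisms.
Variables (k : fieldType) (V W : vectType k).

Lemma glue_lfun (A B : {vspace V}) (f g : 'Hom(V, W)) : (A :&: B = 0)%VS ->
  exists h : 'Hom(V, W), {in A, h =1 f} /\ {in B, h =1 g}.
Proof.
move=> dAB; have dBA : (B :&: A = 0)%VS by rewrite capvC.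
exists ((f \o daddv_pi A B) + (g \o daddv_pi B A))%VF.
have pi0 (C D : {vspace V}) x : (C :&: D = 0)%VS -> x \in D -> daddv_pi C D x = 0.
  move=> dCD Dx; have dDC : (D :&: C = 0)%VS by rewrite capvC.
  have := daddv_pi_add dCD (subvP (addvSr C D) x Dx).
  by rewrite (daddv_pi_id dDC Dx) => /(canRL (addrK x)); rewrite subrr.
split=> x Ax; rewrite add_lfunE !comp_lfunE.
  by rewrite (pi0 B A) // linear0 addr0 daddv_pi_id.
by rewrite (pi0 A B) // linear0 add0r daddv_pi_id.
Qed.

Lemma equidim_lfun (U : {vspace V}) (U' : {vspace W}) : \dim U = \dim U' ->
  exists e : 'Hom(V, W), (U :&: lker e = 0)%VS /\ (e @: U = U')%VS.
Proof.
move=> dimUU'; pose X := vbasis U; pose Y := vbasis U'.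
have [e1 /(_ (basis_free (vbasisP U))) defe] := linear_of_free X Y.
pose e0 : 'Hom(V, W) := linfun e1.
have {}defe : map e0 X = Y.
  by rewrite -defe ?size_tuple //; apply: eq_map => x; rewrite lfunE.
have imE : (e0 @: U = U')%VS.
  by rewrite -(span_basis (vbasisP U)) limg_span defe (span_basis (vbasisP U')).
exists e0; split=> //; apply/eqP; rewrite -dimv_eq0.
by have := limg_ker_dim e0 U; rewrite imE dimUU' => /eqP; rewrite -{2}[\dim U']add0n eqn_add2r.
Qed.

Section Extension.
Variables (T : 'End(V)) (S : 'End(W)) (U : {vspace V}) (U' : {vspace W}).
Hypotheses (TU : (T @: U <= U)%VS) (SU : (S @: U' <= U')%VS).
Hypotheses (dimU : \dim U = \dim U') (dimTU : \dim (T @: U) = \dim (S @: U')).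
Hypothesis dimTTU : \dim (T @: (T @: U)) = \dim (S @: (S @: U')).
Variable f : 'Hom(V, W).
Hypotheses (fTU : {in T @: U, forall x, f (T x) = S (f x)}%VS).
Hypotheses (f_inj : (T @: U :&: lker f = 0)%VS) (f_img : (f @: (T @: U) = S @: U')%VS).
Variables (c : V) (c' : W).
Hypotheses (Uc : c \in U) (U'c : c' \in U') (Tc : T c = 0) (Sc : S c' = 0).
Hypotheses (cTU : c \in (T @: U)%VS -> c = 0) (cSU : c' \in (S @: U')%VS -> c' = 0).
Hypothesis c0 : (c == 0) = (c' == 0).

Local Notation TU_ := (T @: U)%VS.
Local Notation SU_ := (S @: U')%VS.

Let cap_line (Z : vectType k) (A : {vspace Z}) z :
  (z \in A -> z = 0) -> (A :&: <[z]> = 0)%VS.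
Proof.
move=> Az; apply/eqP; rewrite -subv0; apply/subvP => x.
rewrite memv_cap => /andP[Ax /vlineP[a defx]]; rewrite memv0 defx.
have [->|a0] := eqVneq a 0; first by rewrite scale0r.
suff -> : z = 0 by rewrite scaler0.
by apply: Az; rewrite -[z](scalerK a0) -defx memvZ.
Qed.

(** Write U = TU + <c> + X + Z, a direct sum in which X completes (TU meet ker T) + <c> to U meet
    ker T. By rank-nullity the three dimension hypotheses give X and its analogue [Y] the same
    dimension, so X can be sent onto [Y] and c to [c']; on Z any S-preimage in U' of f (T x) will
    do. The conditions on c say that it is 0 or a kernel vector outside TU, so its image is not yet
    prescribed by f. *)
Lemma extend_intertwining : exists g : 'Hom(V, W),
  [/\ {in U, forall x, g (T x) = S (g x)}, (U :&: lker g = 0)%VS,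
      (g @: U = U')%VS, {in T @: U, g =1 f}%VS & g c = c'].
Proof.
pose KU := (U :&: lker T)%VS; pose KU0 := (TU_ :&: lker T)%VS.
pose KV := (U' :&: lker S)%VS; pose KV0 := (SU_ :&: lker S)%VS.
pose X := (KU :\: (KU0 + <[c]>))%VS; pose Y := (KV :\: (KV0 + <[c']>))%VS.
have dimKU : \dim KU = \dim KV.
  apply/eqP; rewrite -(eqn_add2r (\dim TU_)) {2}dimTU.
  by rewrite !limg_ker_dim dimU.
have dimKU0 : \dim KU0 = \dim KV0.
  apply/eqP; rewrite -(eqn_add2r (\dim (T @: TU_))) {2}dimTTU.
  by rewrite !limg_ker_dim dimTU.
have KUc : c \in KU by rewrite memv_cap Uc memv_ker Tc eqxx.
have KVc : c' \in KV by rewrite memv_cap U'c memv_ker Sc eqxx.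
have dc : (KU0 :&: <[c]> = 0)%VS.
  by apply: cap_line => /memv_capP[/cTU].
have dc' : (KV0 :&: <[c']> = 0)%VS.
  by apply: cap_line => /memv_capP[/cSU].
have sKU : (KU0 + <[c]> <= KU)%VS.
  by rewrite subv_add -[X in _ && X]memvE KUc andbT capvS.
have sKV : (KV0 + <[c']> <= KV)%VS.
  by rewrite subv_add -[X in _ && X]memvE KVc andbT capvS.
have defKU : (X + (KU0 + <[c]>) = KU)%VS by rewrite /X addv_diff (addv_idPl sKU).
have defKV : (Y + (KV0 + <[c']>) = KV)%VS by rewrite /Y addv_diff (addv_idPl sKV).
have dX : (X :&: (KU0 + <[c]>) = 0)%VS by exact: capv_diff.
have dY : (Y :&: (KV0 + <[c']>) = 0)%VS by exact: capv_diff.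
have dimXY : \dim X = \dim Y.
  apply/eqP; rewrite -(eqn_add2r (\dim (KU0 + <[c]>))).
  rewrite -dimv_disjoint_sum // defKU dimKU -defKV dimv_disjoint_sum //.
  by rewrite eqn_add2l !dimv_disjoint_sum // dimKU0 !dim_vline c0.
have [e [e_inj e_img]] := equidim_lfun dimXY.
have [el elc] : exists el : 'Hom(V, W), el c = c'.
  have := @equidim_lfun <[c]>%VS <[c']>%VS.
  rewrite !dim_vline c0 => /(_ erefl) [u [_ u_img]].
  have /memv_imgP[x /vlineP[a ->] ->] : c' \in (u @: <[c]>)%VS by rewrite u_img memv_line.
  by exists (a *: u)%VF; rewrite scale_lfunE linearZ.
pose S1 := (S \o projv U')%VF.
pose h := (projv U' \o S1^-1 \o f \o T)%VF.
have hS : {in U, forall x, S (h x) = f (T x)}.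
  move=> x Ux; have : f (T x) \in (limg S1).
    by rewrite /S1 limg_comp limg_proj -f_img !memv_img.
  move/limg_lfunVK; rewrite {1}/S1 comp_lfunE => defy.
  by rewrite /h !comp_lfunE /= defy.
have hU x : h x \in U' by rewrite /h !comp_lfunE memv_proj.
pose Z := (U :\: (TU_ + (<[c]> + X)))%VS.
have sXK : (X <= KU)%VS by exact: diffvSl.
have sYK : (Y <= KV)%VS by exact: diffvSl.
have dcX : (<[c]> :&: X = 0)%VS.
  by apply/eqP; rewrite -subv0 -dX capvC capvS // addvSr.
have dTU : (TU_ :&: (<[c]> + X) = 0)%VS.
  apply/eqP; rewrite -subv0; apply/subvP=> x /memv_capP[TUx /memv_addP[u cu [v Xv defx]]].
  have Kx : x \in KU0.
    rewrite memv_cap TUx defx rpredD //; last first.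
      by have /memv_capP[] := subvP sXK v Xv.
    by move/vlineP: cu => [a ->]; rewrite memvZ // memv_ker Tc.
  have v0 : v = 0.
    apply/eqP; rewrite -memv0 -dX memv_cap Xv.
    rewrite (_ : v = x - u); last by rewrite defx addrAC addrN add0r.
    by rewrite memv_add // rpredN.
  by rewrite -dc memv_cap Kx defx v0 addr0.
have [g1 [g1c g1X]] := glue_lfun el e dcX.
have [g2 [g2T g2cX]] := glue_lfun f g1 dTU.
have dZ : ((TU_ + (<[c]> + X)) :&: Z = 0)%VS by rewrite capvC capv_diff.
have [g [gT gZ]] := glue_lfun g2 h dZ.
have ccX : c \in (<[c]> + X)%VS by rewrite (subvP (addvSl _ _)) // memv_line.
have XcX x : x \in X -> x \in (<[c]> + X)%VS by apply/subvP/addvSr.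
have gTU : {in TU_, g =1 f}.
  by move=> x TUx; rewrite gT ?g2T // (subvP (addvSl _ _)).
have gcX : {in (<[c]> + X)%VS, g =1 g1}.
  by move=> x cXx; rewrite gT ?g2cX // (subvP (addvSr _ _)).
have gc : g c = c' by rewrite gcX // g1c ?memv_line.
have gX : {in X, g =1 e} by move=> x Xx; rewrite gcX ?XcX // g1X.
have decU x : x \in U -> exists t a y z,
    [/\ t \in TU_, y \in X, z \in Z, z \in U & x = t + (a *: c + y) + z].
  move=> Ux; have : x \in (Z + (TU_ + (<[c]> + X)))%VS.
    by rewrite /Z addv_diff (subvP (addvSl _ _)).
  case/memv_addP=> z Zz [u /memv_addP[t TUt [v /memv_addP[_ /vlineP[a ->] [y Xy ->]] ->]] ->].
  exists t, a, y, z; split=> //; last by rewrite addrC.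
  exact: (subvP (diffvSl _ _)) Zz.
have gU x : x \in U -> g x \in U'.
  case/decU=> t [a [y [z [TUt Xy Zz _ ->]]]]; rewrite !linearD linearZ /= gc !rpredD //.
  - by rewrite gTU // (subvP SU) // -f_img memv_img.
  - by rewrite rpredZ.
  - by rewrite gX //; have: e y \in Y by [rewrite -e_img memv_img]; case/(subvP sYK)/memv_capP.
  - by rewrite gZ.
have eY x : x \in X -> S (e x) = 0.
  move=> Xx; have: e x \in Y by rewrite -e_img memv_img.
  by case/(subvP sYK)/memv_capP=> _; rewrite memv_ker => /eqP.
have XT x : x \in X -> T x = 0.
  by case/(subvP sXK)/memv_capP=> _; rewrite memv_ker => /eqP.
have SgE : {in U, forall x, f (T x) = S (g x)}.
  move=> x /decU[t [a [y [z [TUt Xy Zz Uz ->]]]]].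
  rewrite !linearD !linearZ /= gc Sc Tc !scaler0 linear0 !add0r.
  by rewrite gTU // gX // gZ // eY // (XT y) // !linear0 !addr0 hS // fTU.
have TTU x : x \in U -> T x \in TU_ by apply: memv_img.
have fU x : x \in TU_ -> f x = 0 -> x = 0.
  by move=> TUx fx; apply/eqP; rewrite -memv0 -f_inj memv_cap TUx memv_ker fx eqxx.
(* From g x = 0 follows f (T x) = 0, hence T x = 0; and on U meet ker T = X + KU0 + <c> the images
   of the three summands lie in the independent spaces [Y], [KV0] and <c'>. *)
have ginj : (U :&: lker g = 0)%VS.
  apply/eqP; rewrite -subv0; apply/subvP=> x /memv_capP[Ux].
  rewrite memv_ker => /eqP gx.
  have Tx : T x = 0 by apply: fU; rewrite ?TTU // SgE // gx linear0.
  have : x \in KU by rewrite memv_cap Ux memv_ker Tx eqxx.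
  rewrite -defKU => /memv_addP[y Xy [_ /memv_addP[u Ku [_ /vlineP[a ->] ->]] defx]].
  have /memv_capP[TUu] := Ku; rewrite memv_ker => /eqP Tu.
  have fuK : f u \in KV0.
    rewrite memv_cap -f_img memv_img // memv_ker.
    by have /eqP := fTU TUu; rewrite Tu linear0 eq_sym.
  move: gx; rewrite defx !linearD linearZ /= gc (gX y) // gTU // => gx.
  have ey : e y = 0.
    apply/eqP; rewrite -memv0 -dY memv_cap -e_img memv_img //=.
    have -> : e y = - (f u + a *: c') by apply/eqP; rewrite -addr_eq0 gx.
    by rewrite rpredN memv_add // memvZ // memv_line.
  have y0 : y = 0.
    by apply/eqP; rewrite -memv0 -e_inj memv_cap Xy memv_ker ey eqxx.
  move: gx; rewrite ey add0r => /eqP; rewrite addr_eq0 => /eqP fu.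
  have fu0 : f u = 0.
    apply/eqP; rewrite -memv0 -dc' memv_cap fuK /= fu rpredN memvZ //.
    exact: memv_line.
  have u0 := fU _ TUu fu0.
  move: fu; rewrite fu0 => /esym/eqP; rewrite oppr_eq0 scaler_eq0 -c0 => ac.
  rewrite y0 u0 !add0r memv0 scaler_eq0; exact: ac.
exists g; split=> //.
  by move=> x Ux; rewrite gTU ?TTU // SgE.
apply/eqP; rewrite eqEdim limg_dim_eq // dimU leqnn andbT.
by apply/subvP=> _ /memv_imgP[x Ux ->]; apply: gU.
Qed.
End Extension.

(** The isomorphism is built on T^i V for decreasing i, starting from T^m V = 0. Each step needs
    only the dimensions of three consecutive images. *)
Lemma nilpotent_classification (T : 'End(V)) (S : 'End(W)) m (c : V) (c' : W) :
    iter m (lfun_img T) fullv = 0%VS -> iter m (lfun_img S) fullv = 0%VS ->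
    (forall i, \dim (iter i (lfun_img T) fullv) = \dim (iter i (lfun_img S) fullv)) ->
    T c = 0 -> S c' = 0 ->
    (forall i, (c \in iter i (lfun_img T) fullv) = (c' \in iter i (lfun_img S) fullv)) ->
  exists g : 'Hom(V, W), [/\ lker g = 0%VS, limg g = fullv,
    forall x, g (T x) = S (g x) & g c = c'].
Proof.
pose TI i := iter i (lfun_img T) fullv; pose SI i := iter i (lfun_img S) fullv.
move=> T0 S0 dimTS Tc Sc heq.
have TIS i : (TI i.+1 <= TI i)%VS.
  by elim: i => [|i IHi]; rewrite ?subvf // /TI !iterS limgS.
have SIS i : (SI i.+1 <= SI i)%VS.
  by elim: i => [|i IHi]; rewrite ?subvf // /SI !iterS limgS.
suff /(_ m (leqnn m)) : forall j, (j <= m)%N -> exists g : 'Hom(V, W),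
    [/\ {in TI (m - j)%N, forall x, g (T x) = S (g x)}, (TI (m - j)%N :&: lker g = 0)%VS,
      (g @: TI (m - j)%N = SI (m - j)%N)%VS & c \in TI (m - j)%N -> g c = c'].
  rewrite subnn => -[g [gT gi gim gc]]; exists g; split=> //.
  - by move: gi; rewrite /TI /= capvC capvf.
  - by move=> x; apply: gT; rewrite memvf.
  - by apply: gc; rewrite memvf.
elim=> [|j IHj] ltjm.
  rewrite subn0 /TI T0; exists 0%VF; split.
  - by move=> x _; rewrite !lfunE /= linear0.
  - by rewrite cap0v.
  - by rewrite limg0 /SI S0.
  - move=> c0; have := heq m; rewrite T0 S0 c0 => /esym; rewrite memv0 => /eqP->.
    by rewrite lfunE.
have [f [fT fi fim fc]] := IHj (ltnW ltjm).
move: (m - j)%N (subnSK ltjm) fT fi fim fc => mj <-; set i := (m - j.+1)%N.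
move=> fT fi fim fc.
(* The vector c is prescribed only at its exact height i. At every other level the extension is run
   with the zero vector: either c is already handled by f, or it is not yet in the domain. *)
pose b := (c \in TI i) && (c \notin TI i.+1).
have bE : b = (c' \in SI i) && (c' \notin SI i.+1) by rewrite /b /TI /SI !heq.
pose c1 := if b then c else 0; pose c1' := if b then c' else 0.
have [] := @extend_intertwining T S (TI i) (SI i) (TIS i) (SIS i) (dimTS i) (dimTS i.+1)
  (dimTS i.+2) f fT fi fim c1 c1'.
- by rewrite /c1; case: ifP => [/andP[]|] // _; exact: mem0v.
- by rewrite /c1' bE; case: ifP => [/andP[]|] // _; exact: mem0v.
- by rewrite /c1; case: ifP => // _; rewrite linear0.
- by rewrite /c1'; case: ifP => // _; rewrite linear0.
- by rewrite /c1; case: ifP => // /andP[_ /negP].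
- by rewrite /c1' bE; case: ifP => // /andP[_ /negP].
- rewrite /c1 /c1'; case: ifP => [bT|_]; last by rewrite !eqxx.
  have -> : (c == 0) = false.
    by apply/negbTE; case/andP: bT => _; apply: contraNneq => ->; rewrite mem0v.
  symmetry; apply/negbTE; move: bT; rewrite bE.
  by case/andP => _; apply: contraNneq => ->; rewrite mem0v.
move=> g [gT gi gim gf gc]; exists g; split=> //.
move=> TIc; have [TIc'|nTIc'] := boolP (c \in TI i.+1); first by rewrite gf // fc.
by move: gc; rewrite /c1 /c1' /b TIc nTIc'.
Qed.
End NilpotentEndomorphisms.

(** * Duality and cyclic modules *)

Lemma iter_lfun_imgP (k : fieldType) (V : vectType k) (T : 'End(V)) i x :
  x \in iter i (lfun_img T) fullv <-> exists y, x = iter i T y.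
Proof.
elim: i x => [|i IHi] x; first by split=> [|_]; [exists x | rewrite memvf].
split=> [/memv_imgP[y /IHi[z ->] ->]|[y ->]]; first by exists z.
by apply: memv_img; apply/IHi; exists y.
Qed.

Section Orthogonality.
Variables (k : fieldType) (d : nat).
Local Notation V := 'rV[k]_d.
Implicit Types (U : {vspace V}) (v w : V).

Lemma dot_symm_eq0 v w : (v *m w^T == 0) = (w *m v^T == 0).
Proof. by rewrite -trmx_eq0 trmx_mul trmxK. Qed.

Lemma dot_nondegenerate v : (forall w, v *m w^T = 0) -> v = 0.
Proof.
move=> v0; apply/rowP=> i; have /matrixP/(_ 0 0) := v0 (delta_mx 0 i).
by rewrite !mxE (bigD1 i) //= !mxE !eqxx mulr1 big1 ?addr0 // => j ji;
  rewrite !mxE (negPf ji) andbF mulr0.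
Qed.

(** The columns form a basis of U, so orthogonality to U is the kernel condition of a single
    matrix. *)
Definition basis_trmx U : 'M[k]_(d, \dim U) :=
  (\matrix_(j < \dim U) ((vbasis U)`_j : 'rV[k]_d))^T.

Lemma basis_trmxE U w j : (w *m basis_trmx U) 0 j = (w *m ((vbasis U)`_j)^T) 0 0.
Proof. by rewrite !mxE; apply: eq_bigr => i _; rewrite !mxE. Qed.

Lemma basis_trmxP U w :
  w *m basis_trmx U = 0 <-> (forall u, u \in U -> w *m u^T = 0).
Proof.
split=> [/rowP w0 u Uu | w0]; last first.
  apply/rowP=> j; rewrite basis_trmxE w0 ?mxE //.
  by rewrite vbasis_mem // mem_nth // size_tuple.
rewrite (coord_vbasis Uu) linear_sum mulmx_sumr big1 // => j _.
rewrite linearZ -scalemxAr; apply/matrixP=> x y; rewrite !ord1 mxE -basis_trmxE w0.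
by rewrite !mxE mulr0.
Qed.

(* Pairing U against a basis of U' embeds U in a space of dimension dim U'. *)
Lemma leq_dim_pairing U U' :
    (forall u, u \in U -> (forall w, w \in U' -> u *m w^T = 0) -> u = 0) ->
  (\dim U <= \dim U')%N.
Proof.
move=> inj; pose Psi : 'Hom(V, 'rV_(\dim U')) := linfun (mulmxr (basis_trmx U')).
have Psi0 : (U :&: lker Psi = 0)%VS.
  apply/eqP; rewrite -subv0; apply/subvP=> u /memv_capP[Uu].
  rewrite memv_ker lfunE /= memv0 => /eqP u0.
  by apply/eqP/inj => //; apply/basis_trmxP.
rewrite -(limg_dim_eq Psi0); apply: leq_trans (dimvS (subvf _)) _.
by rewrite dimvf /dim /= mul1n.
Qed.

Lemma exists_orthogonal U : U <> fullv ->
  exists2 v : V, v != 0 & forall u, u \in U -> v *m u^T = 0.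
Proof.
move=> nfU; pose Psi : 'Hom(V, 'rV_(\dim U)) := linfun (mulmxr (basis_trmx U)).
have Psi0 : lker Psi != 0%VS.
  apply/eqP=> K0; apply: nfU; apply/eqP; rewrite eqEdim subvf /=.
  have := limg_ker_dim Psi fullv; rewrite K0 capv0 dimv0 add0n => <-.
  by apply: leq_trans (dimvS (subvf _)) _; rewrite dimvf /dim /= mul1n.
exists (vpick (lker Psi)); first by rewrite vpick0.
apply/basis_trmxP; have := memv_pick (lker Psi).
by rewrite memv_ker lfunE /= => /eqP.
Qed.

(** A vector S w is orthogonal to ker T by adjunction. If it is also orthogonal to a complement of
    ker T, it is 0; so the image of S embeds in the dual of that complement, whose dimension is the
    rank of T. *)
Lemma leq_rank_adjoint (T S : 'End(V)) :
  (forall v w, T v *m w^T = v *m (S w)^T) -> (\dim (limg S) <= \dim (limg T))%N.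
Proof.
move=> adjTS; have <- : \dim (lker T)^C = \dim (limg T).
  by rewrite dimv_compl -(limg_ker_dim T fullv) capfv addKn.
apply: leq_dim_pairing => _ /memv_imgP[w _ ->] w0; apply: dot_nondegenerate => v.
have : v \in (lker T + (lker T)^C)%VS by rewrite addv_complf memvf.
case/memv_addP=> x; rewrite memv_ker => /eqP Tx [y Cy ->].
rewrite linearD mulmxDr (w0 y) // addr0; apply/eqP; rewrite dot_symm_eq0 -adjTS Tx.
by rewrite mul0mx.
Qed.

Lemma rank_adjoint (T S : 'End(V)) :
  (forall v w, T v *m w^T = v *m (S w)^T) -> \dim (limg S) = \dim (limg T).
Proof.
move=> adjTS; apply/eqP; rewrite eqn_leq !leq_rank_adjoint // => v w.
by apply/trmx_inj; rewrite !trmx_mul !trmxK adjTS.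
Qed.

(** The image of S is contained in the orthogonal [O] of ker T. Conversely ker T pairs faithfully
    with a complement of [O], which bounds the dimension of [O] by the rank of T, equal to that of
    S. *)
Lemma mem_limg_adjoint (T S : 'End(V)) w :
    (forall v w, T v *m w^T = v *m (S w)^T) ->
  (w \in limg S) <-> (forall v, T v = 0 -> v *m w^T = 0).
Proof.
move=> adjTS; split=> [/memv_imgP[x _ ->] v Tv | w0].
  by rewrite -adjTS Tv mul0mx.
pose O : {vspace V} := lker (linfun (mulmxr (basis_trmx (lker T)))).
have OP x : x \in O <-> (forall v, T v = 0 -> v *m x^T = 0).
  rewrite memv_ker lfunE /=; split=> [/eqP/basis_trmxP x0 v Tv | x0].
    by apply/eqP; rewrite dot_symm_eq0 x0 // memv_ker Tv.
  apply/eqP/basis_trmxP=> v; rewrite memv_ker => /eqP Tv.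
  by apply/eqP; rewrite dot_symm_eq0 x0.
suff -> : limg S = O by apply/OP.
have SO : (limg S <= O)%VS.
  by apply/subvP=> _ /memv_imgP[x _ ->]; apply/OP=> v Tv; rewrite -adjTS Tv mul0mx.
apply/eqP; rewrite eqEdim SO (rank_adjoint adjTS) /=.
have leK : (\dim (lker T) <= \dim O^C)%N.
  apply: leq_dim_pairing => u; rewrite memv_ker => /eqP Tu u0.
  apply: dot_nondegenerate => v.
  have : v \in (O + O^C)%VS by rewrite addv_complf memvf.
  case/memv_addP=> x /OP Ox [y Cy ->].
  by rewrite linearD mulmxDr Ox // (u0 y) // addr0.
rewrite -(leq_add2l (\dim (lker T))) -[lker T in X in (_ <= X)%N]capfv limg_ker_dim.
by rewrite -(addv_complf O) dimv_disjoint_sum ?capv_compl // addnC leq_add2l.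
Qed.
End Orthogonality.

Section IteratedAdjoint.
Variables (k : fieldType) (d : nat) (T S : 'End('rV[k]_d)).
Hypothesis adjTS : forall v w, T v *m w^T = v *m (S w)^T.

Let lpow (R : 'End('rV[k]_d)) i := iter i (fun g => R \o g)%VF \1%VF.
Let lpowE R i x : lpow R i x = iter i R x.
Proof. by elim: i => [|i IHi]; rewrite ?id_lfunE //= comp_lfunE IHi. Qed.
Let lpow_img R i : limg (lpow R i) = iter i (lfun_img R) fullv.
Proof. by elim: i => [|i IHi]; rewrite ?lim1g //= limg_comp IHi. Qed.
Let lpow_adj i v w : lpow T i v *m w^T = v *m (lpow S i w)^T.
Proof. by rewrite !lpowE; elim: i v w => //= i IHi v w; rewrite adjTS IHi -iterSr. Qed.

Lemma rank_iter_adjoint i :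
  \dim (iter i (lfun_img S) fullv) = \dim (iter i (lfun_img T) fullv).
Proof. by rewrite -!lpow_img; apply: rank_adjoint. Qed.

Lemma mem_iter_adjoint i w : w \in iter i (lfun_img S) fullv <->
  (forall v, iter i T v = 0 -> v *m w^T = 0).
Proof.
rewrite -lpow_img; split=> [/(mem_limg_adjoint _ (lpow_adj i)) w0 v|w0].
  by rewrite -lpowE; apply: w0.
by apply/(mem_limg_adjoint _ (lpow_adj i)) => v; rewrite lpowE; apply: w0.
Qed.
End IteratedAdjoint.

(** * Lengths and norms in terms of powers of sigma - 1 *)

Section CyclicModules.
Variables (p n : nat) (p_pr : prime p) (M : vectType 'F_p) (s : 'End(M)).
Hypothesis sN : forall x, iter (p ^ n) s x = x.
Local Notation N := (p ^ n)%N.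

Lemma sub1_lfunE x : (s - \1)%VF x = sub1 s x.
Proof. by rewrite add_lfunE opp_lfunE id_lfunE. Qed.

Lemma iter_sub1_lfunE i x : iter i (s - \1)%VF x = iter i (sub1 s) x.
Proof. by apply: eq_iter => y; apply: sub1_lfunE. Qed.

(** In characteristic p, (s - 1)^(p^n) = s^(p^n) - 1. *)
Lemma iter_sub1_order x : iter N (sub1 s) x = 0.
Proof. by apply: (addrI x); rewrite -iter_pfrobenius // sN addr0. Qed.

Lemma iter_sub1_leq i j x : (i <= j)%N -> iter i (sub1 s) x = 0 -> iter j (sub1 s) x = 0.
Proof.
move=> leij x0; rewrite -(subnK leij) iterD x0 -iter_sub1_lfunE.
by elim: (_ - _)%N => //= m ->; rewrite linear0.
Qed.

Lemma iter_img_sub1_order : iter N (lfun_img (s - \1)%VF) fullv = 0%VS.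
Proof.
apply/eqP; rewrite -subv0; apply/subvP=> _ /iter_lfun_imgP[x ->].
by rewrite iter_sub1_lfunE iter_sub1_order mem0v.
Qed.

(** This turns length into nilpotency. A stable space of dimension at most k is killed by (s - 1)^k;
    conversely, if (s - 1)^k a = 0, the k vectors (s - 1)^j a with j < k span a stable space
    containing a. *)
Lemma dim_cyclicv_leq k a :
  (\dim (cyclicv s N a) <= k)%N = (iter k (sub1 s) a == 0).
Proof.
have N_gt0 : (0 < N)%N by rewrite expn_gt0 prime_gt0.
apply/idP/eqP=> [le_k | ak0].
  by apply: (iter_sub1_dim p_pr sN _ le_k); rewrite ?cyclicv_stable ?mem_cyclicv.
pose U := <<[seq iter j (sub1 s) a | j <- iota 0 k]>>%VS.
have Ua j : iter j (sub1 s) a \in U.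
  have [ltjk|lekj] := ltnP j k; last by rewrite (iter_sub1_leq lekj ak0) mem0v.
  by apply: memv_span; apply/mapP; exists j; rewrite ?mem_iota.
have sU : (s @: U <= U)%VS.
  rewrite limg_span; apply/span_subvP => _ /mapP[_ /mapP[j _ ->] ->].
  rewrite -(subrK (iter j (sub1 s) a) (s _)) rpredD //.
  exact: (Ua j.+1).
apply: (@leq_trans (\dim U)); last first.
  by apply: leq_trans (dim_span _) _; rewrite size_map size_iota.
apply/dimvS/span_subvP => _ /mapP[i _ ->]; elim: i => [|i IHi]; first exact: (Ua 0).
by apply/(subvP sU)/memv_img.
Qed.

Let polyact (P : {poly 'F_p}) x := \sum_(i < size P) P`_i *: iter i s x.

Let polyactE m (P : {poly 'F_p}) x : (size P <= m)%N ->
  polyact P x = \sum_(i < m) P`_i *: iter i s x.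
Proof.
move=> leP; rewrite /polyact (big_ord_widen m (fun i => P`_i *: iter i s x) leP).
rewrite big_mkcond; apply: eq_bigr => i _; case: ltnP => // gei.
by rewrite nth_default ?scale0r.
Qed.

Let polyactXsub1 (P : {poly 'F_p}) x : polyact (P * ('X - 1)) x = sub1 s (polyact P x).
Proof.
pose m := (size P).+1.
rewrite (@polyactE m.+1); last first.
  by apply: leq_trans (size_polyMleq _ _) _; rewrite -polyC1 size_XsubC addn2.
rewrite /sub1 (@polyactE m P) ?leqnSn // mulrBr mulr1.
under eq_bigr do rewrite coefB coefMX scalerBl.
rewrite sumrB; congr (_ - _); last first.
  by rewrite big_ord_recr /= nth_default // scale0r addr0.
rewrite big_ord_recl /= scale0r add0r linear_sum.
by apply: eq_bigr => i _; rewrite linearZ.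
Qed.

(** The norm is (s - 1)^(N - 1): evaluate at s the identity 1 + X + ... + X^(N - 1) = (X - 1)^(N -
    1) over F_p, [polyact P x] being P(s) x. *)
Lemma sum_iter_order x : \sum_(i < N) iter i s x = iter N.-1 (sub1 s) x.
Proof.
have N_gt0 : (0 < N)%N by rewrite expn_gt0 prime_gt0.
have chp : p \in [pchar {poly 'F_p}].
  by rewrite (pchar_lalg {poly 'F_p}) pchar_Fp.
have polyN : ('X - 1) ^+ N.-1 = \sum_(i < N) 'X^i :> {poly 'F_p}.
  have nz : 'X - 1 != 0 :> {poly 'F_p} by rewrite -polyC1 polyXsubC_eq0.
  (* After multiplication by X - 1 both sides are X^N - 1, since N is a power of the
     characteristic. *)
  apply: (mulfI nz); rewrite -exprS prednK // -subrX1.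
  have chN : [pchar {poly 'F_p}].-nat N by rewrite pnatX pnatE // chp.
  by rewrite (exprDn_pchar _ _ chN) (exprNn_pchar _ chN) expr1n.
have -> : iter N.-1 (sub1 s) x = polyact (('X - 1) ^+ N.-1) x.
  elim: N.-1 => [|m IHm]; last by rewrite exprSr polyactXsub1 -IHm.
  by rewrite expr0 (@polyactE 1) ?size_poly1 // big_ord1 coef1 scale1r.
rewrite polyN (_ : \sum_(i < N) 'X^i = \poly_(i < N) 1); last first.
  by rewrite poly_def; apply: eq_bigr => i _; rewrite scale1r.
rewrite (@polyactE N) ?size_poly //; apply: eq_bigr => i _.
by rewrite coef_poly ltn_ord scale1r.
Qed.

End CyclicModules.

(** * Heights, coordinates and lambda *)

Section BulletHeight.
Variables (p n : nat) (p_pr : prime p) (M : vectType 'F_p) (s : 'End(M)).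
Hypothesis sN : forall x, iter (p ^ n) s x = x.
Local Notation N := (p ^ n)%N.

Lemma iter_sub1_stable (U : {vspace M}) i x :
  (s @: U <= U)%VS -> x \in U -> iter i (sub1 s) x \in U.
Proof.
move=> sU Ux; elim: i => //= i IHi; rewrite rpredB //.
by apply/(subvP sU)/memv_img.
Qed.

(** Suppose c = (s - 1)^h y with h >= mu. The component of this equation in the summand of a0 has
    left side c and right side 0, since (s - 1)^h kills a summand of dimension mu; but (s - 1)^(mu -
    1) a0 is not 0. *)
Lemma bullet_pow_height mu r (alpha : 'I_r -> M) a0 h :
    (0 < mu <= N)%N -> cyclic_decomposition s N alpha ->
    ((mu < N)%N -> exists i0, a0 = alpha i0) ->
    ((mu < N)%N -> \dim (cyclicv s N a0) = mu) -> (h < N)%N ->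
  (bullet_pow s n mu a0 \in iter h (lfun_img (s - \1)%VF) fullv) = (h < mu)%N.
Proof.
case/andP=> mu_gt0 mu_le [dir full] a0_alpha a0_dim ltN.
(* For mu = N the vector is 0 and lies in every image, in accordance with h < N. *)
rewrite /bullet_pow; case: ltnP => [lt_mu|ge_mu]; last first.
  by rewrite mem0v (leq_trans ltN).
have N_gt0 : (0 < N)%N by apply: leq_trans ltN.
have [i0 defa0] := a0_alpha lt_mu; have dima := a0_dim lt_mu.
apply/idP/idP=> [/iter_lfun_imgP[y]|lt_h]; last first.
  apply/iter_lfun_imgP; exists (iter (mu.-1 - h) (sub1 s) a0).
  by rewrite iter_sub1_lfunE -iterD subnKC // -ltnS prednK.
rewrite iter_sub1_lfunE => c_im; rewrite ltnNge; apply/negP=> le_h.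
have: iter mu.-1 (sub1 s) a0 == 0.
  have : y \in (\sum_(i < r) cyclicv s N (alpha i))%VS by rewrite full memvf.
  case/memv_sumP=> u Uu defy.
  have sub1_sum i : iter i (sub1 s) y = \sum_(j < r) iter i (sub1 s) (u j).
    rewrite -iter_sub1_lfunE defy; elim: i => [|i IHi] //=.
    by rewrite IHi linear_sum; apply: eq_bigr => j _ /=; rewrite sub1_lfunE.
  move/directv_sum_unique: dir => /(_ (fun j => iter h (sub1 s) (u j))
      (fun j => if j == i0 then iter mu.-1 (sub1 s) a0 else 0)).
  rewrite -sub1_sum -c_im -big_mkcond /= big_pred1_eq eqxx => uniq.
  have /esym/forall_inP/(_ i0 isT) := uniq
    (fun j _ => iter_sub1_stable h (cyclicv_stable _ N_gt0 sN) (Uu j isT))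
    (fun j _ => ltac:(case: eqP => [->|_]; [rewrite -defa0; apply: iter_sub1_stable;
       rewrite ?cyclicv_stable ?mem_cyclicv // | exact: mem0v])).
  rewrite eqxx => /eqP <-; apply/eqP.
  apply: (iter_sub1_dim p_pr sN _ _ (Uu i0 isT)); first exact: cyclicv_stable.
  by rewrite -defa0 dima.
rewrite -(dim_cyclicv_leq p_pr sN) dima.
by rewrite -[X in (X <= _)%N](prednK mu_gt0) ltnn.
Qed.
End BulletHeight.

Section Coordinates.
Variables (p : nat) (p_pr : prime p) (Q : lmodType 'F_p).

(** Since [fdim] chooses some size of a basis, the point is that every admissible size is the
    dimension of U: a basis of the image pulls back along f to a basis of U. *)
Lemma fdim_image (V : vectType 'F_p) (f : {linear V -> Q}) (U : {vspace V}) :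
  injective f -> fdim [set f u | u in [set` U]] = \dim U.
Proof.
move=> f_inj; set S := (X in fdim X); rewrite /fdim.
set D := (X in xget _ X).
suff DE d : D d <-> d = \dim U by apply: xget_unique => [|d]; [apply/DE | case/DE].
split=> [[b [free_b defS]] | ->].
  have : forall i, exists v, v \in U /\ b i = f v.
    move=> i; have : S (b i).
      rewrite defS; exists (fun j => (j == i)%:R).
      rewrite (bigD1 i) //= eqxx scale1r big1 ?addr0 // => j /negPf ->.
      by rewrite scale0r.
    by case=> u Uu <-; exists u.
  case/choice=> v vP; pose X := [tuple v i | i < d].
  have Xi (i : 'I_d) : X`_i = v i by rewrite -tnth_nth tnth_mktuple.
  have sumX (c : 'I_d -> 'F_p) : f (\sum_i c i *: X`_i) = \sum_i c i *: b i.
    rewrite linear_sum; apply: eq_bigr => i _; rewrite Xi linearZ.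
    by rewrite (vP i).2.
  have freeX : free X.
    apply/freeP => c c0 i; apply: free_b.
    by rewrite -sumX c0 linear0.
  rewrite -(size_tuple X) -(eqnP freeX); congr (\dim _).
  apply/eqP; rewrite eqEsubv; apply/andP; split.
    apply/span_subvP => _ /mapP[i _ ->]; exact: (vP i).1.
  apply/subvP=> u Uu; have : S (f u) by exists u.
  rewrite defS => -[c]; rewrite -sumX => /f_inj ->.
  apply: memv_suml => i _; apply: memvZ; apply: memv_span.
  by rewrite mem_nth // size_tuple.
exists (fun i => f (vbasis U)`_i); split=> [c c0 i|].
  have /freeP/(_ c) := basis_free (vbasisP U); apply.
  apply: f_inj; rewrite linear0 -c0 linear_sum; apply: eq_bigr => j _.
  by rewrite linearZ.
apply/seteqP; split=> [_ [u /= Uu <-]|_ [c ->]].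
  exists (fun i => coord (vbasis U) i u); rewrite {1}(coord_vbasis Uu) linear_sum.
  by apply: eq_bigr => i _; rewrite linearZ.
exists (\sum_i c i *: (vbasis U)`_i).
  apply: memv_suml => i _; apply: memvZ; apply: vbasis_mem.
  by rewrite mem_nth // size_tuple.
by rewrite linear_sum; apply: eq_bigr => i _; rewrite linearZ.
Qed.

Lemma linear_combination m (x : 'I_m -> Q) :
  exists g : {linear 'rV['F_p]_m -> Q}, forall v, g v = \sum_i v 0 i *: x i.
Proof.
pose g (v : 'rV['F_p]_m) := \sum_i v 0 i *: x i.
have g_lin : linear g.
  move=> a u v; rewrite /g scaler_sumr -big_split; apply: eq_bigr => i _.
  by rewrite !mxE scalerDl scalerA.
pose gH := GRing.isLinear.Build _ _ _ _ g g_lin.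
by exists (HB.pack g gH : {linear 'rV['F_p]_m -> Q}).
Qed.

(** The elements of A, listed as X, give a linear map g from row vectors onto A; its restriction to
    a complement of the kernel is the desired f. *)
Lemma finite_coordinates (A : set Q) :
    finite_set A -> A 0 -> (forall a x y, A x -> A y -> A (a *: x + y)) ->
  exists d, exists f : {linear 'rV['F_p]_d -> Q}, injective f /\ range f = A.
Proof.
move=> /finite_seqP[X defA] A0 Alin.
have AX i : A X`_i.
  have [lti|gei] := ltnP i (size X); last by rewrite nth_default.
  by rewrite defA /= mem_nth.
have Asum (m : nat) (c : 'I_m -> 'F_p) (x : 'I_m -> Q) :
    (forall i, A (x i)) -> A (\sum_i c i *: x i).
  move=> Ax; elim/big_rec: _ => // i y _ Ay; exact: Alin.
have [g gE] := linear_combination (fun i : 'I_(size X) => X`_i).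
(* As Q may be infinite-dimensional, the kernel of g is obtained as the span of the finitely many
   row vectors that g kills. *)
pose Y := [seq v <- enum 'rV['F_p]_(size X) | g v == 0].
pose U : {vspace 'rV['F_p]_(size X)} := <<Y>>%VS.
have UP v : (v \in U) = (g v == 0).
  apply/idP/idP=> [Uv|gv]; last by apply: memv_span; rewrite mem_filter gv mem_enum.
  have -> : v = \sum_i coord (in_tuple Y) i v *: Y`_i.
    exact: (@coord_span _ _ _ (in_tuple Y)).
  rewrite linear_sum big1 // => i _; rewrite linearZ /=.
  have : Y`_i \in Y by rewrite mem_nth.
  by rewrite mem_filter => /andP[/eqP -> _]; rewrite scaler0.
pose b := vbasis U^C.
have [f fE] := linear_combination (fun i : 'I_(\dim U^C) => g b`_i).
have fg c : f c = g (\sum_i c 0 i *: b`_i).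
  by rewrite fE linear_sum; apply: eq_bigr => i _; rewrite linearZ.
have hC (c : 'I_(\dim U^C) -> 'F_p) : \sum_i c i *: b`_i \in U^C%VS.
  apply: memv_suml => i _; apply: memvZ; apply: vbasis_mem.
  by rewrite mem_nth // size_tuple.
exists (\dim U^C), f; split.
  move=> c1 c2 eqc; apply/eqP; rewrite -subr_eq0; apply/eqP.
  have: f (c1 - c2) = 0 by rewrite linearB /= eqc subrr.
  move: (c1 - c2) => c; rewrite fg => /eqP; rewrite -UP => Uh.
  have : \sum_i c 0 i *: b`_i \in (U :&: U^C)%VS by rewrite memv_cap Uh hC.
  rewrite capv_compl memv0 => /eqP h0; apply/rowP => i; rewrite mxE.
  by have /freeP/(_ (fun i => c 0 i)) := basis_free (vbasisP U^C); apply.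
apply/seteqP; split=> [_ [c _ <-]|x Ax].
  by rewrite fg gE; apply: Asum.
have Xx : x \in X by move: Ax; rewrite defA.
pose i0 := Ordinal (etrans (index_mem x X) Xx).
pose v : 'rV['F_p]_(size X) := delta_mx 0 i0.
have gv : g v = x.
  rewrite gE (bigD1 i0) //= !mxE !eqxx scale1r.
  rewrite nth_index // big1 ?addr0 // => i /negPf nei.
  by rewrite mxE nei andbF scale0r.
have : v \in (U + U^C)%VS by rewrite addv_complf memvf.
case/memv_addP=> u; rewrite UP => /eqP gu [w Cw defv].
exists (\row_i coord b i w) => //; rewrite fg.
have -> : \sum_i (\row_i coord b i w) 0 i *: b`_i = w.
  by rewrite [RHS](coord_vbasis Cw); apply: eq_bigr => i _; rewrite mxE.
by rewrite -gv defv linearD gu add0r.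
Qed.
End Coordinates.

Section Lambda.
Variables (p n : nat) (p_pr : prime p) (Q : lmodType 'F_p) (sQ : Q -> Q) (A : set Q).
Variables (V : vectType 'F_p) (f : {linear V -> Q}) (s : 'End(V)).
Hypotheses (f_inj : injective f) (f_img : range f = A).
Hypothesis fs : forall v, f (s v) = sQ (f v).
Local Notation N := (p ^ n)%N.
Hypothesis sN : forall x, iter N s x = x.

Lemma iter_linear_conj i v : f (iter i s v) = iter i sQ (f v).
Proof. by elim: i => //= i <-; rewrite fs. Qed.

Lemma mod_length_image v : mod_length sQ N (f v) = \dim (cyclicv s N v).
Proof.
rewrite /mod_length -(fdim_image (cyclicv s N v) f_inj); congr fdim.
pose X := map_tuple (fun i : nat => iter i s v) (iota_tuple N 0).
have Xi (i : 'I_N) : X`_i = iter i s v.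
  by rewrite (nth_map 0) ?size_iota // nth_iota.
apply/seteqP; split=> [_ [c ->]|_ [u /= Uu <-]].
  exists (\sum_i c i *: iter i s v).
    apply: memv_suml => i _; apply: memvZ; rewrite -Xi; apply: memv_span.
    by rewrite mem_nth // size_tuple.
  by rewrite linear_sum; apply: eq_bigr => i _; rewrite linearZ /= iter_linear_conj.
exists (fun i => coord X i u); rewrite {1}(@coord_span _ _ _ X u Uu) linear_sum.
by apply: eq_bigr => i _; rewrite linearZ /= Xi iter_linear_conj.
Qed.

Variables (e : Q -> 'F_p) (e' : V -> 'F_p).
Hypothesis ee' : forall v, (\dim (cyclicv s N v) < N)%N -> e (f v) = e' v.

(** An element has length at most h exactly when (s - 1)^h kills it, so h < lambda says that the
    index vanishes on that kernel. For h < N all these elements have length < N, where e may be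
    replaced by [e']. *)
Lemma lambdaP : (lambda sQ N e A <= N)%N /\
  forall h, (h < N)%N ->
    (h < lambda sQ N e A)%N <-> (forall v, iter h (sub1 s) v = 0 -> e' v = 0).
Proof.
rewrite /lambda; set lengths := [set l | exists x, _]; set D := (X in xget _ X).
have lenE l : lengths l <->
    exists2 v, (\dim (cyclicv s N v) < N)%N & e' v != 0 /\ l = \dim (cyclicv s N v).
  split=> [[x []]|[v ltN [ev ->]]].
    rewrite -f_img => -[v _ <-]; rewrite mod_length_image => ltN.
    by rewrite ee' // => ev ->; exists v.
  by exists (f v); split; rewrite ?mod_length_image ?ee' // -f_img; exists v.
have Zlen h : (h < N)%N -> (forall v, iter h (sub1 s) v = 0 -> e' v = 0) <->
    (forall l, lengths l -> (h < l)%N).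
  move=> ltN; split=> [Z l /lenE[v lt [ev ->]]|Z v v0].
    rewrite ltnNge; apply: contra ev => le; apply/eqP/Z/eqP.
    by rewrite -(dim_cyclicv_leq p_pr sN).
  apply/eqP; apply: contraT => ev.
  have := v0 => /eqP; rewrite -(dim_cyclicv_leq p_pr sN) => le.
  have /Z : lengths (\dim (cyclicv s N v)).
    by apply/lenE; exists v => //; apply: leq_ltn_trans ltN.
  by rewrite ltnNge le.
case: (xgetP N D) => [l _ [lenl minl]|Dn].
  split=> [|h ltN]; first by have /lenE[v lt [_ ->]] := lenl; apply: ltnW.
  rewrite Zlen //; split=> [lt l' /minl|/(_ l lenl) //].
  exact: leq_trans.
(* A nonempty set of lengths has a least element; here there is none, so the set is empty and lambda
   takes its default N. *)
have nolen l : ~ lengths l.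
  elim/ltn_ind: l => l IHl lenl; apply: (Dn l); split=> // l' lenl'.
  by rewrite leqNgt; apply/negP => /IHl.
by split=> // h ltN; rewrite Zlen //; split=> // _ l /nolen.
Qed.
End Lambda.

(** * The group extension *)

(** Scalars in F_p act as integer multiples, so additivity implies linearity. *)
Lemma Fp_additive_lfun (p : nat) (p_pr : prime p) (V W : vectType 'F_p) (f : V -> W) :
    (forall x y, f (x + y) = f x + f y) ->
  exists g : 'Hom(V, W), forall x, g x = f x.
Proof.
move=> fD; have f0 : f 0 = 0 by apply: (addrI (f 0)); rewrite -fD !addr0.
have fMn m x : f (x *+ m) = f x *+ m.
  by elim: m => [|m IHm]; rewrite ?mulr0n // !mulrS fD IHm.
have f_lin : linear f.
  move=> a x y; rewrite fD; congr (_ + _).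
  by rewrite -[a]natr_Zp !scaler_nat fMn.
pose fH := GRing.isLinear.Build _ _ _ _ f f_lin.
by exists (linfun (HB.pack f fH : {linear V -> W})) => x; rewrite lfunE.
Qed.

Section BulletGroup.
Variables (k : fieldType) (M : vectType k) (s : 'End(M)) (N : nat) (c : M).
Variables (N_gt0 : (0 < N)%N) (sN : forall x, iter N s x = x) (sc : s c = c).
Local Notation H := (cext N_gt0 sN sc).
Local Notation inj := (@cext_inj _ _ s N c N_gt0 sN sc).
Local Notation gen := (@cext_gen _ _ s N c N_gt0 sN sc).

Lemma cext_conj m : (gen * inj m = inj (s m) * gen)%g.
Proof.
have [_ <- _] := cext_relations N_gt0 sN sc.
by rewrite -!mulgA mulVg mulg1.
Qed.

Lemma cext_injD x y : inj (x + y) = (inj x * inj y)%g.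
Proof. by have [-> _ _] := cext_relations N_gt0 sN sc. Qed.

Lemma cext_inj_genX m i :
  ((inj m * gen) ^+ i = inj (\sum_(j < i) iter j s m) * gen ^+ i)%g.
Proof.
have inj0 : inj 0 = 1%g by [].
elim: i => [|i IHi]; first by rewrite big_ord0 inj0 !expg0 mulg1.
rewrite expgS IHi big_ord_recl /= cext_injD -!mulgA; congr (_ * _)%g.
rewrite !mulgA cext_conj -!mulgA -expgS linear_sum; congr (inj _ * _)%g.
Qed.

(** Changing the lift of sigma by m adds the norm of m to its N-th power: c is determined by the
    extension only modulo norms. *)
Lemma cext_inj_gen_order m :
  ((inj m * gen) ^+ N = inj (\sum_(j < N) iter j s m + c))%g.
Proof. by rewrite cext_inj_genX cext_injD; have [_ _ ->] := cext_relations N_gt0 sN sc. Qed.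

Section Projection.
Variables (gT : finGroupType) (sigma : gT).
Hypothesis sigmaN : #[sigma]%g = N.
Let phi (x : H) : gT := (sigma ^+ (x : M * 'I_N).2)%g.

Lemma cext_projM x y : phi (x * y)%g = (phi x * phi y)%g.
Proof.
have expg_modN i : (sigma ^+ (i %% N) = sigma ^+ i)%g by rewrite -sigmaN expg_mod_order.
by rewrite /phi /= expg_modN expgnDr.
Qed.

Lemma cext_proj_gen : phi gen = sigma.
Proof.
rewrite /phi /cext_gen; case: ifP => /= [N_gt1|]; first by rewrite modn_small ?expg1.
move=> N_le1; have N1 : N = 1%N by apply/eqP; rewrite eqn_leq N_gt0 andbT leqNgt N_le1.
by rewrite mod0n expg0; apply/esym/eqP; rewrite -order_eq1 sigmaN N1.
Qed.

Lemma cext_proj_inj m : phi (inj m) = 1%g.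
Proof. by rewrite /phi /= mod0n expg0. Qed.

Lemma cext_proj_eq1 x : phi x = 1%g -> x = inj x.1.
Proof.
rewrite /phi => /eqP; rewrite -order_dvdn sigmaN => dvd.
case: x dvd => m i /= dvd; congr (_, _); apply: val_inj => /=; rewrite mod0n.
by case: (nat_of_ord i) (ltn_ord i) dvd => // j lt /(dvdn_leq (ltn0Sn _)); rewrite leqNgt lt.
Qed.
End Projection.
End BulletGroup.

(** * Solutions as module isomorphisms onto the dual *)

Section EmbeddingProblem.
Variables (p n : nat) (p_pr : prime p) (F : fieldType) (Om : splittingFieldType F).
Variables (K L : {subfield Om}) (sigma : gal_of K).
Local Notation N := (p ^ n)%N.
Hypotheses (sigmaN : #[sigma]%g = N) (sKL : (K <= L)%VS).
Variable (M : vectType 'F_p) (s : 'End(M)).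
Variables (s_pn : forall m, iter (p ^ n) s m = m) (mu : nat) (a0 : M).
Variables (mu_gt0 : (0 < mu)%N).
Variable a0_dim : (mu < p ^ n)%N -> \dim (cyclicv s (p ^ n) a0) = mu.
Local Notation phi := (@bullet_proj F Om p n p_pr M s s_pn mu a0 mu_gt0 a0_dim K sigma).
Local Notation c := (bullet_pow s n mu a0).
Local Notation H := (bullet p_pr s_pn mu_gt0 a0_dim).
Local Notation cfix := (bullet_pow_fixed p_pr s_pn mu_gt0 a0_dim).
Local Notation inj := (@cext_inj _ M s N c (pn_gt0 n p_pr) s_pn cfix).
Local Notation gen := (@cext_gen _ M s N c (pn_gt0 n p_pr) s_pn cfix).

Variable g : gal_of L.
Hypothesis gK : {in K, g =1 sigma}.
Hypothesis resK : forall x : gal_of L, exists i, {in K, x =1 (sigma ^+ i)%g}.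
Variables (W : vectType 'F_p) (S : 'End(W)) (D : gal_of L -> W).
Local Notation Delta := 'Gal(L / K)%g.
Hypothesis DM : {in Delta &, forall x y, D (x * y)%g = D x + D y}.
Hypothesis D_inj : {in Delta &, injective D}.
Hypothesis D_surj : forall w, exists2 x, x \in Delta & D x = w.
Hypothesis DJ : {in Delta, forall x, D (x ^ g)%g = S (D x)}.

Let DeltaP (x : gal_of L) : reflect {in K, forall a, x a = a} (x \in Delta).
Proof. by rewrite gal_kHom //; apply: kAHomP. Qed.

Let inL a : a \in K -> a \in L. Proof. exact: (subvP sKL). Qed.

Let gXK i : {in K, (g ^+ i)%g =1 (sigma ^+ i)%g}.
Proof.
elim: i => [|i IHi] a Ka; first by rewrite !expg0 !gal_id.
by rewrite !expgSr !galM ?inL // IHi // gK // memv_gal.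
Qed.

Let gJ x : x \in Delta -> (x ^ g)%g \in Delta.
Proof.
move/DeltaP=> xK; apply/DeltaP=> a Ka.
have [i giK] := resK (g^-1)%g; have Kga : (g^-1)%g a \in K by rewrite giK // memv_gal.
rewrite conjgE !galM ?inL ?memv_gal ?inL // xK //.
by rewrite -galM ?inL // mulVg gal_id.
Qed.

Let D1 : D 1%g = 0.
Proof. by apply: (addrI (D 1%g)); rewrite -DM ?group1 // mulg1 addr0. Qed.

Let DV : {in Delta, forall x, D x^-1%g = - D x}.
Proof.
by move=> x Dx; apply: (addrI (D x)); rewrite -DM ?groupV // mulgV D1 subrr.
Qed.

Let Dconj : {in Delta &, forall x y, D (x ^ y)%g = D x}.
Proof. by move=> x y Dx Dy; rewrite conjgE !DM ?groupM ?groupV // DV // addrC addrK. Qed.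

Let gN_Delta : (g ^+ N)%g \in Delta.
Proof.
by apply/DeltaP=> a Ka; rewrite gXK // -sigmaN expg_order gal_id.
Qed.

Lemma D_genX x i : x \in Delta -> exists2 y, y \in Delta &
  ((g * x) ^+ i = g ^+ i * y)%g /\ D y = \sum_(j < i) iter j S (D x).
Proof.
move=> Dx; elim: i => [|i [y Dy [eqy DyE]]].
  by exists 1%g; rewrite ?group1 // !expg0 mulg1 big_ord0 D1.
exists (y ^ g * x)%g; first by rewrite groupM ?gJ.
split; first by rewrite !expgSr eqy conjgE -!mulgA mulKVg.
by rewrite DM ?gJ // DJ // DyE linear_sum big_ord_recl /= addrC.
Qed.

Let phiM (x y : H) : phi (x * y)%g = (phi x * phi y)%g.
Proof. exact: cext_projM. Qed.

Let phi_inj m : phi (inj m) = 1%g.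
Proof. exact: cext_proj_inj. Qed.

Let phi_gen : phi gen = sigma.
Proof. exact: cext_proj_gen. Qed.

Let phi_eq1 (x : H) : phi x = 1%g -> x = inj (x : M * 'I_N).1.
Proof. exact: cext_proj_eq1. Qed.

(** A solution restricts to an isomorphism between M and Gal(L/K), read in W through D. The only
    further invariant of the extension is the N-th power of a lift of sigma, and w records the
    freedom in choosing that lift. *)
Lemma solves_embedding_dual :
  solves_embedding L phi <->
  exists f : 'Hom(M, W), [/\ lker f = 0%VS, limg f = fullv,
    forall x, f (s x) = S (f x)
    & exists w, f c = D (g ^+ N)%g + \sum_(j < N) iter j S w].
Proof.
split=> [[psi [[psi' psiK psi'K] psiM psires]] | [f [kerf imf fs [w fc]]]].
  have psi'M x y : psi' (x * y)%g = (psi' y * psi' x)%g.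
    by apply: (can_inj psiK); rewrite psiM !psi'K.
  have psi1 : psi 1%g = 1%g by apply: (mulgI (psi 1%g)); rewrite -psiM !mulg1.
  have psiX x i : psi (x ^+ i)%g = (psi x ^+ i)%g.
    by elim: i => [|i IHi]; rewrite ?psi1 // expgSr psiM IHi expgS.
  have psiDelta x : x \in Delta -> exists m, psi x = inj m.
    move/DeltaP=> xK; exists (psi x).1.
    apply: phi_eq1; apply/eqP/gal_eqP => a Ka.
    by rewrite gal_id -[RHS]xK // -psires.
  have psi'Delta m : psi' (inj m) \in Delta.
    apply/DeltaP=> a Ka; rewrite -psires // psi'K.
    by rewrite phi_inj gal_id.
  have [f fE] : exists f : 'Hom(M, W), forall m, f m = D (psi' (inj m)).
    apply: Fp_additive_lfun => // x y; rewrite cext_injD psi'M DM //.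
    exact: addrC.
  (* Both [psi g] and [gen] lie over sigma, so they differ by an element of M. *)
  have [m1 defg] : exists m1, psi g = (inj m1 * gen)%g.
    have phig : phi (psi g) = sigma.
      by apply/eqP/gal_eqP => a Ka; rewrite psires // gK.
    exists (psi g * gen^-1 : H)%g.1; rewrite -phi_eq1 ?mulgVK //.
    by apply: (mulIg (phi gen)); rewrite -phiM mulgVK phig phi_gen mul1g.
  have fs x : f (s x) = S (f x).
    rewrite !fE -DJ //; congr (D _); apply: (can_inj psiK).
    rewrite psi'K conjgE !psiM psi'K.
    have -> : psi (g^-1)%g = (psi g)^-1%g.
      by apply: (mulIg (psi g)); rewrite -psiM mulgV mulVg.
    apply: (mulIg (psi g)); rewrite mulgVK defg -[RHS]mulgA cext_conj !mulgA.
    by rewrite -!cext_injD addrC.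
  have fiter j x : f (iter j s x) = iter j S (f x) by elim: j => //= j <-.
  exists f; split=> //.
  - apply/eqP; rewrite -subv0; apply/subvP=> x; rewrite memv_ker fE memv0 => /eqP.
    rewrite -D1 => /D_inj; rewrite group1 psi'Delta => /(_ isT isT)/(congr1 psi).
    by rewrite psi'K psi1 => -[->].
  - apply/eqP; rewrite eqEsubv subvf; apply/subvP=> w _.
    have [x Dx <-] := D_surj w; have [m psix] := psiDelta x Dx.
    by rewrite -[x]psiK psix -fE memv_img ?memvf.
  (* By the choice of [m1], g^N corresponds to the norm of [m1] plus c; the sign moves that norm to
     the other side. *)
  exists (- f m1).
  have -> : D (g ^+ N)%g = f (\sum_(j < N) iter j s m1 + c).
    by rewrite fE -cext_inj_gen_order -defg -psiX psiK.
  rewrite linearD linear_sum addrAC -big_split big1 ?add0r // => j _ /=.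
  rewrite fiter; elim: (nat_of_ord j) => [|i IHi]; first exact: subrr.
  by rewrite !iterS -linearD IHi linear0.
have /choice[Dinv DinvP] : forall w, exists x, x \in Delta /\ D x = w.
  by move=> u; have [x Dx <-] := D_surj u; exists x.
have DinvD u : Dinv u \in Delta by case: (DinvP u).
have DinvK u : D (Dinv u) = u by case: (DinvP u).
have DinvE x : x \in Delta -> Dinv (D x) = x by move=> Dx; apply: D_inj; rewrite ?DinvK.
(* Correcting g by w gives a lift of sigma whose N-th power corresponds exactly to f c. *)
have [t0 def_t0] : exists t0, t0 = (g * Dinv w)%g by exists (g * Dinv w)%g.
have t0K : {in K, t0 =1 sigma}.
  move=> a Ka; rewrite def_t0 galM ?inL // gK //; apply: (DeltaP _ (DinvD w)).
  exact: memv_gal.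
have t0XK i : {in K, (t0 ^+ i)%g =1 (sigma ^+ i)%g}.
  elim: i => [|i IHi] a Ka; first by rewrite !expg0 !gal_id.
  by rewrite !expgSr !galM ?inL // IHi // t0K // memv_gal.
have t0N : (t0 ^+ N)%g = Dinv (f c).
  have [y Dy [eqy DyE]] := D_genX N (DinvD w).
  rewrite def_t0 eqy; apply: D_inj; rewrite ?groupM // DinvK DM //.
  by rewrite fc DyE DinvK.
have t0J x : x \in Delta -> (x ^ t0)%g = Dinv (S (D x)).
  move=> Dx; apply: D_inj; rewrite // def_t0 conjgM; last by rewrite Dconj ?gJ ?DinvK ?DJ.
  by rewrite groupJ ?gJ.
(* A solution must reverse products, whereas the universal property yields a homomorphism h. So M
   and the generator are sent to inverses, and the solution will be the inverse bijection of x |->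
   (h x)^-1. *)
pose Fm m := ((Dinv (f m))^-1)%g.
have FmD : {morph Fm : x y / x + y >-> (x * y)%g}.
  move=> x y; rewrite /Fm -invMg; congr (_^-1)%g; apply: D_inj; rewrite ?groupM //.
  by rewrite DM // !DinvK linearD addrC.
have Fmt m : (t0^-1 * Fm m * t0^-1^-1)%g = Fm (s m).
  by rewrite invgK -mulgA -conjgE conjVg t0J // DinvK /Fm -fs.
have FmN : ((t0^-1)^+ N)%g = Fm c by rewrite expgVn t0N.
have [h [[hM hinj hgen] _]] := 
  @cext_universal _ _ s N c (pn_gt0 n p_pr) s_pn cfix _ Fm (t0^-1)%g FmD Fmt FmN.
have h1 : h 1%g = 1%g by apply: (mulgI (h 1%g)); rewrite -hM !mulg1.
have hX x i : h (x ^+ i)%g = (h x ^+ i)%g.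
  by elim: i => [|i IHi]; rewrite ?h1 // !expgS hM IHi.
have hE (x : H) : ((h x)^-1 = t0 ^+ (x : M * 'I_N).2 * Dinv (f (x : M * 'I_N).1))%g.
  by rewrite {1}(cextE x) hM hX hinj hgen invMg expgVn !invgK.
have hK (x : H) : {in K, (h x)^-1%g =1 phi x}.
  move=> a Ka; rewrite hE galM ?inL // t0XK //.
  by apply: (DeltaP _ (DinvD _)); apply: memv_gal.
have f_inj : injective f.
  move=> x y eqxy; apply/eqP; rewrite -subr_eq0 -memv0 -kerf memv_ker linearB /=.
  by rewrite eqxy subrr.
have h_inj : injective h.
  move=> x y eqxy; suff {x y eqxy} ker1 z : h z = 1%g -> z = 1%g.
    apply: (mulIg (y^-1)%g); rewrite mulgV; apply: ker1.
    by rewrite hM eqxy -hM mulgV.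
  move=> hz1; have phiz : phi z = 1%g.
    by apply/eqP/gal_eqP=> a Ka; rewrite -hK // hz1 invg1 !gal_id.
  have defz := phi_eq1 phiz.
  move: hz1; rewrite defz hinj => /eqP; rewrite /Fm invg_eq1 => /eqP/(congr1 D).
  by rewrite DinvK D1 -(linear0 f) => /f_inj ->.
have h_surj x : exists y : H, (h y)^-1%g = x.
  have [i xK] := resK x.
  have ltiN : (i %% N < N)%N by rewrite ltn_pmod ?pn_gt0.
  have xK' : {in K, x =1 (sigma ^+ (i %% N))%g}.
    by move=> a Ka; rewrite xK // -sigmaN expg_mod_order.
  pose z := ((t0 ^+ (i %% N))^-1 * x)%g.
  have Dz : z \in Delta.
    have [j tjK] := resK ((t0 ^+ (i %% N))^-1)%g.
    apply/DeltaP=> a Ka; rewrite galM ?inL // xK' -?t0XK ?tjK ?memv_gal //.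
    by rewrite -tjK // -galM ?inL // mulVg gal_id.
  have /memv_imgP[m _ defm] : D z \in limg f by rewrite imf memvf.
  exists ((m, Ordinal ltiN) : M * 'I_N) => /=.
  by rewrite hE /= -defm DinvE // mulKVg.
have /choice[psi psiP] := h_surj.
have psiK (y : H) : psi ((h y)^-1)%g = y.
  by apply: h_inj; apply: invg_inj; rewrite psiP.
exists psi; split.
- by exists (fun y : H => (h y)^-1%g).
- by move=> x y; apply: h_inj; apply: invg_inj; rewrite psiP hM invMg !psiP.
- by move=> x a Ka; rewrite -hK // psiP.
Qed.
End EmbeddingProblem.

(** * Reduction to a perfect pairing *)

Lemma iter_comm (T : Type) (f g : T -> T) i x : (forall y, f (g y) = g (f y)) ->
  iter i (fun y => f (g y)) x = iter i f (iter i g x).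
Proof.
move=> fg; have fig j y : iter j f (g y) = g (iter j f y).
  by elim: j => //= j ->; rewrite fg.
by elim: i => //= i ->; rewrite fig.
Qed.

Section IsoImages.
Variables (k : fieldType) (V W : vectType k) (T : 'End(V)) (S : 'End(W)) (g : 'Hom(V, W)).
Hypotheses (g_inj : lker g = 0%VS) (g_surj : limg g = fullv).
Hypothesis gT : forall x, g (T x) = S (g x).

Lemma iso_iter_img i : (g @: iter i (lfun_img T) fullv = iter i (lfun_img S) fullv)%VS.
Proof.
elim: i => //= i <-; rewrite -!limg_comp; apply: eq_in_limg => x _.
by rewrite !comp_lfunE gT.
Qed.

Lemma iso_dim_iter_img i :
  \dim (iter i (lfun_img T) fullv) = \dim (iter i (lfun_img S) fullv).
Proof. by rewrite -iso_iter_img limg_dim_eq // g_inj capv0. Qed.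

Lemma iso_mem_iter_img i x :
  (x \in iter i (lfun_img T) fullv) = (g x \in iter i (lfun_img S) fullv).
Proof.
rewrite -iso_iter_img; apply/idP/idP=> [/memv_img -> //|/memv_imgP[y Uy /eqP]].
by rewrite -subr_eq0 -linearB -memv_ker g_inj memv0 subr_eq0 => /eqP ->.
Qed.
End IsoImages.

Lemma exists_adjoint (k : fieldType) d (T : 'End('rV[k]_d)) :
  exists S : 'End('rV[k]_d), forall v w, T v *m w^T = v *m (S w)^T.
Proof.
exists (linfun (mulmxr (lin1_mx T)^T)) => v w.
by rewrite lfunE /= trmx_mul trmxK mulmxA mul_rV_lin1.
Qed.

(* u - 1 and u^-1 - 1 differ by the unit - u^-1, so their powers have the same
   kernels and images. *)
Section InverseSub1.
Variables (p : nat) (V : vectType 'F_p) (R R' : 'End(V)).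
Hypotheses (RK : cancel R R') (R'K : cancel R' R).

Lemma iter_sub1_inv i x :
  iter i (sub1 R') x = iter i (fun y => - R' y) (iter i (sub1 R) x).
Proof.
rewrite -iter_comm => [|y]; last first.
  by rewrite /sub1 linearB /= RK linearN /= R'K opprK opprB addrC.
by apply: eq_iter => y; rewrite /sub1 linearB /= RK opprB.
Qed.

Lemma iter_sub1_inv_eq0 i x : iter i (sub1 R) x = 0 -> iter i (sub1 R') x = 0.
Proof.
by rewrite iter_sub1_inv => ->; elim: i => //= i ->; rewrite linear0 oppr0.
Qed.

Lemma iter_sub1_inv_img i :
  (iter i (lfun_img (R' - \1)%VF) fullv <= iter i (lfun_img (R - \1)%VF) fullv)%VS.
Proof.
apply/subvP=> _ /iter_lfun_imgP[x ->]; apply/iter_lfun_imgP.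
exists (iter i (fun y => - R' y) x); rewrite !iter_sub1_lfunE -iter_comm => [|y].
  by apply: eq_iter => y; rewrite /sub1 linearN /= R'K opprK addrC.
by rewrite /sub1 linearB /= RK linearN /= R'K opprK opprB addrC.
Qed.
End InverseSub1.

Section ReductionToPairing.
Variables (p n : nat) (p_pr : prime p) (F : fieldType) (Om : splittingFieldType F).
Variables (K L : {subfield Om}) (sigma : gal_of K).
Local Notation N := (p ^ n)%N.
Hypotheses (sigmaN : #[sigma]%g = N) (sKL : (K <= L)%VS).
Variable (M : vectType 'F_p) (s : 'End(M)).
Variables (s_pn : forall m, iter (p ^ n) s m = m) (mu : nat) (a0 : M).
Variables (mu_gt0 : (0 < mu)%N).
Variable a0_dim : (mu < p ^ n)%N -> \dim (cyclicv s (p ^ n) a0) = mu.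
Hypothesis mu_le : (mu <= p ^ n)%N.
Variables (r : nat) (alpha : 'I_r -> M).
Hypothesis alpha_dec : cyclic_decomposition s (p ^ n) alpha.
Hypothesis a0_alpha : (mu < p ^ n)%N -> exists i0, a0 = alpha i0.
Local Notation phi := (@bullet_proj F Om p n p_pr M s s_pn mu a0 mu_gt0 a0_dim K sigma).
Local Notation c := (bullet_pow s n mu a0).

Variable g : gal_of L.
Hypothesis gK : {in K, g =1 sigma}.
Hypothesis resK : forall x : gal_of L, exists i, {in K, x =1 (sigma ^+ i)%g}.
Variables (Q : lmodType 'F_p) (sQ : Q -> Q) (A : set Q) (e : Q -> 'F_p).
Hypothesis submodA : finite_submodule sQ A.
Hypothesis sQD : forall x y, sQ (x + y) = sQ x + sQ y.
Hypothesis sQN : forall x, A x -> iter N sQ x = x.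
Variable pr : gal_of L -> Q -> 'F_p.
Local Notation Delta := 'Gal(L / K)%g.
Hypothesis prM : {in Delta &, forall x y a, A a -> pr (x * y)%g a = pr x a + pr y a}.
Hypothesis prD : {in Delta, forall x a b, A a -> A b -> pr x (a + b) = pr x a + pr x b}.
Hypothesis pr_faithful : {in Delta, forall x, (forall a, A a -> pr x a = 0) -> x = 1%g}.
Hypothesis pr_nondegenerate : forall a, A a -> {in Delta, forall x, pr x a = 0} -> a = 0.
Hypothesis prJ : {in Delta, forall x a, A a -> pr (x ^ g)%g (sQ a) = pr x a}.
Hypothesis pr_index : forall a, A a -> \sum_(i < N) iter i sQ a = 0 -> pr (g ^+ N)%g a = e a.

(** This is the part common to both characteristics: it uses only the formal properties of the
    pairing. The hypothesis on the index concerns elements of zero norm, that is, of length < N. *)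
Theorem solves_embedding_pairing :
  solves_embedding L phi <-> module_iso sQ s A /\ mu = lambda sQ N e A.
Proof.
have N_gt0 := pn_gt0 n p_pr.
have [finA A0 Alin AsQ] := submodA.
have [d [f [f_inj f_img]]] := finite_coordinates finA A0 Alin.
have Af v : A (f v) by rewrite -f_img; exists v.
have Aex a : A a -> exists v, f v = a by rewrite -f_img => -[v _ <-]; exists v.
have [R fR] : exists R : 'End('rV['F_p]_d), forall v, f (R v) = sQ (f v).
  have /choice[R0 R0P] : forall v, exists u, f u = sQ (f v) by move=> v; apply/Aex/AsQ.
  have [|R RE] := @Fp_additive_lfun p p_pr _ _ R0.
    by move=> x y; apply: f_inj; rewrite !linearD /= !R0P linearD sQD.
  by exists R => v; rewrite RE R0P.
have RN v : iter N R v = v.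
  by apply: f_inj; rewrite (iter_linear_conj fR) sQN.
have [R' RK R'K] : exists2 R' : 'End('rV['F_p]_d), cancel R R' & cancel R' R.
  exists (iter N.-1 (fun h => R \o h)%VF \1%VF) => v.
    have lpowE h x : iter h (fun h => R \o h)%VF \1%VF x = iter h R x.
      by elim: h x => [|h IHh] x; rewrite ?id_lfunE //= comp_lfunE IHh.
    by rewrite lpowE -iterSr prednK.
  have lpowE h x : iter h (fun h => R \o h)%VF \1%VF x = iter h R x.
    by elim: h x => [|h IHh] x; rewrite ?id_lfunE //= comp_lfunE IHh.
  by rewrite lpowE -iterS prednK.
(* By [prJ], conjugation by g is adjoint to the inverse of sigma; hence S is the adjoint of [R'] and
   not of R. *)
have [S adjS] := exists_adjoint R'.
have adjS1 v w : (R' - \1)%VF v *m w^T = v *m ((S - \1)%VF w)^T.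
  by rewrite !sub1_lfunE /sub1 mulmxBl adjS linearB mulmxBr.
pose D x : 'rV['F_p]_d := \row_i pr x (f (delta_mx 0 i)).
have prE x v : x \in Delta -> pr x (f v) = (v *m (D x)^T) 0 0.
  move=> Dx; pose prx u := pr x (f u).
  have prxD u w : prx (u + w) = prx u + prx w by rewrite /prx linearD prD.
  have prx0 : prx 0 = 0 by apply: (addrI (prx 0)); rewrite -prxD !addr0.
  have prxMn m u : prx (u *+ m) = prx u *+ m.
    by elim: m => [|m IHm]; rewrite ?mulr0n // !mulrS prxD IHm.
  rewrite -/(prx v) {1}(row_sum_delta v) (big_morph prx prxD prx0) mxE.
  by apply: eq_bigr => i _; rewrite !mxE -[v 0 i]natr_Zp scaler_nat prxMn mulr_natl.
have D_ext x (w : 'rV['F_p]_d) : x \in Delta ->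
    (forall v, pr x (f v) = (v *m w^T) 0 0) -> D x = w.
  move=> Dx eqw; apply/eqP; rewrite -subr_eq0; apply/eqP/dot_nondegenerate => v.
  apply/eqP; rewrite dot_symm_eq0 linearB mulmxBr subr_eq0; apply/eqP/matrixP.
  by move=> i j; rewrite !ord1 -prE.
have DM : {in Delta &, forall x y, D (x * y)%g = D x + D y}.
  by move=> x y Dx Dy; apply/rowP=> i; rewrite !mxE prM.
have D_eq0 x : x \in Delta -> D x = 0 -> x = 1%g.
  move=> Dx D0; apply: pr_faithful => // a /Aex[v <-].
  by rewrite prE // D0 trmx0 mulmx0 mxE.
have D_inj : {in Delta &, injective D}.
  move=> x y Dx Dy eqD; apply: (mulIg (y^-1)%g); rewrite mulgV.
  apply: D_eq0; first by rewrite groupM ?groupV.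
  by apply: (addIr (D y)); rewrite -DM ?groupM ?groupV // mulgVK add0r.
have DMn x m : x \in Delta -> D (x ^+ m)%g = D x *+ m.
  move=> Dx; elim: m => [|m IHm].
    by apply: (addrI (D 1%g)); rewrite expg0 -DM ?group1 // mulg1 mulr0n addr0.
  by rewrite expgS DM ?groupX // IHm mulrS.
(* By nondegeneracy no nonzero vector is orthogonal to all D x, so they span. Their set is closed
   under F_p-combinations, scalars being realized by powers in the group, so it is the whole
   space. *)
have D_surj w : exists2 x, x \in Delta & D x = w.
  pose U := <<[seq D x | x in Delta]>>%VS.
  have fullU : U = fullv.
    apply: contrapT => /exists_orthogonal[v nzv orth]; case/eqP: nzv; apply: f_inj.
    rewrite linear0; apply: pr_nondegenerate => // x Dx; rewrite prE // orth ?mxE //.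
    by apply/memv_span/fintype.image_f.
  have : w \in U by rewrite fullU memvf.
  move=> Uw; rewrite (@coord_span _ _ _ (in_tuple _) w Uw).
  elim/big_rec: _ => [|i y _ [x Dx <-]].
    by exists 1%g; rewrite ?group1 // -(mulr0n (D 1%g)) -DMn ?group1 // expg0.
  have /fintype.imageP[z Dz ->] : [seq D x | x in Delta]`_i \in [seq D x | x in Delta].
    by rewrite mem_nth.
  set a := coord _ _ _; exists (z ^+ a * x)%g; first by rewrite groupM ?groupX.
  by rewrite DM ?groupX // DMn // -[a in RHS]natr_Zp scaler_nat.
have gN_Delta : (g ^+ N)%g \in Delta.
  rewrite gal_kHom //; apply/kAHomP => a Ka.
  have -> : (g ^+ N)%g a = (sigma ^+ N)%g a.
    elim: (N) => [|i IHi]; first by rewrite !expg0 !gal_id.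
    by rewrite !expgSr !galM ?(subvP sKL) // IHi gK // memv_gal.
  by rewrite -sigmaN expg_order gal_id.
have gJ x : x \in Delta -> (x ^ g)%g \in Delta.
  rewrite !gal_kHom // => /kAHomP xK; apply/kAHomP => a Ka.
  have [i giK] := resK (g^-1)%g; have Kga : (g^-1)%g a \in K by rewrite giK // memv_gal.
  rewrite conjgE !galM ?memv_gal ?(subvP sKL) // xK //.
  by rewrite -galM ?(subvP sKL) // mulVg gal_id.
have DJ : {in Delta, forall x, D (x ^ g)%g = S (D x)}.
  move=> x Dx; apply: D_ext => [|v]; first exact: gJ.
  by rewrite -adjS -[v in LHS]R'K fR prJ // prE.
pose chi := D (g ^+ N)%g.
have Schi : S chi = chi.
  by rewrite -DJ // conjgE -expgSr expgS mulKg.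
have R'N v : iter N R' v = v.
  rewrite -{1}(RN v); elim: (N) v => // i IHi v.
  by rewrite iterSr iterS RK IHi.
have SN w : iter N S w = w.
  apply/eqP; rewrite -subr_eq0; apply/eqP/dot_nondegenerate => v.
  apply/eqP; rewrite dot_symm_eq0 linearB mulmxBr subr_eq0; apply/eqP.
  rewrite -[v in RHS]R'N; elim: (N) v => // i IHi v.
  by rewrite iterS -adjS IHi -iterSr.
(* Length < N means that (R - 1)^(N - 1), the norm, kills v, which is the hypothesis of
   [pr_index]. *)
have ee' v : (\dim (cyclicv R N v) < N)%N -> e (f v) = (v *m chi^T) 0 0.
  move=> ltN; rewrite -prE // pr_index //.
  have -> : \sum_(i < N) iter i sQ (f v) = f (\sum_(i < N) iter i R v).
    by rewrite linear_sum; apply: eq_bigr => i _; rewrite (iter_linear_conj fR).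
  rewrite (sum_iter_order n p_pr) //.
  have -> : iter N.-1 (sub1 R) v = 0 by apply/eqP; rewrite -(dim_cyclicv_leq p_pr RN) -ltnS prednK.
  exact: linear0.
have [lambda_le lambdaE] := lambdaP p_pr f_inj f_img fR RN ee'.
have chi_height h : (h < N)%N ->
    (chi \in iter h (lfun_img (S - \1)%VF) fullv) = (h < lambda sQ N e A)%N.
  move=> ltN; apply/idP/idP.
    move/(mem_iter_adjoint adjS1) => chi0; apply/lambdaE => // v v0.
    rewrite chi0 ?mxE // iter_sub1_lfunE; exact: (iter_sub1_inv_eq0 RK R'K).
  move/(lambdaE _ ltN) => chi0; apply/(mem_iter_adjoint adjS1) => v.
  rewrite iter_sub1_lfunE => /(iter_sub1_inv_eq0 R'K RK)/chi0 v0.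
  by apply/matrixP=> i j; rewrite !ord1 v0 mxE.
have c_height h : (h < N)%N ->
    (c \in iter h (lfun_img (s - \1)%VF) fullv) = (h < mu)%N.
  by apply: (bullet_pow_height p_pr s_pn) alpha_dec a0_alpha a0_dim; rewrite mu_gt0.
have dimSR i : \dim (iter i (lfun_img (S - \1)%VF) fullv)
    = \dim (iter i (lfun_img (R - \1)%VF) fullv).
  rewrite (rank_iter_adjoint adjS1); congr (\dim _); apply/eqP.
  by rewrite eqEsubv !iter_sub1_inv_img.
have c_fixed : s c = c := bullet_pow_fixed p_pr s_pn mu_gt0 a0_dim.
have sub1_fs (V W : vectType 'F_p) (u : 'Hom(V, W)) (a : 'End(V)) (b : 'End(W)) :
    (forall x, u (a x) = b (u x)) -> forall x, u ((a - \1)%VF x) = (b - \1)%VF (u x).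
  by move=> uab x; rewrite !sub1_lfunE /sub1 linearB /= uab.
have fs_sub1 (V W : vectType 'F_p) (u : 'Hom(V, W)) (a : 'End(V)) (b : 'End(W)) :
    (forall x, u ((a - \1)%VF x) = (b - \1)%VF (u x)) -> forall x, u (a x) = b (u x).
  move=> uab x; have := uab x; rewrite !sub1_lfunE /sub1 linearB /=.
  by move/addIr.
have classify (V : vectType 'F_p) (a : 'End(V)) : (forall x, iter N a x = x) ->
    (forall i, \dim (iter i (lfun_img (s - \1)%VF) fullv)
       = \dim (iter i (lfun_img (a - \1)%VF) fullv)) ->
    forall x y, s x = x -> a y = y ->
    (forall i, (x \in iter i (lfun_img (s - \1)%VF) fullv)
       = (y \in iter i (lfun_img (a - \1)%VF) fullv)) ->
  exists u : 'Hom(M, V), [/\ lker u = 0%VS, limg u = fullv,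
    forall z, u (s z) = a (u z) & u x = y].
  move=> aN dims x y sx ay heq.
  have [||||||u [ker im uT ux]] := @nilpotent_classification _ _ _
    (s - \1)%VF (a - \1)%VF N x y => //.
  - exact: iter_img_sub1_order.
  - exact: iter_img_sub1_order.
  - by rewrite sub1_lfunE /sub1 sx subrr.
  - by rewrite sub1_lfunE /sub1 ay subrr.
  by exists u; split=> //; apply: fs_sub1.
rewrite (solves_embedding_dual p_pr sigmaN sKL s_pn mu_gt0 a0_dim gK resK DM D_inj D_surj DJ).
split=> [[u [ker im us [w uc]]]|].
  split.
    (* M is isomorphic to the dual of A, whose ranks are those of A; the classification, with zero
       as the marked vector on both sides, makes M isomorphic to A itself. *)
    have [i|x|u' [ker' im' us' _]] := classify _ R RN _ 0 0 (linear0 _) (linear0 _).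
    - by rewrite -dimSR; apply: (iso_dim_iter_img ker im); apply: sub1_fs.
    - by rewrite !mem0v.
    exists (f \o u' : {linear M -> Q}); split.
    - move=> x y /= /f_inj /eqP; rewrite -subr_eq0 -linearB -memv_ker ker' memv0.
      by rewrite subr_eq0 => /eqP.
    - apply/seteqP; split=> [_ [x _ <-]|a /Aex[v <-]]; first exact: Af.
      have /memv_imgP[x _ ->] : v \in limg u' by rewrite im' memvf.
      by exists x.
    - by move=> m /=; rewrite us' fR.
  (* The images of c and chi differ by a norm, which is divisible by (S - 1)^h for all h < N. *)
  have eqh h : (h < N)%N -> (h < mu)%N = (h < lambda sQ N e A)%N.
    move=> ltN; rewrite -c_height // -chi_height //.
    rewrite (iso_mem_iter_img ker im (sub1_fs _ _ _ _ _ us)) uc.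
    rewrite (sum_iter_order n p_pr) rpredDr //.
    apply/iter_lfun_imgP; exists (iter (N.-1 - h) (sub1 S) w).
    by rewrite iter_sub1_lfunE -iterD subnKC // -ltnS prednK.
  apply/eqP; rewrite eqn_leq; apply/andP; split; rewrite leqNgt; apply/negP => lt.
    by have := eqh _ (leq_trans lt mu_le); rewrite lt ltnn.
  by have := eqh _ (leq_trans lt lambda_le); rewrite lt ltnn.
move=> [[f' [f'_inj f'_img f's]] mu_eq].
have /choice[u0 u0P] : forall m, exists v, f v = f' m.
  by move=> m; apply: Aex; rewrite -f'_img; exists m.
have [|u1 u1E] := @Fp_additive_lfun p p_pr _ _ u0.
  by move=> x y; apply: f_inj; rewrite linearD !u0P linearD.
have fu m : f (u1 m) = f' m by rewrite u1E u0P.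
have ker1 : lker u1 = 0%VS.
  apply/eqP; rewrite -subv0; apply/subvP=> x; rewrite memv_ker memv0 => /eqP ux.
  by apply/eqP/f'_inj; rewrite -fu ux !linear0.
have im1 : limg u1 = fullv.
  apply/eqP; rewrite eqEsubv subvf; apply/subvP=> v _.
  have : A (f v) by []; rewrite -f'_img => -[m _]; rewrite -fu => /f_inj <-.
  by rewrite memv_img ?memvf.
have us1 m : u1 (s m) = R (u1 m) by apply: f_inj; rewrite fR !fu f's.
have dims i : \dim (iter i (lfun_img (s - \1)%VF) fullv)
    = \dim (iter i (lfun_img (S - \1)%VF) fullv).
  by rewrite dimSR; apply: (iso_dim_iter_img ker1 im1); apply: sub1_fs.
have [lt_mu|ge_mu] := ltnP mu N.
  have [i|u [ker im us uc]] := classify _ S SN dims c chi c_fixed Schi.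
    have [ltN|geN] := ltnP i N; first by rewrite c_height // chi_height // mu_eq.
    have im0 (V : vectType 'F_p) (a : 'End(V)) : (forall x, iter N a x = x) ->
        iter i (lfun_img (a - \1)%VF) fullv = 0%VS.
      move=> aN; rewrite -(subnK geN) iterD (iter_img_sub1_order p_pr) //.
      by elim: (i - N)%N => //= j ->; rewrite limg0.
    (* For i >= N both images vanish, so it remains to see that c and chi are nonzero: both have the
       finite height mu < N, being outside the mu-th image. *)
    rewrite !im0 // !memv0.
    have nz (V : vectType 'F_p) (z : V) (U : {vspace V}) : z \notin U -> (z == 0) = false.
      by move=> nUz; apply: contraNF nUz => /eqP->; exact: mem0v.
    rewrite (nz _ c (iter mu (lfun_img (s - \1)%VF) fullv)) ?c_height ?ltnn //.
    rewrite (nz _ chi (iter mu (lfun_img (S - \1)%VF) fullv)) // chi_height //.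
    by rewrite -mu_eq ltnn.
  exists u; split=> //; exists 0; rewrite uc big1 ?addr0 // => j _.
  by elim: (nat_of_ord j) => //= l ->; rewrite linear0.
have muN : mu = N by apply/eqP; rewrite eqn_leq mu_le.
have [i|u [ker im us _]] := classify _ S SN dims 0 0 (linear0 _) (linear0 _).
  by rewrite !mem0v.
have c0 : c = 0 by rewrite /bullet_pow muN ltnn.
(* Now lambda = N, so chi is divisible by (S - 1)^(N - 1): it is a norm and is absorbed by w, while
   c = 0. *)
have : chi \in iter N.-1 (lfun_img (S - \1)%VF) fullv.
  by rewrite chi_height ?prednK // -mu_eq muN.
case/iter_lfun_imgP=> w; rewrite iter_sub1_lfunE -(sum_iter_order n p_pr) => chiE.
exists u; split=> //; exists (- w); rewrite c0 linear0 -/chi chiE -big_split big1 // => j _ /=.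
elim: (nat_of_ord j) => [|l IHl]; first by rewrite /= subrr.
by rewrite !iterS -linearD IHl linear0.
Qed.
End ReductionToPairing.

(** * Galois theory of adjoined sets *)

Section GaloisHelpers.
Variables (F : fieldType) (Om : splittingFieldType F).
Implicit Types (K L E B : {subfield Om}) (S : set Om).

Lemma gal_restrict K L (x : gal_of L) : galois 1 K -> (K <= L)%VS ->
  exists2 y, y \in 'Gal(K / 1)%g & {in K, x =1 y}.
Proof.
case/and3P=> _ _ nK sKL.
have aut : kAut 1 K x.
  apply: (@normalField_kAut _ _ 1%AS K L); rewrite ?sub1v //.
  by rewrite kAut1E limg_gal.
by have [y Gy xy] := kAut_to_gal aut; exists y.
Qed.

Lemma gal_extend K L (y : gal_of K) : galois 1 K -> (K <= L)%VS -> normalField 1 L ->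
  exists x : gal_of L, {in K, x =1 y}.
Proof.
move=> galK sKL nL.
have hom : kHom 1 K y by rewrite k1AHom.
have [|x _ xy] := @kHom_to_gal _ _ 1%AS K L y _ nL hom; first by rewrite sub1v.
by exists x => a Ka; rewrite xy.
Qed.

Lemma gal_restrict_generator K L sigma (x : gal_of L) :
    galois 1 K -> (K <= L)%VS -> generator 'Gal(K / 1)%g sigma ->
  exists i, {in K, x =1 (sigma ^+ i)%g}.
Proof.
move=> galK sKL /eqP gen; have [y + xy] := gal_restrict x galK sKL.
by rewrite gen => /cycleP[i defy]; exists i; rewrite -defy.
Qed.

Lemma AEnd_restrict_generator K sigma (f : 'AEnd(Om)) :
    galois 1 K -> generator 'Gal(K / 1)%g sigma ->
  exists i, {in K, f =1 (sigma ^+ i)%g}.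
Proof.
case/and3P=> _ _ nK /eqP gen; have fK : (f @: K <= K)%VS.
  have := forall_inP nK f; rewrite inE kAutfE k1AHom => /(_ isT)/eqP->.
  exact: subvv.
have : kAut 1 K f by rewrite kAut1E.
case/kAut_to_gal=> y; rewrite gen => /cycleP[i defy] fy.
by exists i; rewrite -defy.
Qed.

Lemma big_generator (R : Type) (idx : R) (op : Monoid.com_law idx)
    (gT : finGroupType) (G : {group gT}) (x : gT) (f : gT -> R) :
  generator G x -> \big[op/idx]_(y in G) f y = \big[op/idx]_(i < #|G|) f (x ^+ i)%g.
Proof.
move/eqP=> defG; have oG : #|G| = #[x]%g by rewrite defG.
have -> : \big[op/idx]_(y in G) f y
    = \big[op/idx]_(y in [set (x ^+ (i : 'I_#|G|))%g | i in 'I_#|G|]%SET) f y.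
  apply: eq_bigl => y; apply/idP/imsetP => [|[i _ ->]].
    rewrite {1}defG => /cyclePmin[i]; rewrite -oG => lti ->.
    by exists (Ordinal lti).
  by rewrite groupX // defG cycle_id.
rewrite big_imset //= => i j _ _ /eqP; rewrite eq_expg_mod_order -oG !modn_small //.
by move/eqP/val_inj.
Qed.

(** The image f(B) contains E and S, hence B by minimality, and it has the same dimension as B. *)
Lemma adjoined_normal E S B : adjoined E S B -> normalField 1 E ->
  (forall (f : 'AEnd(Om)) y, S y -> S (f y)) -> normalField 1 B.
Proof.
case=> sEB SB minB nE Sf; apply/forall_inP => f fP.
have fEE : (f @: E)%VS = E by apply/eqP; exact: (forall_inP nE f fP).
rewrite eq_sym eqEdim limg_dim_eq ?leqnn ?andbT; last first.
  by rewrite (eqP (AEnd_lker0 f)) capv0.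
apply: (minB (f @: B)%AS) => [|y Sy]; first by rewrite -fEE limgS.
have -> : y = f (f^-1%AF y) by rewrite /= lker0_lfunVK ?AEnd_lker0.
by apply/memv_img/SB/Sf.
Qed.

(** With z a separable generator, every y in S is both separable and purely inseparable over E(z),
    hence lies in E(z); by minimality B is contained in E(z). *)
Lemma adjoined_separable E S B : adjoined E S B ->
  (forall y, S y -> separable_element E y) -> separable E B.
Proof.
case=> sEB SB minB sepS; pose z := separable_generator E B.
have sepz : separable_element E z := separable_generatorP B E.
have sBz : (B <= <<E; z>>)%VS.
  apply: (minB <<E; z>>%AS) => [|y Sy]; first exact: subv_adjoin.
  have <- := separable_inseparable_element <<E; z>>%AS y.
  rewrite (separable_elementS (subv_adjoin E z)) ?sepS //.
  exact/purely_inseparableP/SB/Sy/separable_generator_maximal.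
apply/separableP => y By; move/adjoin_separableP: sepz; apply.
exact: (subvP sBz).
Qed.

Lemma adjoined_gal_eq1 E S B (x : gal_of B) : adjoined E S B ->
  {in E, forall a, x a = a} -> (forall y, S y -> x y = y) -> x = 1%g.
Proof.
case=> sEB SB minB xE xS; apply/eqP/gal_eqP => a Ba.
have sBx : (B <= fixedField [set x]%SET)%VS.
  apply: (minB (fixedField [set x]%SET)%AS) => [|y Sy].
    apply/subvP=> b Eb; apply/fixedFieldP; first exact: (subvP sEB).
    by move=> y /set1P->; apply: xE.
  by apply/fixedFieldP; [apply: SB | move=> z /set1P->; apply: xS].
have /(subvP sBx) := Ba; rewrite gal_id => /(mem_fixedFieldP)[_ fix_a].
by apply: fix_a; rewrite inE.
Qed.
End GaloisHelpers.

(** * The Artin-Schreier pairing *)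

Section PrimeFieldImage.
Variables (p : nat) (p_pr : prime p) (E : fieldType).

Lemma Fp_val_add (a b : 'F_p) : (a + b)%R = ((a + b)%N %% p)%N :> nat.
Proof. by rewrite /= {3}(Fp_cast p_pr). Qed.

Hypothesis chE : p \in [pchar E].

Lemma natr_mod_pchar m : (m %% p)%:R = m%:R :> E.
Proof.
by rewrite [in RHS](divn_eq m p) natrD natrM (pcharf0 chE) mulr0 add0r.
Qed.

Lemma Fp_natrD (a b : 'F_p) : ((a + b)%R : nat)%:R = a%:R + b%:R :> E.
Proof. by rewrite Fp_val_add natr_mod_pchar natrD. Qed.

Lemma Fp_ltn (a : 'F_p) : (a < p)%N.
Proof. by have := ltn_ord a; rewrite {2}(Fp_cast p_pr). Qed.

Lemma Fp_natr_inj (a b : 'F_p) : a%:R = b%:R :> E -> a = b.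
Proof.
wlog leab : a b / (a <= b)%N.
  move=> IH; have [/IH//|/ltnW/IH IH' /esym/IH' //] := leqP a b.
move=> /eqP; rewrite eq_sym -subr_eq0 -natrB // -(dvdn_pcharf chE) => dvd.
apply: val_inj => /=; apply/eqP; rewrite eqn_leq leab -subn_eq0 /=.
have lt : (b - a < p)%N by rewrite (leq_ltn_trans (leq_subr _ _)) ?Fp_ltn.
by move: dvd; rewrite /dvdn modn_small.
Qed.

(** The images of F_p are already p distinct roots of X^p - X. *)
Lemma Fp_natr_surj (z : E) : z ^+ p = z -> exists e : 'F_p, z = e%:R.
Proof.
move=> zp; apply: contrapT => nz.
have p_gt1 := prime_gt1 p_pr.
have sizeP : size ('X^p - 'X : {poly E}) = p.+1.
  by rewrite size_polyDl ?size_polyN ?size_polyXn ?size_polyX.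
have nzP : ('X^p - 'X : {poly E}) != 0 by rewrite -size_poly_eq0 sizeP.
pose rs := z :: [seq (nat_of_ord e)%:R | e : 'F_p <- enum 'F_p].
have : (size rs < size ('X^p - 'X : {poly E})%R)%N.
  apply: max_poly_roots => //.
    apply/allP=> _ /predU1P[->|/mapP[e _ ->]]; rewrite /root !hornerE.
      by rewrite zp subrr.
    by rewrite -(pFrobenius_autE chE) pFrobenius_aut_nat subrr.
  rewrite /= map_inj_uniq ?enum_uniq ?andbT => [|a b /Fp_natr_inj //].
  by apply/mapP=> -[e _ ze]; apply: nz; exists e.
by rewrite sizeP /= size_map -cardE card_Fp // ltnn.
Qed.

Lemma wpD (x y : E) : (x + y) ^+ p - (x + y) = (x ^+ p - x) + (y ^+ p - y).
Proof.
have := pFrobenius_autD_comm chE (mulrC x y).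
by rewrite !pFrobenius_autE => ->; rewrite opprD addrACA.
Qed.

Lemma wp_eq0 (x : E) : x ^+ p - x = 0 -> exists e : 'F_p, x = e%:R.
Proof. by move/eqP; rewrite subr_eq0 => /eqP; apply: Fp_natr_surj. Qed.

Lemma wp_inj (x y : E) : x ^+ p - x = y ^+ p - y -> exists e : 'F_p, x = y + e%:R.
Proof.
move=> eqxy; have [|e defe] := @wp_eq0 (x - y).
  by apply: (addrI (y ^+ p - y)); rewrite -wpD addrCA subrr addr0 addr0.
by exists e; rewrite -defe addrC subrK.
Qed.

Lemma wp_sum m (f : 'I_m -> E) :
  (\sum_i f i) ^+ p - \sum_i f i = \sum_i (f i ^+ p - f i).
Proof.
apply: (big_morph (fun x : E => x ^+ p - x)); first exact: wpD.
by rewrite expr0n gtn_eqF ?prime_gt0 // subr0.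
Qed.
End PrimeFieldImage.

Section ArtinSchreierPairing.
Variables (p n : nat) (p_pr : prime p).
Variables (F : fieldType) (Om : splittingFieldType F) (K : {subfield Om}).
Hypothesis galK : galois 1 K.
Variable sigma : gal_of K.
Hypothesis sigma_gen : generator 'Gal(K / 1)%g sigma.
Hypothesis cardG : #|'Gal(K / 1)%g| = (p ^ n)%N.
Variable chK : p \in [pchar subvs_of K].
Local Notation N := (p ^ n)%N.
Local Notation cl := (as_class p_pr chK).
Local Notation sQ := (@as_act F Om p p_pr K chK sigma).

Lemma order_generator : #[sigma]%g = N.
Proof. by rewrite -cardG (eqP sigma_gen). Qed.

Lemma pchar_Om : p \in [pchar Om].
Proof. by rewrite (fmorph_pchar (vsval : {rmorphism subvs_of K -> Om})). Qed.
Let chO := pchar_Om.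

Lemma as_classD x y : cl (x + y) = cl x + cl y.
Proof. exact: fpclassD. Qed.

Lemma as_class_eq x y : cl x = cl y <->
  exists k, k \in K /\ vsval x = vsval y + (k ^+ p - k).
Proof.
split=> [/eqP|[k [Kk eqx]]].
  rewrite fpclassE => /asboolP[k xy]; exists (vsval k); split; first exact: subvsP.
  have -> : x = y + (k ^+ p - k) by rewrite -xy addrC subrK.
  by rewrite !linearD linearN /= rmorphXn.
apply/eqP; rewrite fpclassE; apply/asboolP; exists (vsproj K k); apply: subvs_inj.
by rewrite !linearB /= rmorphXn /= vsprojK // eqx addrC addKr.
Qed.

Lemma iter_as_act i x : iter i sQ (cl x) = cl (gal_sub (sigma ^+ i)%g x).
Proof.
elim: i => [|i IHi] /=.
  by congr (cl _); apply: subvs_inj; rewrite gal_subE expg0 gal_id.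
rewrite IHi as_actE; congr (cl _); apply: subvs_inj; rewrite !gal_subE.
by rewrite expgSr galM // subvsP.
Qed.

Lemma as_actD x y : sQ (x + y) = sQ x + sQ y.
Proof.
rewrite -[x]as_reprK -[y]as_reprK -as_classD !as_actE -as_classD; congr (cl _).
by apply: subvs_inj; rewrite linearD /= !gal_subE !linearD.
Qed.

Lemma as_act_order x : iter N sQ x = x.
Proof.
rewrite -[x]as_reprK iter_as_act -order_generator expg_order; congr (cl _).
by apply: subvs_inj; rewrite gal_subE gal_id.
Qed.

Lemma galTrace_iter (a : Om) : galTrace 1 K a = \sum_(i < N) (sigma ^+ i)%g a.
Proof. by rewrite /galTrace (big_generator _ _ sigma_gen) cardG. Qed.

Variable A : set (as_quot p_pr chK).
Hypothesis submodA : finite_submodule sQ A.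
Hypothesis rootsA : forall a, A (cl a) -> exists y : Om, y ^+ p - y = vsval a.
Variable L : {subfield Om}.
Hypothesis adjL : adjoined K (as_roots A) L.

Let sKL : (K <= L)%VS. Proof. by case: adjL. Qed.
Let rootL b y : A (cl b) -> y ^+ p - y = vsval b -> y \in L.
Proof. by case: adjL => _ rL _ Ab yb; apply: rL; exists b. Qed.

Lemma as_normal : normalField 1 L.
Proof.
apply: (adjoined_normal adjL); first by case/and3P: galK.
move=> f y [b Ab yb]; have [i fi] := AEnd_restrict_generator f galK sigma_gen.
exists (gal_sub (sigma ^+ i)%g b); last first.
  by rewrite gal_subE -fi ?subvsP // -yb rmorphB rmorphXn.
rewrite -iter_as_act; have [_ _ _ AsQ] := submodA.
by elim: i {fi} => //= i /AsQ.
Qed.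

Lemma as_separable_element (b : subvs_of K) (y : Om) :
  y ^+ p - y = vsval b -> separable_element K y.
Proof.
move=> yb; apply/separable_elementP; exists ('X^p - 'X - (vsval b)%:P); split.
- by rewrite !rpredB ?rpredX ?polyOverX // polyOverC subvsP.
- by rewrite /root !hornerE yb subrr.
rewrite unlock !derivB derivXn derivX derivC subr0.
have -> : 'X^(p.-1) *+ p = 0 :> {poly Om}.
  by rewrite -mulr_natr -polyC_natr (pcharf0 chO) mulr0.
(* The derivative of X^p - X - b is -1, coprime to everything. *)
by rewrite sub0r -[- 1]scaleN1r coprimepZr ?oppr_eq0 ?oner_eq0 // coprimep1.
Qed.

Lemma as_galois : galois K L.
Proof.
rewrite /galois sKL (normalFieldS (sub1v K)) ?as_normal // andbT.
apply: (adjoined_separable adjL) => y [b _]; exact: as_separable_element.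
Qed.

Let DeltaP (x : gal_of L) : reflect {in K, forall a, x a = a} (x \in 'Gal(L / K)%g).
Proof. by rewrite gal_kHom //; apply: kAHomP. Qed.

(** The value x y - y depends neither on the representative b nor on the root y: two choices of y
    differ by an element of K plus an element of the prime field, and x fixes both. *)
Lemma as_pairing_ex : exists pr : gal_of L -> as_quot p_pr chK -> 'F_p,
  forall x a, x \in 'Gal(L / K)%g -> A a ->
  forall b y, cl b = a -> y ^+ p - y = vsval b -> x y = y + (pr x a)%:R.
Proof.
suff /choice[pr prP] : forall xa : gal_of L * as_quot p_pr chK, exists e : 'F_p,
    xa.1 \in 'Gal(L / K)%g -> A xa.2 ->
    forall b y, cl b = xa.2 -> y ^+ p - y = vsval b -> xa.1 y = y + e%:R.
  by exists (fun x a => pr (x, a)) => x a; apply: (prP (x, a)).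
case=> x a /=; have [Dx|] := boolP (x \in _); last by exists 0.
have [Aa|] := pselect (A a); last by exists 0.
have Aba : A (cl (as_repr a)) by rewrite as_reprK.
have [y0 y0b] := rootsA Aba.
have xK := DeltaP _ Dx.
have [e xe] : exists e : 'F_p, x y0 = y0 + e%:R.
  by apply: (wp_inj p_pr chO); rewrite y0b -[RHS]xK ?subvsP // -y0b rmorphB rmorphXn.
exists e => _ _ b y ba yb.
have /as_class_eq[k [Kk bk]] : cl b = cl (as_repr a) by rewrite as_reprK.
have [|j defy] := @wp_inj p p_pr Om chO y (y0 + k).
  by rewrite wpD // yb bk y0b.
by rewrite defy !rmorphD /= xe xK // rmorph_nat -!addrA; congr (_ + _); rewrite addrC -addrA.
Qed.

Variable g : gal_of L.
Hypothesis gK : {in K, g =1 sigma}.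
Variable pr : gal_of L -> as_quot p_pr chK -> 'F_p.
Hypothesis prP : forall x a, x \in 'Gal(L / K)%g -> A a ->
  forall b y, cl b = a -> y ^+ p - y = vsval b -> x y = y + (pr x a)%:R.

Let root_ex a : A a -> exists b y, [/\ cl b = a, y ^+ p - y = vsval b & y \in L].
Proof.
move=> Aa; have Aba : A (cl (as_repr a)) by rewrite as_reprK.
have [y yb] := rootsA Aba; exists (as_repr a), y; rewrite as_reprK; split=> //.
exact: rootL yb.
Qed.

Lemma as_pairingM : {in 'Gal(L / K)%g &, forall x y a, A a ->
  pr (x * y)%g a = pr x a + pr y a}.
Proof.
move=> x y Dx Dy a Aa; have [b [z [ba zb Lz]]] := root_ex Aa.
apply: (Fp_natr_inj p_pr chO); rewrite Fp_natrD //; apply: (addrI z).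
rewrite -(prP (groupM Dx Dy) Aa ba zb) galM // (prP Dx Aa ba zb) rmorphD /=.
by rewrite (prP Dy Aa ba zb) rmorph_nat addrAC addrA.
Qed.

Lemma as_pairingD : {in 'Gal(L / K)%g, forall x a b, A a -> A b ->
  pr x (a + b) = pr x a + pr x b}.
Proof.
move=> x Dx a a' Aa Aa'.
have [b [z [ba zb Lz]]] := root_ex Aa; have [b' [z' [ba' zb' Lz']]] := root_ex Aa'.
have Aaa : A (a + a') by have [_ _ Al _] := submodA; rewrite -[a]scale1r; apply: Al.
apply: (Fp_natr_inj p_pr chO); rewrite Fp_natrD //; apply: (addrI (z + z')).
rewrite -(prP Dx Aaa (b := b + b')); last first.
- by rewrite wpD // zb zb' linearD.
- by rewrite as_classD ba ba'.
by rewrite rmorphD /= (prP Dx Aa ba zb) (prP Dx Aa' ba' zb') addrACA.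
Qed.

Lemma as_pairing_faithful : {in 'Gal(L / K)%g, forall x,
  (forall a, A a -> pr x a = 0) -> x = 1%g}.
Proof.
move=> x Dx pr0; apply: (adjoined_gal_eq1 adjL); first exact: DeltaP.
by move=> y [b Ab yb]; rewrite (prP Dx Ab erefl yb) pr0 // addr0.
Qed.

Lemma as_pairing_nondegenerate a : A a ->
  {in 'Gal(L / K)%g, forall x, pr x a = 0} -> a = 0.
Proof.
move=> Aa pr0; have [b [z [ba zb Lz]]] := root_ex Aa.
have Kz : z \in K.
  rewrite -(galois_fixedField as_galois); apply/fixedFieldP => // x Dx.
  by rewrite (prP Dx Aa ba zb) pr0 // addr0.
rewrite -ba -(fpclass0 p_pr (wp_mulrn chK)); apply/as_class_eq.
by exists z; rewrite linear0 add0r zb.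
Qed.

(** If z is a root for b, then g z is a root for sigma b, and since products act from left to right,
    x^g sends g z to g (x z). *)
Lemma as_pairingJ : {in 'Gal(L / K)%g, forall x a, A a ->
  pr (x ^ g)%g (sQ a) = pr x a}.
Proof.
move=> x Dx a Aa; have [b [z [ba zb Lz]]] := root_ex Aa.
have Lgz : g z \in L by apply: memv_gal.
have Dxg : (x ^ g)%g \in 'Gal(L / K)%g.
  apply/DeltaP=> c Kc; have Lc : c \in L by apply: (subvP sKL).
  have [i gi] := gal_restrict_generator (g^-1)%g galK sKL sigma_gen.
  rewrite conjgE !galM ?memv_gal // (DeltaP _ Dx) ?gi ?memv_gal //.
  by rewrite -gi // -galM // mulVg gal_id.
have AsQ : A (sQ a) by have [_ _ _] := submodA; apply.
apply: (Fp_natr_inj p_pr chO); apply: (addrI (g z)).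
rewrite -(prP Dxg AsQ (b := gal_sub sigma b)); last first.
- by rewrite gal_subE -gK ?subvsP // -zb rmorphB rmorphXn.
- by rewrite -ba as_actE.
rewrite conjgE !galM ?memv_gal // -[(g^-1)%g (g z)]galM // mulgV gal_id.
by rewrite (prP Dx Aa ba zb) rmorphD /= rmorph_nat.
Qed.

(** The sum Y of the g^i z, i < N, is a root attached to the trace of b. Applying g shifts the
    summands, so that g Y - Y telescopes to g^N z - z. *)
Lemma as_pairing_index a : A a -> \sum_(i < N) iter i sQ a = 0 ->
  pr (g ^+ N)%g a = as_index sigma a.
Proof.
move=> Aa sum0; have [b [z [ba zb Lz]]] := root_ex Aa.
have gX i : {in K, (g ^+ i)%g =1 (sigma ^+ i)%g}.
  elim: i => [|i IHi] c Kc; first by rewrite !expg0 !gal_id.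
  by rewrite !expgSr !galM ?(subvP sKL) // IHi // gK // memv_gal.
have DgN : (g ^+ N)%g \in 'Gal(L / K)%g.
  by apply/DeltaP => c Kc; rewrite gX // -order_generator expg_order gal_id.
pose Y := \sum_(i < N) (g ^+ i)%g z.
have wpY : Y ^+ p - Y = galTrace 1 K (vsval b).
  rewrite wp_sum // galTrace_iter; apply: eq_bigr => i _.
  by rewrite -gX ?subvsP // -zb rmorphB rmorphXn.
(* The zero norm of the class says that the trace of b is k^p - k with k in K, so Y differs from k
   by an element of the prime field. *)
have KY : Y \in K.
  pose T : subvs_of K := \sum_(i < N) gal_sub (sigma ^+ i)%g b.
  have TE : vsval T = galTrace 1 K (vsval b).
    by rewrite galTrace_iter linear_sum; apply: eq_bigr => i _; rewrite /= gal_subE.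
  have clT : cl T = cl 0.
    rewrite [RHS]fpclass0 -sum0 -ba.
    rewrite (big_morph cl as_classD (fpclass0 p_pr (wp_mulrn chK))).
    by apply: eq_bigr => i _; rewrite iter_as_act.
  move/as_class_eq: clT => [k [Kk]]; rewrite TE linear0 add0r -wpY => eqY.
  have [j ->] := wp_inj p_pr chO eqY.
  by rewrite rpredD // rpred_nat.
have gY : sigma Y = Y + (pr (g ^+ N)%g a)%:R.
  rewrite -gK // linear_sum /= (eq_bigr (fun i : 'I_N => (g ^+ i.+1)%g z)); last first.
    by move=> i _; rewrite expgSr galM.
  apply: (addrI z); have := big_ord_recl N (fun i : 'I_N.+1 => (g ^+ i)%g z).
  rewrite /= expg0 gal_id => <-; rewrite big_ord_recr /= (prP DgN Aa ba zb).
  by rewrite addrCA.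
have traceK k : k \in K -> sigma (galTrace 1 K k) = galTrace 1 K k.
  move=> Kk; apply: (fixed_gal (sub1v K)); last exact: mem_galTrace.
  by rewrite (eqP sigma_gen) cycle_id.
symmetry; rewrite /as_index; apply: xget_unique.
  by exists b, Y; split=> //; rewrite gY addrC addKr.
move=> e [b' [rho [b'a Krho wprho eE]]]; apply: (Fp_natr_inj p_pr chO); rewrite eE.
have /as_class_eq[k [Kk bk]] : cl b' = cl b by rewrite b'a.
have trk : galTrace 1 K (k ^+ p - k) = (galTrace 1 K k) ^+ p - galTrace 1 K k.
  rewrite !galTrace_iter wp_sum //; apply: eq_bigr => i _.
  by rewrite rmorphB rmorphXn.
(* Another representative changes the root by the trace of k, and another root by an element of the
   prime field; sigma fixes both, so the index is well defined. *)
have [|j ->] := @wp_inj p p_pr Om chO rho (Y + galTrace 1 K k).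
  by rewrite wpD // wpY wprho bk raddfD /= trk.
rewrite !rmorphD /= gY traceK // rmorph_nat.
by apply/eqP; rewrite subr_eq -!addrA addrCA.
Qed.
End ArtinSchreierPairing.

(** * The Kummer pairing *)

Section RootsOfUnity.
Variables (p : nat) (p_pr : prime p) (E : fieldType) (xi : E).
Hypothesis prim_xi : p.-primitive_root xi.

Lemma prim_exprD (a b : 'F_p) : xi ^+ (a + b)%R = xi ^+ a * xi ^+ b.
Proof. by rewrite Fp_val_add // prim_expr_mod // exprD. Qed.

Lemma prim_expr_inj (a b : 'F_p) : xi ^+ a = xi ^+ b -> a = b.
Proof.
move/eqP; rewrite (eq_prim_root_expr prim_xi) !modn_small ?Fp_ltn // => /eqP.
exact: val_inj.
Qed.

Lemma root_ratio (y z : E) : z != 0 -> y ^+ p = z ^+ p ->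
  exists e : 'F_p, y = z * xi ^+ e.
Proof.
move=> nz yz; have : (y / z) ^+ p = 1 by rewrite expr_div_n yz divff ?expf_neq0.
case/(prim_rootP prim_xi) => i defi; exists (i%:R).
by rewrite val_Fp_nat // prim_expr_mod // -defi mulrC divfK.
Qed.
End RootsOfUnity.

Section KummerPairing.
Variables (p n : nat) (p_pr : prime p).
Variables (F : fieldType) (Om : splittingFieldType F) (E Fh B : {subfield Om}).
Variables (xi : Om) (sh : gal_of E).
Hypotheses (prim_xi : p.-primitive_root xi) (Fxi : xi \in Fh).
Hypothesis galFE : galois Fh E.
Hypothesis sh_gen : generator 'Gal(E / Fh)%g sh.
Hypothesis cardG : #|'Gal(E / Fh)%g| = (p ^ n)%N.
Local Notation N := (p ^ n)%N.
Local Notation U := (units (subvs_of E)).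
Local Notation cl := (kummer_class p_pr (E := E)).
Local Notation sQ := (@kummer_act F Om p p_pr E sh).
Local Notation v a := (vsval (uval a)).

Let sFE : (Fh <= E)%VS. Proof. by case/and3P: galFE. Qed.
Let Exi : xi \in E. Proof. exact: (subvP sFE). Qed.
Let shG : sh \in 'Gal(E / Fh)%g. Proof. by rewrite (eqP sh_gen) cycle_id. Qed.
Let p_gt0 := prime_gt0 p_pr.
Let xi_neq0 : xi != 0.
Proof.
apply/eqP=> xi0; have := prim_expr_order prim_xi; rewrite xi0 expr0n gtn_eqF //.
by move/eqP; rewrite eq_sym oner_eq0.
Qed.

Lemma order_kummer_generator : #[sh]%g = N.
Proof. by rewrite -cardG (eqP sh_gen). Qed.

Lemma uvalE (a : U) : v a \in E /\ v a != 0.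
Proof.
split; first exact: subvsP.
by apply: contra (uvalP a) => /eqP a0; apply/eqP/subvs_inj; rewrite a0 linear0.
Qed.

Lemma units_ex (u : Om) : u \in E -> u != 0 -> exists a : U, v a = u.
Proof.
move=> Eu nzu; have nz : vsproj E u != 0.
  apply: contra nzu => /eqP/(congr1 vsval); rewrite vsprojK // linear0 => ->.
  exact: eqxx.
by exists (Units nz); rewrite /= vsprojK.
Qed.

Lemma val_unitsD (x y : U) : v (x + y) = v x * v y.
Proof. by rewrite uvalD rmorphM. Qed.

Lemma val_units0 : v (0 : U) = 1.
Proof. exact: rmorph1. Qed.

Lemma kummer_classD (x y : U) : cl (x + y) = cl x + cl y.
Proof. exact: fpclassD. Qed.

Lemma kummer_class_eq (x y : U) : cl x = cl y <->
  exists u : Om, [/\ u \in E, u != 0 & v x = v y * u ^+ p].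
Proof.
split=> [/eqP|[u [Eu nzu eqx]]].
  rewrite fpclassE => /asboolP[k xy]; exists (v k).
  have [Ek nzk] := uvalE k; split=> //.
  have -> : x = y + k *+ p by rewrite -xy addrC subrK.
  by rewrite uvalD uvalMn rmorphM rmorphXn.
apply/eqP; rewrite fpclassE; apply/asboolP; have [k kE] := units_ex Eu nzu.
exists k; apply/eqP; rewrite subr_eq addrC; apply/eqP; apply: val_inj => /=.
by apply: subvs_inj; rewrite uvalMn rmorphM rmorphXn /= kE.
Qed.

Lemma val_gal_units (x : gal_of E) (a : U) : v (gal_units x a) = x (v a).
Proof. by rewrite /= gal_subE. Qed.

Lemma val_units_inj (a b : U) : v a = v b -> a = b.
Proof. by move/subvs_inj => ab; apply: val_inj. Qed.

Lemma kummer_actM (x y : gal_of E) a :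
  kummer_act (x * y)%g a = kummer_act y (kummer_act x a) :> kummer_quot p_pr E.
Proof.
rewrite -[a]kummer_reprK !kummer_actE; congr (cl _); apply: val_units_inj.
by rewrite !val_gal_units galM // (uvalE _).1.
Qed.

Lemma kummer_act1 a : kummer_act 1%g a = a :> kummer_quot p_pr E.
Proof.
rewrite -[a]kummer_reprK !kummer_actE; congr (cl _); apply: val_units_inj.
by rewrite !val_gal_units gal_id.
Qed.

Lemma iter_kummer_act (x : gal_of E) i (a : kummer_quot p_pr E) :
  iter i (kummer_act x) a = kummer_act (x ^+ i)%g a.
Proof.
by elim: i => [|i IHi] /=; rewrite ?expg0 ?kummer_act1 // expgSr kummer_actM IHi.
Qed.

Lemma kummer_actD x y : sQ (x + y) = sQ x + sQ y.
Proof.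
rewrite -[x]kummer_reprK -[y]kummer_reprK -kummer_classD !kummer_actE -kummer_classD.
congr (cl _); apply: val_units_inj.
by rewrite val_gal_units !val_unitsD !val_gal_units rmorphM.
Qed.

Lemma kummer_act_order x : iter N sQ x = x.
Proof. by rewrite iter_kummer_act -order_kummer_generator expg_order kummer_act1. Qed.

Lemma galNorm_iter (a : Om) : galNorm Fh E a = \prod_(i < N) (sh ^+ i)%g a.
Proof. by rewrite /galNorm (big_generator _ _ sh_gen) cardG. Qed.

Variable A : set (kummer_quot p_pr E).
Hypothesis submodA : finite_submodule sQ A.
Hypothesis rootsA : forall a, A (cl a) -> exists y : Om, y ^+ p = v a.
Hypothesis adjB : adjoined E (kummer_roots A) B.
Hypothesis galEB : galois E B.

Let sEB : (E <= B)%VS. Proof. by case: adjB. Qed.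
Let rootB b y : A (cl b) -> y ^+ p = v b -> y \in B.
Proof. by case: adjB => _ rB _ Ab yb; apply: rB; exists b. Qed.
Let root_neq0 (b : U) (y : Om) : y ^+ p = v b -> y != 0.
Proof.
have [_ nzb] := uvalE b; move=> yb; apply: contra nzb => /eqP y0.
by rewrite -yb y0 expr0n gtn_eqF.
Qed.

Let DeltaP (x : gal_of B) : reflect {in E, forall a, x a = a} (x \in 'Gal(B / E)%g).
Proof. by rewrite gal_kHom //; apply: kAHomP. Qed.

(** Two p-th roots for the same class differ by a factor in E times a power of xi, and x fixes both,
    so the ratio x y / y depends only on x and the class. *)
Lemma kummer_pairing_ex : exists pr : gal_of B -> kummer_quot p_pr E -> 'F_p,
  forall x a, x \in 'Gal(B / E)%g -> A a ->
  forall b y, cl b = a -> y ^+ p = v b -> x y = y * xi ^+ pr x a.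
Proof.
suff /choice[pr prP] : forall xa : gal_of B * kummer_quot p_pr E, exists e : 'F_p,
    xa.1 \in 'Gal(B / E)%g -> A xa.2 ->
    forall b y, cl b = xa.2 -> y ^+ p = v b -> xa.1 y = y * xi ^+ e.
  by exists (fun x a => pr (x, a)) => x a; apply: (prP (x, a)).
case=> x a /=; have [Dx|] := boolP (x \in _); last by exists 0.
have [Aa|] := pselect (A a); last by exists 0.
have Aba : A (cl (kummer_repr a)) by rewrite kummer_reprK.
have [y0 y0b] := rootsA Aba.
have xE := DeltaP _ Dx.
have [e xe] : exists e : 'F_p, x y0 = y0 * xi ^+ e.
  apply: (root_ratio p_pr prim_xi); first exact: root_neq0 y0b.
  by rewrite y0b -[RHS]xE ?(uvalE _).1 // -y0b rmorphXn.
exists e => _ _ b y ba yb.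
have /kummer_class_eq[k [Ek nzk bk]] : cl b = cl (kummer_repr a) by rewrite kummer_reprK.
have [||j defy] := @root_ratio p p_pr Om xi prim_xi y (y0 * k).
- by rewrite mulf_neq0 // (root_neq0 y0b).
- by rewrite exprMn yb bk y0b.
by rewrite defy !rmorphM /= xe !xE ?rpredX // -!mulrA; congr (_ * _); rewrite mulrC -mulrA.
Qed.

Variable g : gal_of B.
Hypothesis gE : {in E, g =1 sh}.
Variable pr : gal_of B -> kummer_quot p_pr E -> 'F_p.
Hypothesis prP : forall x a, x \in 'Gal(B / E)%g -> A a ->
  forall b y, cl b = a -> y ^+ p = v b -> x y = y * xi ^+ pr x a.

Let root_ex a : A a -> exists b y, [/\ cl b = a, y ^+ p = v b, y \in B & y != 0].
Proof.
move=> Aa; have Aba : A (cl (kummer_repr a)) by rewrite kummer_reprK.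
have [y yb] := rootsA Aba; exists (kummer_repr a), y; rewrite kummer_reprK.
by split=> //; [exact: rootB yb | exact: root_neq0 yb].
Qed.

Let xi_fix (x : gal_of B) i : x \in 'Gal(B / E)%g -> x (xi ^+ i) = xi ^+ i.
Proof. by move/DeltaP; apply; rewrite rpredX. Qed.

Let g_xi i : g (xi ^+ i) = xi ^+ i.
Proof. by rewrite gE ?rpredX // (fixed_gal sFE shG) ?rpredX. Qed.

Lemma kummer_pairingM : {in 'Gal(B / E)%g &, forall x y a, A a ->
  pr (x * y)%g a = pr x a + pr y a}.
Proof.
move=> x y Dx Dy a Aa; have [b [z [ba zb Bz nzz]]] := root_ex Aa.
apply: (prim_expr_inj p_pr prim_xi); rewrite (prim_exprD p_pr) //; apply: (mulfI nzz).
rewrite -(prP (groupM Dx Dy) Aa ba zb) galM // (prP Dx Aa ba zb) rmorphM /=.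
by rewrite (prP Dy Aa ba zb) xi_fix // mulrAC mulrA.
Qed.

Lemma kummer_pairingD : {in 'Gal(B / E)%g, forall x a b, A a -> A b ->
  pr x (a + b) = pr x a + pr x b}.
Proof.
move=> x Dx a a' Aa Aa'.
have [b [z [ba zb Bz nzz]]] := root_ex Aa.
have [b' [z' [ba' zb' Bz' nzz']]] := root_ex Aa'.
have Aaa : A (a + a') by have [_ _ Al _] := submodA; rewrite -[a]scale1r; apply: Al.
apply: (prim_expr_inj p_pr prim_xi); rewrite (prim_exprD p_pr) //.
apply: (mulfI (mulf_neq0 nzz nzz')).
rewrite -(prP Dx Aaa (b := b + b')); last first.
- by rewrite exprMn zb zb' uvalD rmorphM.
- by rewrite kummer_classD ba ba'.
by rewrite rmorphM /= (prP Dx Aa ba zb) (prP Dx Aa' ba' zb') mulrACA.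
Qed.

Lemma kummer_pairing_faithful : {in 'Gal(B / E)%g, forall x,
  (forall a, A a -> pr x a = 0) -> x = 1%g}.
Proof.
move=> x Dx pr0; apply: (adjoined_gal_eq1 adjB); first exact: DeltaP.
by move=> y [b Ab yb]; rewrite (prP Dx Ab erefl yb) pr0 // expr0 mulr1.
Qed.

Lemma kummer_pairing_nondegenerate a : A a ->
  {in 'Gal(B / E)%g, forall x, pr x a = 0} -> a = 0.
Proof.
move=> Aa pr0; have [b [z [ba zb Bz nzz]]] := root_ex Aa.
have Ez : z \in E.
  rewrite -(galois_fixedField galEB); apply/fixedFieldP => // x Dx.
  by rewrite (prP Dx Aa ba zb) pr0 // expr0 mulr1.
rewrite -ba -(fpclass0 p_pr (@ppowers_mulrn (subvs_of E) p)); apply/kummer_class_eq.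
by exists z; rewrite val_units0 mul1r zb.
Qed.

Lemma kummer_pairingJ : {in 'Gal(B / E)%g, forall x a, A a ->
  (x ^ g)%g \in 'Gal(B / E)%g -> pr (x ^ g)%g (sQ a) = pr x a}.
Proof.
move=> x Dx a Aa Dxg; have [b [z [ba zb Bz nzz]]] := root_ex Aa.
have Bgz : g z \in B by apply: memv_gal.
have nzgz : g z != 0 by rewrite fmorph_eq0.
have AsQ : A (sQ a) by have [_ _ _] := submodA; apply.
apply: (prim_expr_inj p_pr prim_xi); apply: (mulfI nzgz).
rewrite -(prP Dxg AsQ (b := gal_units sh b)); last first.
- by rewrite val_gal_units -gE ?(uvalE _).1 // -zb rmorphXn.
- by rewrite -ba kummer_actE.
rewrite conjgE !galM ?memv_gal // -[(g^-1)%g (g z)]galM // mulgV gal_id.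
by rewrite (prP Dx Aa ba zb) rmorphM /= g_xi.
Qed.

(** The product Y of the g^i z is a p-th root of the norm of b, and g Y / Y telescopes to g^N z / z.
    Zero norm of the class makes the norm of b a p-th power in E, so Y lies in E. *)
Lemma kummer_pairing_index a : A a -> \sum_(i < N) iter i sQ a = 0 ->
  pr (g ^+ N)%g a = kummer_index Fh xi sh a.
Proof.
move=> Aa sum0; have [b [z [ba zb Bz nzz]]] := root_ex Aa.
have [Eb nzb] := uvalE b.
have gX i : {in E, (g ^+ i)%g =1 (sh ^+ i)%g}.
  elim: i => [|i IHi] c Kc; first by rewrite !expg0 !gal_id.
  by rewrite !expgSr !galM ?(subvP sEB) // IHi // gE // memv_gal.
have DgN : (g ^+ N)%g \in 'Gal(B / E)%g.
  by apply/DeltaP => c Kc; rewrite gX // -order_kummer_generator expg_order gal_id.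
pose Y := \prod_(i < N) (g ^+ i)%g z.
have nzY : Y != 0 by apply/prodf_neq0 => i _; rewrite fmorph_eq0.
have wpY : Y ^+ p = galNorm Fh E (v b).
  rewrite -prodrXl galNorm_iter; apply: eq_bigr => i _.
  by rewrite -gX // -zb rmorphXn.
have normE k : k \in E -> galNorm Fh E k \in E.
  by move=> Ek; apply/(subvP sFE)/mem_galNorm.
have EY : Y \in E.
  have [T TE] : exists T : U, v T = galNorm Fh E (v b).
    by apply: units_ex; rewrite ?normE // galNorm_eq0.
  have clT : cl T = cl 0.
    rewrite [RHS]fpclass0 -sum0 -ba.
    have -> : T = \sum_(i < N) gal_units (sh ^+ i)%g b.
      apply: val_units_inj; rewrite TE galNorm_iter.
      rewrite (big_morph (fun x : U => v x) val_unitsD val_units0).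
      by apply: eq_bigr => i _; rewrite val_gal_units.
    rewrite (big_morph cl kummer_classD (fpclass0 p_pr (@ppowers_mulrn (subvs_of E) p))).
    by apply: eq_bigr => i _; rewrite iter_kummer_act kummer_actE.
  move/kummer_class_eq: clT => [k [Ek nzk]]; rewrite TE val_units0 mul1r -wpY => eqY.
  have [j ->] := root_ratio p_pr prim_xi nzk eqY.
  by rewrite rpredM // rpredX.
have gY : sh Y = Y * xi ^+ pr (g ^+ N)%g a.
  rewrite -gE // rmorph_prod /= (eq_bigr (fun i : 'I_N => (g ^+ i.+1)%g z)); last first.
    by move=> i _; rewrite expgSr galM.
  apply: (mulfI nzz); have := big_ord_recl N (fun i : 'I_N.+1 => (g ^+ i)%g z).
  rewrite /= expg0 gal_id => <-; rewrite big_ord_recr /= (prP DgN Aa ba zb).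
  by rewrite mulrCA.
have normK k : k \in E -> sh (galNorm Fh E k) = galNorm Fh E k.
  by move=> Ek; apply: (fixed_gal sFE shG); apply: mem_galNorm.
symmetry; rewrite /kummer_index; apply: xget_unique.
  by exists b, Y; split=> //; rewrite gY mulrC mulKf.
move=> e [b' [rho [b'a Erho wprho eE]]]; apply: (prim_expr_inj p_pr prim_xi); rewrite eE.
have /kummer_class_eq[k [Ek nzk bk]] : cl b' = cl b by rewrite b'a.
have nzN : galNorm Fh E k != 0 by rewrite galNorm_eq0.
have [||j ->] := @root_ratio p p_pr Om xi prim_xi rho (Y * galNorm Fh E k).
- by rewrite mulf_neq0.
- by rewrite exprMn wpY wprho bk galNormM galNormX.
have shxi : sh (xi ^+ j) = xi ^+ j by rewrite (fixed_gal sFE shG) ?rpredX.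
rewrite !rmorphM /= gY normK // shxi -[Y * _ * _ * _]mulrA [Y * _ * (_ * _)]mulrAC.
by rewrite -[Y * _ * xi ^+ j]mulrA mulrC mulKf // !mulf_neq0 // expf_neq0.
Qed.
End KummerPairing.

(** * Descent from K(xi) to K *)

Lemma pth_root_separable (F : fieldType) (Om : splittingFieldType F)
    (E : {subfield Om}) (p : nat) (b y : Om) :
  p%:R != 0 :> Om -> b \in E -> b != 0 -> y ^+ p = b -> separable_element E y.
Proof.
move=> nzp Eb nzb yb; apply/separable_elementP; exists ('X^p - b%:P); split.
- by rewrite rpredB ?rpredX ?polyOverX // polyOverC.
- by rewrite /root !hornerE yb subrr.
have p_gt0 : (0 < p)%N by rewrite lt0n; apply: contra nzp => /eqP->.
(* Bezout relation: - p (X^p - b) + X (p X^(p - 1)) = p b, a nonzero constant. *)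
rewrite unlock; apply/Bezout_coprimepP; exists (- (p%:R)%:P, 'X) => /=.
rewrite derivB derivXn derivC subr0 mulrnAr -exprS prednK //.
rewrite mulrBr !mulNr opprK polyC_natr !mulr_natl addrAC addNr add0r.
by rewrite -size_poly_eq1 -polyCMn size_polyC -mulr_natl mulf_neq0.
Qed.

Section KummerLift.
Variables (p n : nat) (p_pr : prime p).
Variables (F : fieldType) (Om : splittingFieldType F) (K : {subfield Om}).
Hypothesis galK : galois 1 K.
Variable sigma : gal_of K.
Hypothesis sigma_gen : generator 'Gal(K / 1)%g sigma.
Hypothesis cardG : #|'Gal(K / 1)%g| = (p ^ n)%N.
Variable xi : Om.
Hypothesis prim_xi : p.-primitive_root xi.
Local Notation Kh := <<K; xi>>%AS.
Local Notation Fh := <<1; xi>>%AS.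
Local Notation N := (p ^ n)%N.

Let p_gt0 := prime_gt0 p_pr.
Let p_neq0 : p%:R != 0 :> Om. Proof. exact: prim_root_natf_neq0 prim_xi. Qed.
Let sKKh : (K <= Kh)%VS. Proof. exact: subv_adjoin. Qed.
Let Kh_xi : xi \in Kh. Proof. exact: memv_adjoin. Qed.
Let Fh_xi : xi \in Fh. Proof. exact: memv_adjoin. Qed.
Let sFhKh : (Fh <= Kh)%VS. Proof. by apply/FadjoinP; rewrite sub1v. Qed.

(** Unlike xi alone, the set of all p-th roots of unity is stable under automorphisms, as the
    criterion for normality requires. *)
Lemma adjoined_roots_of_unity : adjoined K [set y | y ^+ p = 1] Kh.
Proof.
split=> // [y /= yp|B' sKB' rB'].
  by have [i ->] := prim_rootP prim_xi yp; rewrite rpredX.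
by apply/FadjoinP; split=> //; apply: rB'; exact: prim_expr_order.
Qed.

Lemma galois_Kh : galois 1 Kh.
Proof.
case/and3P: galK => _ sepK nK; rewrite /galois sub1v /=; apply/andP; split.
  apply: (@separable_trans _ _ K 1%AS Kh sepK); apply: (adjoined_separable adjoined_roots_of_unity).
  by move=> y /= yp; apply: (pth_root_separable p_neq0 _ _ yp); rewrite ?rpred1 ?oner_neq0.
apply: (adjoined_normal adjoined_roots_of_unity) => // f y /= yp.
by rewrite -rmorphXn /= yp rmorph1.
Qed.

Lemma galois_Fh_Kh : galois Fh Kh.
Proof. by apply: (galoisS _ galois_Kh); rewrite sub1v. Qed.

Lemma Kh_gal_eq1 (E : {subfield Om}) (x : gal_of E) :
  (Kh <= E)%VS -> {in K, forall a, x a = a} -> x xi = xi -> {in Kh, forall a, x a = a}.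
Proof.
move=> sKhE xK xxi.
have [y _ xy] := gal_restrict x galois_Kh sKhE.
have y1 : y = 1%g.
  apply: (adjoined_gal_eq1 adjoined_roots_of_unity) => [a Ka|z /= zp].
    by rewrite -xy ?xK // (subvP sKKh).
  by have [i ->] := prim_rootP prim_xi zp; rewrite rmorphXn /= -xy // xxi.
by move=> a Ka; rewrite xy // y1 gal_id.
Qed.

Variable sh : gal_of Kh.
Hypotheses (sh_Fh : sh \in 'Gal(Kh / Fh)%g) (shK : {in K, sh =1 sigma}).

Let shXK i : {in K, (sh ^+ i)%g =1 (sigma ^+ i)%g}.
Proof.
elim: i => [|i IHi] a Ka; first by rewrite !expg0 !gal_id.
by rewrite !expgSr !galM ?(subvP sKKh) // IHi // shK // memv_gal.
Qed.

Let order_sigma : #[sigma]%g = N.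
Proof. by rewrite -cardG (eqP sigma_gen). Qed.

Lemma sh_generator : generator 'Gal(Kh / Fh)%g sh.
Proof.
rewrite /generator finset.eqEsubset cycle_subG sh_Fh andbT; apply/fintype.subsetP=> x Gx.
have [i xK] := gal_restrict_generator x galK sKKh sigma_gen.
apply/cycleP; exists i; apply/eqP; rewrite eq_mulgV1; apply/eqP.
have Gz : (x * (sh ^+ i)^-1)%g \in 'Gal(Kh / Fh)%g by rewrite groupM ?groupV ?groupX.
apply/eqP/gal_eqP => a Ka; rewrite gal_id; move: a Ka; apply: Kh_gal_eq1 => //.
  move=> a Ka; rewrite galM ?(subvP sKKh) // xK // -shXK // -galM ?(subvP sKKh) //.
  by rewrite mulgV gal_id.
exact: (fixed_gal sFhKh Gz).
Qed.

Lemma card_Gal_Kh : #|'Gal(Kh / Fh)%g| = N.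
Proof.
rewrite (eqP sh_generator) -order_sigma -orderE; apply/eqP; rewrite eqn_dvd.
apply/andP; split; rewrite order_dvdn; apply/eqP/eqP/gal_eqP => a Ka; rewrite gal_id.
  move: a Ka; apply: Kh_gal_eq1 => // [a Ka|].
    by rewrite shXK // expg_order gal_id.
  by rewrite (fixed_gal sFhKh (groupX _ sh_Fh)).
by rewrite -shXK // expg_order gal_id.
Qed.

Variables (eps : gal_of Kh) (t : nat).
Hypotheses (eps_gen : generator 'Gal(Kh / K)%g eps) (eps_xi : eps xi = xi ^+ t).

Let eps_G : eps \in 'Gal(Kh / K)%g.
Proof. by rewrite (eqP eps_gen) cycle_id. Qed.

Let eps_K : {in K, forall a, eps a = a}.
Proof. by move=> a Ka; apply: (fixed_gal sKKh eps_G). Qed.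

Lemma gal_Kh_decomposition (x : gal_of Kh) : exists i j, x = (eps ^+ j * sh ^+ i)%g.
Proof.
have [i xK] := gal_restrict_generator x galK sKKh sigma_gen.
have : (x * (sh ^+ i)^-1)%g \in 'Gal(Kh / K)%g.
  rewrite gal_kHom //; apply/kAHomP => a Ka.
  rewrite galM ?(subvP sKKh) // xK // -shXK // -galM ?(subvP sKKh) //.
  by rewrite mulgV gal_id.
rewrite (eqP eps_gen) => /cycleP[j defj]; exists i, j.
by rewrite -defj mulgVK.
Qed.

(** Its action on xi raises to the power t^(p - 1), which is 1 modulo p by Fermat, t being prime to
    p. *)
Lemma eps_exp_pred : (eps ^+ p.-1)%g = 1%g.
Proof.
have epsX i : (eps ^+ i)%g xi = xi ^+ (t ^ i).
  elim: i => [|i IHi]; first by rewrite expg0 gal_id expn0 expr1.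
  by rewrite expgSr galM // IHi rmorphXn /= eps_xi -exprM -expnS.
have cot : coprime t p.
  rewrite coprime_sym prime_coprime //; apply/negP => /dvdnP[m defm].
  have : eps xi = 1 by rewrite eps_xi defm mulnC exprM (prim_expr_order prim_xi) expr1n.
  move/eqP; rewrite fmorph_eq1 => /eqP xi1.
  have := prim_order_dvd prim_xi 1; rewrite xi1 expr1n eqxx.
  by rewrite dvdn1 => /eqP p1; move: p_pr; rewrite p1.
apply/eqP/gal_eqP => a Ka; rewrite gal_id; move: a Ka; apply: Kh_gal_eq1 => //.
  by move=> a Ka; apply: (fixed_gal sKKh (groupX _ eps_G)).
rewrite epsX -(prim_expr_mod prim_xi) -totient_prime // Euler_exp_totient //.
by rewrite prim_expr_mod.
Qed.

Variable A : set (kummer_quot p_pr Kh).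
Hypothesis submodA : finite_submodule (kummer_act sh) A.
Hypothesis eigenA : A `<=` kummer_eigenspace eps t.
Hypothesis rootsA : forall a, A (kummer_class p_pr a) ->
  exists y : Om, y ^+ p = vsval (uval a).
Variable B : {subfield Om}.
Hypothesis adjB : adjoined Kh (kummer_roots A) B.

(** Stability under eps comes from the eigenspace condition; together with sh this covers the whole
    of Gal(Kh/F), so that B is Galois over F. *)
Lemma kummer_act_stable (x : gal_of Kh) a : A a -> A (kummer_act x a).
Proof.
have [_ A0 Al As] := submodA.
have Ae b : A b -> A (kummer_act eps b).
  by move=> Ab; rewrite (eigenA Ab) -[_ *: _]addr0; apply: Al.
have [i [j ->]] := gal_Kh_decomposition x; move=> Aa.
rewrite kummer_actM -!iter_kummer_act.
elim: i => [|i IHi] /=; last exact: As.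
by elim: j => [|j IHj] //=; apply: Ae.
Qed.

Lemma galois_B : galois 1 B.
Proof.
case/and3P: galois_Kh => _ sepKh nKh; rewrite /galois sub1v /=; apply/andP; split.
  apply: (@separable_trans _ _ Kh 1%AS B sepKh); apply: (adjoined_separable adjB) => y [b _ yb].
  by have [Eb nzb] := uvalE b; apply: (pth_root_separable p_neq0 Eb nzb yb).
apply: (adjoined_normal adjB) => // f y [b Ab yb].
have fK : (f @: Kh <= Kh)%VS.
  have := forall_inP nKh f; rewrite inE kAutfE k1AHom => /(_ isT)/eqP->.
  exact: subvv.
have [|x _ fx] := @kAut_to_gal _ _ 1%AS Kh f; first by rewrite kAut1E.
exists (gal_units x b); first by rewrite -kummer_actE; apply: kummer_act_stable.
by rewrite val_gal_units -fx ?(uvalE _).1 // -yb rmorphXn.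
Qed.

Local Notation P := 'Gal(B / Kh)%G.
Local Notation G := 'Gal(B / K)%G.

Let sKhB : (Kh <= B)%VS. Proof. by case: adjB. Qed.
Let sKB : (K <= B)%VS. Proof. exact: subv_trans sKKh sKhB. Qed.
Let inB a : a \in Kh -> a \in B. Proof. exact: (subvP sKhB). Qed.

Lemma galois_Kh_B : galois Kh B.
Proof. by apply: (galoisS _ galois_B); rewrite sub1v. Qed.

Lemma galois_K_B : galois K B.
Proof. by apply: (galoisS _ galois_B); rewrite sub1v. Qed.

Let PP (x : gal_of B) : reflect {in Kh, forall a, x a = a} (x \in P).
Proof. by rewrite gal_kHom //; apply: kAHomP. Qed.
Let GP (x : gal_of B) : reflect {in K, forall a, x a = a} (x \in G).
Proof. by rewrite gal_kHom //; apply: kAHomP. Qed.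

Lemma gal_B_eq (u w : gal_of B) : {in Kh, u =1 w} ->
  (forall y, kummer_roots A y -> u y = w y) -> u = w.
Proof.
move=> uwK uwA; apply/eqP; rewrite eq_mulgV1; apply/eqP.
have [_ rB _] := adjB.
apply: (adjoined_gal_eq1 adjB) => [a Ka|y Ay].
  by rewrite galM ?inB // uwK // -galM ?inB // mulgV gal_id.
by rewrite galM ?rB // uwA // -galM ?rB // mulgV gal_id.
Qed.

Lemma P_root (x : gal_of B) y : x \in P -> kummer_roots A y ->
  exists e : nat, x y = y * xi ^+ e.
Proof.
move=> Px [b Ab yb]; have [pr prP] := kummer_pairing_ex prim_xi Fh_xi galois_Fh_Kh rootsA adjB.
by exists (pr x (kummer_class p_pr b)); apply: (prP x _ Px Ab b).
Qed.

Lemma P_exponent : {in P, forall x, x ^+ p = 1}%g.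
Proof.
move=> x Px; have [_ rB _] := adjB.
apply: gal_B_eq => [a Ka|y Ay]; rewrite gal_id.
  exact: (PP _ (groupX _ Px)).
have [e xe] := P_root Px Ay.
have xX i : (x ^+ i)%g y = y * xi ^+ (e * i).
  elim: i => [|i IHi]; first by rewrite expg0 gal_id muln0 expr0 mulr1.
  rewrite expgSr galM ?rB // IHi rmorphM /= xe (PP _ Px) ?rpredX //.
  by rewrite -mulrA -exprD mulnS.
by rewrite xX mulnC exprM (prim_expr_order prim_xi) expr1n mulr1.
Qed.

Lemma P_pgroup : (p.-group P)%g.
Proof.
rewrite -pnat_exponent; apply: (pnat_dvd (n := p)); last exact: pnat_id.
by apply/exponentP/P_exponent.
Qed.

Lemma P_abelian : abelian P.
Proof.
have [_ rB _] := adjB.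
apply/centsP=> x Px y Py; apply: gal_B_eq => [a Ka|z Az].
  by rewrite !galM ?inB // !(PP _ Px, PP _ Py).
have [e xe] := P_root Px Az; have [f yf] := P_root Py Az.
rewrite !galM ?rB // xe yf !rmorphM /= xe yf (PP _ Px) ?(PP _ Py) ?rpredX //.
exact: mulrAC.
Qed.

(* The eigenspace condition makes a lift of eps act on p-th roots as the t-th
   power, hence commute with Gal(B / Kh). *)
Lemma eps_lift_comm (x u : gal_of B) : x \in P -> {in Kh, u =1 eps} ->
  (x * u = u * x)%g.
Proof.
move=> Px uK; have [_ rB _] := adjB.
apply: gal_B_eq => [a Ka|y Ay].
  by rewrite !galM ?inB // uK // !(PP _ Px) ?uK // memv_gal.
have [e xe] := P_root Px Ay; have [b Ab yb] := Ay.
have [Eb nzb] := uvalE b.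
have nzy : y != 0 by apply: contra nzb => /eqP y0; rewrite -yb y0 expr0n gtn_eqF.
have [w [Ew nzw epsb]] : exists w, [/\ w \in Kh, w != 0
    & eps (vsval (uval b)) = vsval (uval b) ^+ t * w ^+ p].
  have := eigenA Ab; rewrite /kummer_eigenspace /= kummer_actE scaler_nat.
  rewrite -(fpclassMn p_pr (@ppowers_mulrn (subvs_of Kh) p)).
  case/(kummer_class_eq p_pr) => w [Ew nzw wE]; exists w; split=> //.
  by move: wE; rewrite val_gal_units uvalMn rmorphXn.
have [||j uy] := @root_ratio p p_pr Om xi prim_xi (u y) (y ^+ t * w).
- by rewrite mulf_neq0 ?expf_neq0.
- by rewrite -rmorphXn /= yb uK // epsb exprMn -!exprM [(t * p)%N]mulnC exprM yb.
rewrite !galM ?rB // xe uy !rmorphM !rmorphXn /= xe uy uK // eps_xi.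
rewrite (PP _ Px _ Ew) (PP _ Px) // exprMn -!exprM [(t * e)%N]mulnC.
by rewrite -!mulrA; congr (_ * _); rewrite [RHS]mulrC -!mulrA.
Qed.

Lemma G_decomposition (u x : gal_of B) : {in Kh, u =1 eps} -> x \in G ->
  exists j, (x * (u ^+ j)^-1)%g \in P.
Proof.
move=> uK Gx; have [y _ xy] := gal_restrict x galois_Kh sKhB.
have : y \in 'Gal(Kh / K)%g.
  rewrite gal_kHom //; apply/kAHomP => a Ka; rewrite -xy ?(subvP sKKh) //.
  exact: (GP _ Gx).
rewrite (eqP eps_gen) => /cycleP[j defy]; exists j.
have uX i : {in Kh, (u ^+ i)%g =1 (eps ^+ i)%g}.
  elim: i => [|i IHi] a Ka; first by rewrite !expg0 !gal_id.
  by rewrite !expgSr !galM ?inB // IHi // uK // memv_gal.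
apply/PP=> a Ka; rewrite galM ?inB // xy // defy -uX // -galM ?inB // mulgV.
exact: gal_id.
Qed.

Lemma eps_lift : exists2 u : gal_of B, u \in G & {in Kh, u =1 eps}.
Proof.
have nB : normalField 1 B by case/and3P: galois_B.
have [u uK] := gal_extend eps galois_Kh sKhB nB; exists u => //.
by apply/GP=> a Ka; rewrite uK ?(subvP sKKh) // eps_K.
Qed.

(** G is generated by the abelian group P and one lift of eps, which commutes with P. *)
Lemma G_abelian : abelian G.
Proof.
have [u Gu uK] := eps_lift.
apply: (@abelianS _ _ (P <*> <[u]>)%G).
  apply/fintype.subsetP=> x Gx; have [j Pz] := G_decomposition uK Gx.
  rewrite -[x](mulgVK (u ^+ j)%g) groupM //.
    by rewrite mem_gen // inE Pz.
  by rewrite mem_gen // inE mem_cycle orbT.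
rewrite abelianY P_abelian cycle_abelian /= cycle_subG; apply/centP => x Px.
by rewrite /commute (eps_lift_comm Px uK).
Qed.

(** The power x^(p - 1) fixes Kh, because eps^(p - 1) = 1; as p - 1 is prime to the order of x, it
    generates the same cyclic group as x. *)
Lemma G_p_elt x : x \in G -> (p.-elt x)%g -> x \in P.
Proof.
move=> Gx px; have [u Gu uK] := eps_lift.
have Px : (x ^+ p.-1)%g \in P.
  have [y _ xy] := gal_restrict x galois_Kh sKhB.
  have : y \in 'Gal(Kh / K)%g.
    rewrite gal_kHom //; apply/kAHomP => a Ka; rewrite -xy ?(subvP sKKh) //.
    exact: (GP _ Gx).
  rewrite (eqP eps_gen) => /cycleP[j defy].
  have xX i : {in Kh, (x ^+ i)%g =1 (y ^+ i)%g}.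
    elim: i => [|i IHi] a Ka; first by rewrite !expg0 !gal_id.
    by rewrite !expgSr !galM ?inB // IHi // xy // memv_gal.
  by apply/PP=> a Ka; rewrite xX // defy expgAC eps_exp_pred expg1n gal_id.
have /eqP genx : generator <[x]> (x ^+ p.-1)%g.
  rewrite generator_coprime; have /p_natP[k ->] := px.
  by rewrite coprimeXl // coprimenP.
by rewrite -cycle_subG genx cycle_subG.
Qed.

Variable L : {subfield Om}.
Hypothesis maxL : maximal_p_extension p K B L.
Local Notation C := ('O_p^'(G))%G.

Let sKL : (K <= L)%VS. Proof. by case: maxL => /andP[/and3P[]]. Qed.
Let sLB : (L <= B)%VS. Proof. by case: maxL. Qed.

Let C_Hall : (p^'.-Hall(G) C)%g.
Proof. exact/nilpotent_pcore_Hall/abelian_nil/G_abelian. Qed.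

(** An element of C induces on L an automorphism whose order is both a power of p and prime to p,
    hence trivial. Conversely the fixed field of C has degree the index of C, a power of p since C
    is a Hall subgroup. *)
Lemma L_fixedField : L = fixedField C :> {vspace Om}.
Proof.
have [/andP[galL pL] _ maxLE] := maxL.
apply/eqP; rewrite eqEsubv; apply/andP; split.
  apply/subvP=> a La; apply/fixedFieldP; first exact: (subvP sLB).
  move=> c Cc; have Gc : c \in G := fintype.subsetP (pcore_sub _ _) c Cc.
  have aut : kAut K L c.
    apply: (@normalField_kAut _ _ K L B); rewrite ?sKL ?sLB //.
      by case/and3P: galL.
    by rewrite -gal_kAut.
  have [y Gy cy] := kAut_to_gal aut.
  suff y1 : y = 1%g by rewrite cy // y1 gal_id.
  have cX i : {in L, (c ^+ i)%g =1 (y ^+ i)%g}.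
    elim: i => [|i IHi] b Lb; first by rewrite !expg0 !gal_id.
    by rewrite !expgSr !galM ?(subvP sLB) // IHi // cy // memv_gal.
  have dvd : (#[y]%g %| #[c]%g)%N.
    rewrite order_dvdn; apply/eqP/eqP/gal_eqP => b Lb.
    by rewrite -cX // expg_order !gal_id.
  apply/eqP; rewrite -order_eq1; apply/eqP.
  apply: (@pnat_1 p); first exact: mem_p_elt pL Gy.
  by apply: (pnat_dvd dvd); apply: mem_p_elt Cc; apply: pcore_pgroup.
apply: (maxLE (fixedField C)%AS); last exact: fixedField_bound.
have galE := normal_fixedField_galois galois_K_B (pcore_normal p^' G).
rewrite /p_extension galE /pgroup -(galois_dim galE).
rewrite (dim_fixed_galois galois_K_B (pcore_sub p^' G)).
by case/and3P: C_Hall => _ _; rewrite pnatNK.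
Qed.

Lemma gal_B_L : 'Gal(B / L)%g = C.
Proof. by rewrite L_fixedField gal_fixedField. Qed.

(** C is characteristic in G, and G is normal in Gal(B/F). *)
Lemma galois_L : galois 1 L.
Proof.
have nC : (C <| 'Gal(B / 1))%g.
  apply: (char_normal_trans (pcore_char _ _)).
  have sK : (1%AS <= K <= B)%VS by rewrite sub1v.
  have nK : normalField 1%AS K by case/and3P: galK.
  exact: (@normalField_normal _ _ B 1%AS K sK nK).
have := @normal_fixedField_galois _ _ B 1%AS galois_B _ nC.
by rewrite -L_fixedField.
Qed.

(** Fixing xi and K puts x in the p-group P, and fixing L puts it in the p'-group C. *)
Lemma lift_unique (x : gal_of B) :
  x \in 'Gal(B / Fh)%g -> {in L, forall a, x a = a} -> x = 1%g.
Proof.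
move=> Gx xL; have sFhB : (Fh <= B)%VS := subv_trans sFhKh sKhB.
have Px : x \in P.
  apply/PP; apply: Kh_gal_eq1 => // [a Ka|]; first by rewrite xL // (subvP sKL).
  exact: (fixed_gal sFhB Gx).
have Cx : x \in C by rewrite -gal_B_L gal_kHom //; apply/kAHomP.
apply/eqP; rewrite -order_eq1; apply/eqP; apply: (@pnat_1 p).
  exact: mem_p_elt P_pgroup Px.
by apply: mem_p_elt Cx; apply: pcore_pgroup.
Qed.

(** Any extension of x to B is tau sb^i, with tau in G and sb a lift of sh. The p'-part of tau is
    trivial on L and may be dropped; the p-part lies in P and thus fixes xi, as sb does. *)
Lemma lift_exists (x : gal_of L) :
  exists2 y : gal_of B, y \in 'Gal(B / Fh)%g & {in L, y =1 x}.
Proof.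
have nB : normalField 1 B by case/and3P: galois_B.
have sFhB : (Fh <= B)%VS := subv_trans sFhKh sKhB.
have [x' x'L] := gal_extend x galois_L sLB nB.
have [sb sbK] := gal_extend sh galois_Kh sKhB nB.
have sbX i : {in Kh, (sb ^+ i)%g =1 (sh ^+ i)%g}.
  elim: i => [|i IHi] a Ka; first by rewrite !expg0 !gal_id.
  by rewrite !expgSr !galM ?inB // IHi // sbK // memv_gal.
have FhP (z : gal_of B) : z xi = xi -> z \in 'Gal(B / Fh)%g.
  move=> zxi; rewrite gal_kHom //; apply/kAHomP => a.
  have sF : (Fh <= fixedField [set z]%SET)%VS.
    apply/FadjoinP; split; first exact: sub1v.
    by apply/fixedFieldP; [exact: inB | move=> _ /set1P->].
  by case/(subvP sF)/mem_fixedFieldP=> _ fix_a; apply: fix_a; rewrite inE.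
have [i x'K] := gal_restrict_generator x' galK sKB sigma_gen.
pose tau := (x' * (sb ^+ i)^-1)%g.
have Gtau : tau \in G.
  apply/GP=> a Ka; have Kha := subvP sKKh a Ka.
  rewrite galM ?inB // x'K // -shXK // -sbX // -galM ?inB //.
  by rewrite mulgV gal_id.
exists (tau.`_p * sb ^+ i)%g => [|a La].
  have Ptau : (tau.`_p)%g \in P by apply: G_p_elt; rewrite ?groupX ?p_elt_constt.
  apply: FhP; rewrite galM ?inB // (PP _ Ptau) // sbX //.
  by rewrite (fixed_gal sFhKh (groupX _ sh_Fh)).
have Ctau : (tau.`_p^')%g \in 'Gal(B / L)%g.
  rewrite gal_B_L (mem_normal_Hall C_Hall (pcore_normal _ _)) ?p_elt_constt //.
  exact: groupX.
rewrite -x'L // (_ : x' = tau.`_p^' * (tau.`_p * sb ^+ i))%g; last first.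
  by rewrite mulgA -[(tau.`_p)%g]consttNK consttC mulgVK.
by rewrite [RHS]galM ?(subvP sLB) // (fixed_gal sLB Ctau).
Qed.
End KummerLift.

(** * Assembly of the two characteristics *)

Theorem theorem4p4 (p n : nat) (p_pr : prime p)
    (F : fieldType) (Om : splittingFieldType F) (K : {subfield Om})
    (galK : galois 1 K) (sigma : gal_of K)
    (sigma_gen : generator 'Gal(K / 1)%g sigma)
    (cardG : #|'Gal(K / 1)%g| = (p ^ n)%N)
    (M : vectType 'F_p) (s : 'End(M))
    (s_pn : forall m, iter (p ^ n) s m = m)
    (mu : nat) (mu_gt0 : (0 < mu)%N) (mu_le : (mu <= p ^ n)%N)
    (mu_summand : mu = (p ^ n)%N \/ has_cyclic_summand s (p ^ n) mu)
    (r : nat) (alpha : 'I_r -> M)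
    (alpha_dec : cyclic_decomposition s (p ^ n) alpha)
    (a0 : M) (a0_alpha : (mu < p ^ n)%N -> exists i0, a0 = alpha i0)
    (a0_dim : (mu < p ^ n)%N -> \dim (cyclicv s (p ^ n) a0) = mu) :
  let phi := @bullet_proj F Om p n p_pr M s s_pn mu a0 mu_gt0 a0_dim K sigma in
  (p \notin [pchar subvs_of K] ->
   forall (xi : Om), p.-primitive_root xi ->
   let Kh := <<K; xi>>%AS in
   let Fh := <<1; xi>>%AS in
   forall (sh : gal_of Kh), sh \in 'Gal(Kh / Fh)%g -> {in K, sh =1 sigma} ->
   forall (eps : gal_of Kh) (t : nat),
     generator 'Gal(Kh / K)%g eps -> eps xi = xi ^+ t ->
   forall A : set (kummer_quot p_pr Kh),
     finite_submodule (kummer_act sh) A ->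
     A `<=` kummer_eigenspace eps t ->
     (forall a, A (kummer_class p_pr a) ->
        exists y : Om, y ^+ p = vsval (uval a)) ->
   forall B L : {subfield Om},
     adjoined Kh (kummer_roots A) B -> maximal_p_extension p K B L ->
   solves_embedding L phi <->
     module_iso (kummer_act sh) s A
     /\ mu = lambda (kummer_act sh) (p ^ n) (kummer_index Fh xi sh) A)
  /\
  (forall chK : p \in [pchar subvs_of K],
   forall A : set (as_quot p_pr chK),
     finite_submodule (as_act sigma) A ->
     (forall a, A (as_class p_pr chK a) ->
        exists y : Om, y ^+ p - y = vsval a) ->
   forall L : {subfield Om},
     adjoined K (as_roots A) L ->
   solves_embedding L phi <->
     module_iso (as_act sigma) s A
     /\ mu = lambda (as_act sigma) (p ^ n) (as_index sigma) A).
Proof.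
move=> phi; have sigmaN : #[sigma]%g = (p ^ n)%N by rewrite -cardG (eqP sigma_gen).
split.
  move=> _ xi prim_xi Kh Fh sh sh_Fh shK eps t eps_gen eps_xi A submodA eigenA rootsA.
  move=> B L adjB maxL.
  have Fh_xi : xi \in Fh by exact: memv_adjoin.
  have sKKh : (K <= Kh)%VS by exact: subv_adjoin.
  have sKhB : (Kh <= B)%VS by case: adjB.
  have sFhKh : (Fh <= Kh)%VS by apply/FadjoinP; rewrite sub1v memv_adjoin.
  have [/andP[/and3P[sKL _ _] _] sLB _] := maxL.
  have galKh := galois_Kh galK prim_xi.
  have galFhKh := galois_Fh_Kh galK prim_xi.
  have sh_gen := sh_generator galK sigma_gen prim_xi sh_Fh shK.
  have cardh := card_Gal_Kh galK sigma_gen cardG prim_xi sh_Fh shK.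
  have galB := galois_B galK sigma_gen prim_xi shK eps_gen submodA eigenA adjB.
  have galKhB := galois_Kh_B galK sigma_gen prim_xi shK eps_gen submodA eigenA adjB.
  have galL := galois_L galK sigma_gen prim_xi shK eps_gen eps_xi submodA eigenA
    rootsA adjB maxL.
  have uniq (x : gal_of B) := @lift_unique p p_pr F Om K galK sigma sigma_gen xi prim_xi sh
    shK eps t eps_gen eps_xi A submodA eigenA rootsA B adjB L maxL x.
  have lift_ex := lift_exists galK sigma_gen prim_xi sh_Fh shK eps_gen eps_xi submodA
    eigenA rootsA adjB maxL.
  have [pr prP] := kummer_pairing_ex prim_xi Fh_xi galFhKh rootsA adjB.
  have nB : normalField 1 B by case/and3P: galB.
  have inB a : a \in L -> a \in B by exact: (subvP sLB).
  (* Existence and uniqueness of lifts identify Gal(L/F) with Gal(B/F(xi)) and Gal(L/K) with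
     Gal(B/Kh); the pairing required on L is the Kummer pairing composed with [lift]. *)
  have /choice[lift liftP] : forall x : gal_of L, exists y : gal_of B,
      y \in 'Gal(B / Fh)%g /\ {in L, y =1 x}.
    by move=> x; have [y Gy yx] := lift_ex x; exists y.
  have liftG x : lift x \in 'Gal(B / Fh)%g by case: (liftP x).
  have liftL x : {in L, lift x =1 x} by case: (liftP x).
  have lift_eq (y : gal_of B) (x : gal_of L) :
      y \in 'Gal(B / Fh)%g -> {in L, y =1 x} -> lift x = y.
    move=> Gy yx; apply/eqP; rewrite eq_mulgV1; apply/eqP/uniq.
      by rewrite groupM ?groupV.
    by move=> a La; rewrite galM ?inB // liftL // -yx // -galM ?inB // mulgV gal_id.
  have liftM x y : lift (x * y)%g = (lift x * lift y)%g.
    apply: lift_eq => [|a La]; first by rewrite groupM.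
    by rewrite !galM ?inB // !liftL // memv_gal.
  have liftX x i : lift (x ^+ i)%g = (lift x ^+ i)%g.
    elim: i => [|i IHi]; last by rewrite !expgS liftM IHi.
    by apply: lift_eq => [|a La]; rewrite ?group1 // !expg0 !gal_id.
  have liftV x : lift (x^-1)%g = ((lift x)^-1)%g.
    by apply: (mulgI (lift x)); rewrite -liftM !mulgV (liftX x 0).
  have liftJ x y : lift (x ^ y)%g = (lift x ^ lift y)%g.
    by rewrite !conjgE !liftM liftV.
  have lift_Delta x : x \in 'Gal(L / K)%g -> lift x \in 'Gal(B / Kh)%g.
    move=> Dx; rewrite gal_kHom //; apply/kAHomP.
    apply: (Kh_gal_eq1 galK prim_xi) => // [a Ka|].
      by rewrite liftL ?(subvP sKL) // (fixed_gal sKL Dx).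
    exact: (fixed_gal (subv_trans sFhKh sKhB) (liftG x)).
  have Delta_lift (y : gal_of B) : y \in 'Gal(B / Kh)%g ->
      exists2 x, x \in 'Gal(L / K)%g & lift x = y.
    move=> Gy; have [x _ yx] := gal_restrict y galL sLB; exists x.
      rewrite gal_kHom //; apply/kAHomP => a Ka; rewrite -yx ?(subvP sKL) //.
      by rewrite (fixed_gal sKhB Gy) // (subvP sKKh).
    by apply: lift_eq => //; apply: fintype.subsetP Gy; apply: galS.
  (* The lift g of sigma is taken as the restriction of an extension [sb] of sh, which makes [sb]
     the lift of g and lets the Kummer lemmas apply to it. *)
  have [sb sbK] := gal_extend sh galKh sKhB nB.
  have [g _ sbg] := gal_restrict sb galL sLB.
  have liftg : lift g = sb.
    apply: lift_eq => //; rewrite gal_kHom ?(subv_trans sFhKh) //; apply/kAHomP => a Fa.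
    by rewrite sbK ?(subvP sFhKh) // (fixed_gal sFhKh sh_Fh).
  have gK : {in K, g =1 sigma}.
    by move=> a Ka; rewrite -sbg ?(subvP sKL) // sbK ?(subvP sKKh) // shK.
  have resK x := gal_restrict_generator x galK sKL sigma_gen.
  have gJ x : x \in 'Gal(L / K)%g -> (x ^ g)%g \in 'Gal(L / K)%g.
    rewrite !gal_kHom // => /kAHomP xK; apply/kAHomP => a Ka.
    have La := subvP sKL a Ka; have [i giK] := resK (g^-1)%g.
    have Kga : (g^-1)%g a \in K by rewrite giK // memv_gal.
    rewrite conjgE !galM ?memv_gal // xK //.
    by rewrite -galM // mulVg gal_id.
  apply: (@solves_embedding_pairing p n p_pr F Om K L sigma sigmaN sKL M s s_pn mu a0
    mu_gt0 a0_dim mu_le r alpha alpha_dec a0_alpha g gK resK _ _ A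
    (kummer_index Fh xi sh) submodA (kummer_actD sh) _ (fun x => pr (lift x))).
  - by move=> x _; apply: (kummer_act_order sh_gen cardh).
  - move=> x y Dx Dy a Aa /=; rewrite liftM.
    exact: (kummer_pairingM prim_xi Fh_xi galFhKh rootsA adjB prP (lift_Delta x Dx)
      (lift_Delta y Dy) Aa).
  - move=> x Dx a b Aa Ab /=.
    exact: (kummer_pairingD prim_xi submodA rootsA adjB prP (lift_Delta x Dx) Aa Ab).
  - move=> x Dx pr0.
    have lx1 : lift x = 1%g.
      exact: (kummer_pairing_faithful adjB prP (lift_Delta x Dx) pr0).
    by apply/eqP/gal_eqP => a La; rewrite -liftL // lx1 !gal_id.
  - move=> a Aa pr0; apply: (kummer_pairing_nondegenerate rootsA adjB galKhB prP Aa).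
    by move=> y /Delta_lift[x Dx <-]; apply: pr0.
  - move=> x Dx a Aa /=; rewrite liftJ liftg.
    apply: (kummer_pairingJ prim_xi Fh_xi galFhKh sh_gen submodA rootsA adjB sbK prP) => //.
      exact: lift_Delta.
    by rewrite -liftg -liftJ; apply/lift_Delta/gJ.
  - move=> a Aa sum0 /=; rewrite liftX liftg.
    exact: (kummer_pairing_index prim_xi Fh_xi galFhKh sh_gen cardh rootsA adjB sbK prP).
move=> chK A submodA rootsA L adjL.
have sKL : (K <= L)%VS by case: adjL.
have nL := as_normal galK sigma_gen submodA adjL.
have [g gK] := gal_extend sigma galK sKL nL.
have [pr prP] := as_pairing_ex rootsA adjL.
have resK x := gal_restrict_generator x galK sKL sigma_gen.
apply: (@solves_embedding_pairing p n p_pr F Om K L sigma sigmaN sKL M s s_pn mu a0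
  mu_gt0 a0_dim mu_le r alpha alpha_dec a0_alpha g gK resK _ _ A
  (as_index sigma) submodA (as_actD sigma (chK := chK)) _ pr).
- by move=> x _; apply: (as_act_order sigma_gen cardG).
- exact: (as_pairingM rootsA adjL prP).
- exact: (as_pairingD submodA rootsA adjL prP).
- exact: (as_pairing_faithful adjL prP).
- exact: (as_pairing_nondegenerate galK sigma_gen submodA rootsA adjL prP).
- exact: (as_pairingJ galK sigma_gen submodA rootsA adjL gK prP).
- exact: (as_pairing_index galK sigma_gen cardG rootsA adjL gK prP).
Qed.
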